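(* Let $N\subset\mathbb Z^3$ be the set of all lattice points of a convex polytope in $\mathbb R^3$, let $h:\mathbb Z^3\to\mathbb Z$ be the third coordinate, and let $f$ be a general Laurent polynomial on $(\mathbb C^* )^3$ with Newton polytope $N$. Let $p:\{f=0\}\to(\mathbb C^* )^2$ be the projection forgetting the third coordinate. Assume that $A:=h(N)\subset\mathbb Z$ has at least six elements and that no proper arithmetic progression $a\mathbb Z+b\subsetneq\mathbb Z$ contains $|A|-1$ of its elements. Then all multisingularities of $p$ are stable, i.e. they are folds, cusps and double folds, modulo removing regular germs from multigerms.
   Context: ''General'' means: for all $f=\sum_{b\in N}c_bx^b$ with coefficient vector in some nonempty Zariski open subset of $\mathbb C^N$. For a map $p$ between complex surfaces and a point $q$ of the target, the multisingularity of $p$ at $q$ is the equivalence class (under local automorphisms of the source germs and of the common target germ) of the tuple of germs of $p$ at the points of $p^{-1}(q)$. A regular germ is the germ of a local isomorphism. Up to equivalence, a fold is the germ $(\mathbb C^2,0)\to(\mathbb C^2,0)$, $(x,y)\mapsto(x,y^2)$; a cusp is the germ $(x,y)\mapsto(x,y^3+xy)$; a double fold is the pair of germs $(x_1,y_1)\mapsto(x_1,y_1^2)$, $(x_2,y_2)\mapsto(x_2^2,y_2)$ with the common target $(\mathbb C^2,0)$. So the claim says that for every $q$, after removing the regular germs, the multigerm of $p$ at $q$ is empty, a single fold, a single cusp, or a double fold. *)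

(* Defs.v *)
From Stdlib Require List.
From HB Require Import structures.
From mathcomp Require Import all_boot all_order all_algebra finmap.
From mathcomp Require Import complex.
From mathcomp Require Import all_classical all_reals all_analysis.
(* mpoly is not imported: its notations clash with those of all_analysis. *)
From mathcomp Require mpoly.

Set Implicit Arguments.
Unset Strict Implicit.
Unset Printing Implicit Defensive.

Import Order.TTheory GRing.Theory Num.Theory.
Import numFieldNormedType.Exports.

Local Open Scope classical_set_scope.
Local Open Scope ring_scope.

Notation lattice3 := (int * int * int)%type.

Definition height (b : lattice3) : int := b.2.

Definition heights (N : {fset lattice3}) : {fset int} :=
  [fset height b | b in N]%fset.

Definition real_space (R : realType) : lmodType R := (R^o * R^o * R^o)%type.

Definition lattice_to_real (R : realType) (b : lattice3) : real_space R :=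
  (b.1.1%:~R, b.1.2%:~R, b.2%:~R).

Definition convex_hull (R : realType) (V : set (real_space R)) :
    set (real_space R) :=
  smallest (@convex_set R (real_space R)) V.

Definition convex_polytope (R : realType) (K : set (real_space R)) : Prop :=
  exists2 V : set (real_space R), finite_set V & K = convex_hull V.

Definition arith_prog (a b : int) : set int := [set a * k + b | k in setT].

(* R[i]^o carries the norm and the topology of the complex numbers. *)
Notation Cplx R := ((complex R)^o).
Notation Cplane R := (Cplx R * Cplx R)%type.
Notation Cspace R := (Cplx R * Cplx R * Cplx R)%type.

(* C^T for a finite index type T; the variables of the polynomials are matched
   with the elements of T through enum_val. *)
Definition zariski_open (R : realType) (T : finType) (U : set (T -> complex R)) :
    Prop :=
  exists S : set (mpoly.mpoly #|T| (complex R)),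
    U = [set c | exists2 P, S P & mpoly.meval (fun i => c (enum_val i)) P != 0].

Definition laurent_monomial (R : realType) (b : lattice3) (x : Cspace R) : complex R :=
  (x.1.1 : complex R) ^ b.1.1 * (x.1.2 : complex R) ^ b.1.2 *
  (x.2 : complex R) ^ b.2.

Definition laurent (R : realType) (N : {fset lattice3}) (c : N -> complex R)
    (x : Cspace R) : complex R :=
  \sum_(b : N) c b * laurent_monomial (val b) x.

Definition surface (R : realType) (N : {fset lattice3}) (c : N -> complex R) :
    set (Cspace R) :=
  [set x | [/\ x.1.1 != 0, x.1.2 != 0, x.2 != 0 & laurent c x = 0]].

Definition proj_xy (R : realType) (x : Cspace R) : Cplane R := x.1.

(* Differentiability is over R[i], i.e. complex Frechet differentiability. *)
Definition holomorphic_at (R : realType) (V W : normedModType (complex R))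
    (phi : V -> W) (x : V) : Prop :=
  \forall u \near x, differentiable phi u.

(* phi induces an isomorphism of germs of complex spaces (X, x) -> (Y, y);
   functions on X and Y are restrictions of ambient holomorphic functions.
   For X = C^k this says that Y is a k-dimensional complex submanifold near y
   and that phi is a holomorphic parametrization of it. *)
Definition biholomorphic_germ (R : realType) (V W : normedModType (complex R))
    (X : set V) (x : V) (Y : set W) (y : W) (phi : V -> W) : Prop :=
  exists psi : W -> V,
    [/\ holomorphic_at phi x, holomorphic_at psi y,
        phi x = y /\ psi y = x,
        \forall u \near x, X u -> Y (phi u) /\ psi (phi u) = u &
        \forall v \near y, Y v -> X (psi v) /\ phi (psi v) = v].

Definition regular_germ (R : realType) (M : set (Cspace R))
    (p : Cspace R -> Cplane R) (z : Cspace R) : Prop :=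
  biholomorphic_germ M z setT (p z) p.

Definition fold_germ (R : realType) (u : Cplane R) : Cplane R :=
  (u.1, u.2 ^+ 2).

Definition fold_germ' (R : realType) (u : Cplane R) : Cplane R :=
  (u.1 ^+ 2, u.2).

Definition cusp_germ (R : realType) (u : Cplane R) : Cplane R :=
  (u.1, u.2 ^+ 3 + u.1 * u.2).

(* The multigerm of p : M -> C^2 at the points zs over q is equivalent to the
   multigerm gs of maps (C^2, 0) -> (C^2, 0): one change of coordinates psi in
   the target is shared by all the branches, while each branch has its own
   coordinates phi in the source. *)
Definition multigerm_equiv (R : realType) (M : set (Cspace R))
    (p : Cspace R -> Cplane R) (q : Cplane R) (zs : seq (Cspace R))
    (gs : seq (Cplane R -> Cplane R)) : Prop :=
  exists2 psi : Cplane R -> Cplane R,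
    biholomorphic_germ setT q setT 0 psi &
    List.Forall2 (fun z g =>
      exists2 phi : Cplane R -> Cspace R,
        biholomorphic_germ setT 0 M z phi &
        \forall u \near (0 : Cplane R), psi (p (phi u)) = g u) zs gs.

Definition stable_multisingularity (R : realType) (M : set (Cspace R))
    (p : Cspace R -> Cplane R) (q : Cplane R) : Prop :=
  exists2 zs : seq (Cspace R),
    uniq zs /\
    (forall z, z \in zs <-> [/\ M z, p z = q & ~ regular_germ M p z]) &
    [\/ multigerm_equiv M p q zs [::],
        multigerm_equiv M p q zs [:: @fold_germ R],
        multigerm_equiv M p q zs [:: @cusp_germ R] |
        multigerm_equiv M p q zs [:: @fold_germ R; @fold_germ' R]].

(* Main.v *)
Require Import Defs.
From HB Require Import structures.
From mathcomp Require Import all_boot all_order all_algebra finmap.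
From mathcomp Require Import complex.
From mathcomp Require Import all_classical all_reals all_analysis.
From mathcomp Require Import ring lra zify.
From mathcomp Require mpoly.

(* Write f = g_q(z) with q = (x, y), up to a monomial factor. The fiber over q has
   singularities other than a fold, a cusp or a transverse double fold only if one of
   six systems of equations holds; each system is linear in the coefficients c and
   involves the values h^k z_j^h on the support, where z_j are the multiple roots.

   When these values are linearly independent the equations cut out a family of
   dimension less than that of the coefficient space, or, for the transversality
   conditions, the set of critical values of a dominant map, which is thin by an
   algebraic Sard lemma. Dependence is excluded with the six heights: by Rolle's
   theorem real exponential polynomials with few terms have few zeros, so dependence
   at ratios z_2/z_1 forces an algebraic relation with finitely many solutions, and
   the remaining ratios would be roots of unity for which all heights but one lie in
   an arithmetic progression. If 1 and the exponents are dependent, the surface is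
   invariant under a one-parameter group, and one coordinate can be normalized to 1.

   For the other coefficients, g_q splits near each multiple root z_0 as
   (monic of degree m) * (nonvanishing), with coefficients holomorphic in q: the
   multiplication of polynomials is a local isomorphism at coprime factors. Completing
   the square or the cube in the first factor gives the normal forms. *)

Set Implicit Arguments.
Unset Strict Implicit.
Unset Printing Implicit Defensive.

Import Order.TTheory GRing.Theory Num.Theory numFieldNormedType.Exports.
Local Open Scope classical_set_scope.
Local Open Scope ring_scope.

Local Notation "x %:C" := (real_complex _ x) (format "x %:C") : ring_scope.

(** * Thin sets of coefficient vectors *)

(** Thinness means containment in the zero set of one nonzero polynomial, and dimension theory is
    replaced by counting: a rational map with too few parameters satisfies a polynomial relation
    because the monomials of bounded degree in the target outnumber the available dimensions in the
    source.

    The number six is the size of the largest system: three double roots impose the functionals h^e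
    z_j^h with e < 2 and j < 3 on the five unknowns x, y, z_1, z_2, z_3. Rolle's bound handles six
    coefficients on six heights, but only for positive real bases, while the ratios of roots are
    complex; this obstacle shapes the proof. Independence is checked at the ratios 2 and 3 and
    spreads to a nonempty Zariski open set. A relation at a complex ratio t is multiplied by its
    conjugate, which yields a relation with the real base |t|^2. Where the rank drops, the lost
    condition is made up for either by the equation of the degeneracy locus or by a finite list of
    ratios, which leaves x, y and a single root as unknowns. *)

Lemma poly_nonroot (F : numDomainType) (P : {poly F}) :
  P != 0 -> exists n : nat, P.[n%:R] != 0.
Proof.
move=> P0; apply/not_existsP => H.
pose rs := [seq (i%:R : F) | i <- iota 0 (size P)].
have : (size rs < size P)%N.
  apply: max_poly_roots => //.
    apply/allP => x /mapP[i _ ->]; apply/rootP.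
    by have := H i; move/negP; rewrite negbK => /eqP.
  by rewrite map_inj_uniq ?iota_uniq // => a b /eqP; rewrite eqr_nat => /eqP.
by rewrite size_map size_iota ltnn.
Qed.

Section PolyFun.
Variable F : numFieldType.

(** Functions rather than formal polynomials: the index types are sums, options and subtypes, and
    substitution is plain composition. A multivariate polynomial is recovered only at the end,
    through [polyfun_mpoly]. *)
Inductive polyfun (I : Type) : ((I -> F) -> F) -> Prop :=
| polyfun_cst c : polyfun (fun=> c)
| polyfun_var i : polyfun (fun p => p i)
| polyfunD f g : polyfun f -> polyfun g -> polyfun (fun p => f p + g p)
| polyfunM f g : polyfun f -> polyfun g -> polyfun (fun p => f p * g p).

Arguments polyfun_cst {I} c.

Lemma polyfun_ext I (f g : (I -> F) -> F) : f =1 g -> polyfun f -> polyfun g.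
Proof. by move=> /funext ->. Qed.

Lemma polyfunN I (f : (I -> F) -> F) : polyfun f -> polyfun (fun p => - f p).
Proof.
move=> pf; apply: (@polyfun_ext _ (fun p => -1 * f p)).
  by move=> p; rewrite mulN1r.
exact: polyfunM (polyfun_cst _) pf.
Qed.

Lemma polyfun_sum I (J : Type) (r : seq J) (P : pred J) (f : J -> (I -> F) -> F) :
  (forall j, polyfun (f j)) -> polyfun (fun p => \sum_(j <- r | P j) f j p).
Proof.
move=> pf; elim: r => [|j r IH].
  by apply: polyfun_ext (polyfun_cst 0) => p; rewrite big_nil.
case Pj: (P j).
  apply: polyfun_ext (polyfunD (pf j) IH) => p.
  by rewrite big_cons Pj.
by apply: polyfun_ext IH => p; rewrite big_cons Pj.
Qed.

Lemma polyfun_prod I (J : Type) (r : seq J) (P : pred J) (f : J -> (I -> F) -> F) :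
  (forall j, polyfun (f j)) -> polyfun (fun p => \prod_(j <- r | P j) f j p).
Proof.
move=> pf; elim: r => [|j r IH].
  by apply: polyfun_ext (polyfun_cst 1) => p; rewrite big_nil.
case Pj: (P j).
  apply: polyfun_ext (polyfunM (pf j) IH) => p.
  by rewrite big_cons Pj.
by apply: polyfun_ext IH => p; rewrite big_cons Pj.
Qed.

Lemma polyfunX I (f : (I -> F) -> F) k : polyfun f -> polyfun (fun p => f p ^+ k).
Proof.
move=> pf; elim: k => [|k IH].
  by apply: polyfun_ext (polyfun_cst 1) => p; rewrite expr0.
by apply: polyfun_ext (polyfunM pf IH) => p; rewrite exprS.
Qed.

Lemma polyfun_det I n (A : (I -> F) -> 'M[F]_n) :
  (forall i j, polyfun (fun p => A p i j)) -> polyfun (fun p => \det (A p)).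
Proof.
move=> pA; apply: polyfun_sum => s; apply: polyfunM; first exact: polyfun_cst.
exact: polyfun_prod.
Qed.

Lemma polyfun_adj I n (A : (I -> F) -> 'M[F]_n) i j :
  (forall i j, polyfun (fun p => A p i j)) -> polyfun (fun p => (\adj (A p)) i j).
Proof.
move=> pA; apply: (@polyfun_ext _ (fun p => cofactor (A p) j i)).
  by move=> p; rewrite mxE.
apply: polyfunM; first exact: polyfun_cst.
apply: polyfun_det => k l; apply: polyfun_ext (pA (lift j k) (lift i l)) => p.
by rewrite !mxE.
Qed.

Lemma polyfun_comp I J (f : (I -> F) -> F) (u : I -> (J -> F) -> F) :
  polyfun f -> (forall i, polyfun (u i)) -> polyfun (fun w => f (u^~ w)).
Proof.
move=> pf pu; elim: pf => [c|i|g h _ pg _ ph|g h _ pg _ ph].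
- exact: polyfun_cst.
- exact: polyfun_ext (pu i).
- exact: polyfunD.
- exact: polyfunM.
Qed.

Section MultivariatePolynomials.
Import (canonicals) mpoly.

Lemma polyfun_mpoly (T : finType) (f : (T -> F) -> F) : polyfun f ->
  exists P : mpoly.mpoly #|T| F,
    forall c : T -> F, mpoly.meval (fun i => c (enum_val i)) P = f c.
Proof.
elim=> [a|i|g h _ [P HP] _ [Q HQ]|g h _ [P HP] _ [Q HQ]].
- by exists (mpoly.mpolyC _ a) => c; rewrite mpoly.mevalC.
- exists (mpoly.mpolyX F (mpoly.mnm1 (enum_rank i))) => c.
  by rewrite mpoly.mevalXU enum_rankK.
- by exists (P + Q) => c; rewrite mpoly.mevalD HP HQ.
- by exists (P * Q) => c; rewrite mpoly.mevalM HP HQ.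
Qed.

End MultivariatePolynomials.

Lemma polyfun_line I (f : (I -> F) -> F) (p v : I -> F) : polyfun f ->
  exists P : {poly F}, forall t, f (fun i => p i + t * v i) = P.[t].
Proof.
elim=> [a|i|g h _ [P HP] _ [Q HQ]|g h _ [P HP] _ [Q HQ]].
- by exists a%:P => t; rewrite hornerC.
- by exists ((p i)%:P + (v i)%:P * 'X) => t; rewrite !hornerE mulrC.
- by exists (P + Q) => t; rewrite HP HQ hornerD.
- by exists (P * Q) => t; rewrite HP HQ hornerM.
Qed.

(** Irreducibility of affine space: on the line through [p] and [q] both functions restrict to
    nonzero univariate polynomials, whose product has a nonroot. *)
Lemma polyfun_nzM I (f g : (I -> F) -> F) p q : polyfun f -> polyfun g ->
  f p != 0 -> g q != 0 -> exists r, f r != 0 /\ g r != 0.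
Proof.
move=> pf pg fp gq.
have [P HP] := polyfun_line p (fun i => q i - p i) pf.
have [Q HQ] := polyfun_line p (fun i => q i - p i) pg.
have P0 : P != 0.
  apply: contraNneq fp => P0; have := HP 0; rewrite P0 horner0 => <-.
  by apply/eqP; congr f; apply/funext => i; rewrite mul0r addr0.
have Q0 : Q != 0.
  apply: contraNneq gq => Q0; have := HQ 1; rewrite Q0 horner0 => <-.
  by apply/eqP; congr g; apply/funext => i; rewrite mul1r addrC subrK.
have [n] := poly_nonroot (mulf_neq0 P0 Q0).
rewrite hornerM mulf_eq0 negb_or -HP -HQ => /andP[fn gn].
by exists (fun i => p i + n%:R * (q i - p i)).
Qed.

Definition pnz I (f : (I -> F) -> F) := polyfun f /\ exists p, f p != 0.

Lemma pnzM I (f g : (I -> F) -> F) : pnz f -> pnz g -> pnz (fun p => f p * g p).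
Proof.
move=> [pf [p fp]] [pg [q gq]]; split; first exact: polyfunM.
have [r [fr gr]] := polyfun_nzM pf pg fp gq.
by exists r; rewrite mulf_neq0.
Qed.

Lemma pnz_prod I (J : Type) (r : seq J) (f : J -> (I -> F) -> F) :
  (forall j, pnz (f j)) -> pnz (fun p => \prod_(j <- r) f j p).
Proof.
move=> pf; elim: r => [|j r IH].
  split; first by apply: polyfun_ext (polyfun_cst 1) => p; rewrite big_nil.
  by exists (fun=> 0); rewrite big_nil oner_neq0.
have [H1 [p H2]] := pnzM (pf j) IH; split.
  by apply: polyfun_ext H1 => q; rewrite big_cons.
by exists p; rewrite big_cons.
Qed.

Definition thin (T : Type) (B : set (T -> F)) :=
  exists P, pnz P /\ forall c, B c -> P c = 0.

Lemma thinS T (A B : set (T -> F)) : A `<=` B -> thin B -> thin A.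
Proof. by move=> AB [P [HP PB]]; exists P; split=> // c /AB/PB. Qed.

Lemma thinU T (A B : set (T -> F)) : thin A -> thin B -> thin (A `|` B).
Proof.
move=> [P [HP PA]] [Q [HQ QB]]; exists (fun p => P p * Q p); split.
  exact: pnzM.
by move=> c [/PA ->|/QB ->]; rewrite ?mul0r ?mulr0.
Qed.

Lemma thin0 T : thin (set0 : set (T -> F)).
Proof.
exists (fun=> 1); split=> //; split; first exact: polyfun_cst.
by exists (fun=> 0); rewrite oner_neq0.
Qed.

Lemma thin_bigU T (J : eqType) (r : seq J) (A : J -> set (T -> F)) :
  (forall j, j \in r -> thin (A j)) -> thin [set c | exists2 j, j \in r & A j c].
Proof.
elim: r => [|j r IH] H.
  by apply: thinS (@thin0 T) => c [].
have tj : thin (A j) by apply: H; rewrite mem_head.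
have tr : thin [set c | exists2 j, j \in r & A j c].
  by apply: IH => k kr; apply: H; rewrite in_cons kr orbT.
apply: thinS (thinU tj tr) => c [k].
by rewrite in_cons => /orP[/eqP ->|kr] Ak; [left|right; exists k].
Qed.

Lemma thin_finU T (J : finType) (A : J -> set (T -> F)) :
  (forall j, thin (A j)) -> thin [set c | exists j, A j c].
Proof.
move=> H; apply: thinS (@thin_bigU T _ (enum J) A (fun j _ => H j)).
by move=> c [j Aj]; exists j => //; rewrite mem_enum.
Qed.

(** * Monomials of bounded degree in each variable *)

Section Box.
Variable I : finType.
Implicit Types (f g : (I -> F) -> F).

Definition mono (e : I -> nat) (p : I -> F) := \prod_i p i ^+ e i.

Lemma polyfun_mono e : polyfun (mono e).
Proof. by apply: polyfun_prod => i; apply: polyfunX; exact: polyfun_var. Qed.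

(** The degree is bounded in each variable separately, so that the number of monomials is exactly a
    power of [d.+1] and the comparison of dimensions becomes arithmetic. *)
Inductive bdeg (d : nat) : ((I -> F) -> F) -> Prop :=
| bdeg0 : bdeg d (fun=> 0)
| bdegS c e f : (forall i, e i <= d)%N -> bdeg d f ->
    bdeg d (fun p => c * mono e p + f p).

Lemma bdeg_ext d f g : f =1 g -> bdeg d f -> bdeg d g.
Proof. by move=> /funext ->. Qed.

Lemma bdegD d f g : bdeg d f -> bdeg d g -> bdeg d (fun p => f p + g p).
Proof.
move=> bf bg; elim: bf => [|c e h He bh IH].
  by apply: bdeg_ext bg => p; rewrite add0r.
by apply: bdeg_ext (bdegS c He IH) => p; rewrite addrA.
Qed.

Lemma bdegW d d' f : (d <= d')%N -> bdeg d f -> bdeg d' f.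
Proof.
move=> dd'; elim=> [|c e h He bh IH]; first exact: bdeg0.
by apply: bdegS => // i; exact: leq_trans (He i) dd'.
Qed.

Lemma bdeg_mono d c e : (forall i, e i <= d)%N -> bdeg d (fun p => c * mono e p).
Proof.
by move=> He; apply: bdeg_ext (bdegS c He (bdeg0 _)) => p; rewrite addr0.
Qed.

Lemma bdegM d d' f g : bdeg d f -> bdeg d' g -> bdeg (d + d') (fun p => f p * g p).
Proof.
move=> bf bg; elim: bf => [|c e h He bh IH].
  by apply: bdeg_ext (bdeg0 _) => p; rewrite mul0r.
have : bdeg (d + d') (fun p => (c * mono e p) * g p).
  elim: bg => [|c' e' h' He' bh' IH'].
    by apply: bdeg_ext (bdeg0 _) => p; rewrite mulr0.
  have He2 i : (e i + e' i <= d + d')%N by exact: leq_add.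
  apply: bdeg_ext (bdegS (c * c') He2 IH') => p.
  rewrite mulrDr /mono; congr (_ + _).
  under eq_bigr do rewrite exprD.
  by rewrite big_split /= mulrACA.
by move=> H; apply: bdeg_ext (bdegD H IH) => p; rewrite mulrDl.
Qed.

Lemma bdeg_cst c : bdeg 0 (fun=> c).
Proof.
apply: bdeg_ext (@bdeg_mono 0 c (fun=> 0%N) _) => // p.
by rewrite /mono big1 ?mulr1.
Qed.

Lemma bdegX d f k : bdeg d f -> bdeg (d * k) (fun p => f p ^+ k).
Proof.
move=> bf; elim: k => [|k IH].
  by rewrite muln0; apply: bdeg_ext (bdeg_cst 1) => p; rewrite expr0.
by rewrite mulnS; apply: bdeg_ext (bdegM bf IH) => p; rewrite exprS.
Qed.

Lemma bdeg_prod (J : Type) (r : seq J) (f : J -> (I -> F) -> F) (d : J -> nat) :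
  (forall j, bdeg (d j) (f j)) ->
  bdeg (\sum_(j <- r) d j) (fun p => \prod_(j <- r) f j p).
Proof.
move=> bf; elim: r => [|j r IH].
  by rewrite big_nil; apply: bdeg_ext (bdeg_cst 1) => p; rewrite big_nil.
by rewrite big_cons; apply: bdeg_ext (bdegM (bf j) IH) => p; rewrite big_cons.
Qed.

Lemma polyfun_bdeg f : polyfun f -> exists d, bdeg d f.
Proof.
elim=> [c|i|g h _ [d bg] _ [d' bh]|g h _ [d bg] _ [d' bh]].
- by exists 0%N; exact: bdeg_cst.
- exists 1%N; apply: bdeg_ext (@bdeg_mono 1 1 (fun j => (j == i) : nat) _).
    move=> p; rewrite mul1r /mono (bigD1 i) //= eqxx expr1 big1 ?mulr1 //.
    by move=> j /negPf ->.
  by move=> j; case: (j == i).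
- by exists (d + d')%N; apply: bdegD; [apply: bdegW bg|apply: bdegW bh]; lia.
- by exists (d + d')%N; exact: bdegM.
Qed.

Lemma bdeg_coef d f : bdeg d f ->
  exists u : {ffun I -> 'I_d.+1} -> F,
    forall p, f p = \sum_e u e * mono (fun i => e i) p.
Proof.
elim=> [|c e g He bg [u IH]].
  by exists (fun=> 0) => p; rewrite big1 // => e _; rewrite mul0r.
pose e0 : {ffun I -> 'I_d.+1} := [ffun i => inord (e i)].
exists (fun e => (e == e0)%:R * c + u e) => p.
under eq_bigr do rewrite mulrDl.
rewrite big_split /= -IH; congr (_ + _).
rewrite (bigD1 e0) //= eqxx mul1r big1 ?addr0; last first.
  by move=> e' /negPf ->; rewrite !mul0r.
by congr (_ * _); apply: eq_bigr => i _; rewrite ffunE inordK // ltnS.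
Qed.

End Box.

Lemma digits_inj m D (a b : 'I_m -> nat) :
  (forall i, a i < D)%N -> (forall i, b i < D)%N ->
  (\sum_i a i * D ^ i = \sum_i b i * D ^ i)%N -> a =1 b.
Proof.
elim: m a b => [|m IH] a b Ha Hb; first by move=> _ [].
rewrite !big_ord_recl !expn0 !muln1.
have E (g : 'I_m.+1 -> nat) : (\sum_(i < m) g (lift ord0 i) * D ^ (lift ord0 i) =
    (\sum_(i < m) g (lift ord0 i) * D ^ i) * D)%N.
  rewrite big_distrl; apply: eq_bigr => i _.
  by rewrite /= /bump /= add1n expnS; lia.
rewrite !E => H.
have D0 : (0 < D)%N by apply: leq_ltn_trans (Ha ord0).
have H0 : a ord0 = b ord0.
  have /(congr1 (modn^~ D)) := H.
  by rewrite !(addnC _ (_ * D)%N) !modnMDl !modn_small.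
have H1 : (\sum_(i < m) a (lift ord0 i) * D ^ i =
           \sum_(i < m) b (lift ord0 i) * D ^ i)%N.
  by apply/eqP; rewrite -(eqn_pmul2r D0); apply/eqP; move: H; rewrite H0; lia.
have := IH _ _ (fun i => Ha (lift ord0 i)) (fun i => Hb (lift ord0 i)) H1.
move=> H2 i; case: (unliftP ord0 i) => [j ->|->] //; exact: H2.
Qed.

(* Kronecker substitution p_i = t ^ (D ^ i). *)
Lemma mono_indep (I : finType) D (u : {ffun I -> 'I_D} -> F) :
  (forall p, \sum_e u e * mono (fun i => e i) p = 0) -> forall e, u e = 0.
Proof.
move=> H e0.
pose k (e : {ffun I -> 'I_D}) := (\sum_(i < #|I|) e (enum_val i) * D ^ i)%N.
have kinj e e' : k e = k e' -> e = e'.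
  move=> /digits_inj E; apply/ffunP => i; apply/val_inj.
  by have := E (fun i => ltn_ord _) (fun i => ltn_ord _) (enum_rank i); rewrite enum_rankK.
pose P : {poly F} := \sum_e (u e)%:P * 'X^(k e).
have P0 : P = 0.
  apply/eqP; case: (eqVneq P 0) => // /poly_nonroot[n].
  rewrite horner_sum => /eqP[]; apply: etrans (H (fun i => n%:R ^+ (D ^ enum_rank i))).
  apply: eq_bigr => e _.
  rewrite !hornerE; congr (_ * _); rewrite /mono /k.
  under [RHS]eq_bigr do rewrite -exprM mulnC.
  rewrite (reindex (@enum_val I I)) /=; last exact/onW_bij/enum_val_bij.
  under [RHS]eq_bigr do rewrite enum_valK.
  by rewrite -expr_sum.
have : P`_(k e0) = 0 by rewrite P0 coef0.
rewrite coef_sum (bigD1 e0) //= coefCM coefXn eqxx mulr1 big1 ?addr0 //.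
move=> e /eqP ne; rewrite coefCM coefXn; case: eqP => [/esym/kinj //|].
by rewrite mulr0.
Qed.

(** * Images of rational maps by a count of monomials *)

Lemma lin_dep (X Y : finType) (M : X -> Y -> F) : (#|Y| < #|X|)%N ->
  exists2 a : X -> F, (exists x, a x != 0) & forall y, \sum_x a x * M x y = 0.
Proof.
move=> XY.
pose A := \matrix_(i < #|X|, j < #|Y|) M (enum_val i) (enum_val j).
have : kermx A != 0.
  rewrite kermx_eq0 /row_free neq_ltn.
  by rewrite (leq_ltn_trans (rank_leq_col A)).
move=> /rowV0Pn[v /sub_kermxP vA v0].
exists (fun x => v 0 (enum_rank x)).
  have /existsP[i vi] : [exists i, v 0 i != 0].
    apply: contraNT v0; rewrite negb_exists => /forallP H.
    by apply/eqP/rowP => i; rewrite mxE; apply/eqP; have := H i; rewrite negbK.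
  by exists (enum_val i); rewrite enum_valK.
move=> y; have /rowP/(_ (enum_rank y)) := vA; rewrite !mxE => E.
rewrite -[RHS]E (reindex (@enum_val X X)) /=; last exact/onW_bij/enum_val_bij.
by apply: eq_bigr => i _; rewrite mxE enum_valK enum_rankK.
Qed.

(** With D = E n d, the difference (D+1)^m - (D+1-e0)^m grows at most like d^(m-1), while (d+1)^n
    grows at least like d^m. *)
Lemma pow_count (m n E e0 : nat) : (m <= n)%N -> exists d,
  ((E * (n * d)).+1 ^ m < d.+1 ^ n + ((E * (n * d)).+1 - e0) ^ m)%N.
Proof.
move=> mn.
have key D : (D ^ m <= (D - e0) ^ m + m * e0 * D ^ m.-1)%N.
  elim: m {mn} => [|m IH]; first by rewrite !expn0.
  case: m IH => [|m] IH; first by rewrite !expn1 expn0; lia.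
  have HD : (D <= (D - e0) + e0)%N by lia.
  have aD : (D - e0 <= D)%N by lia.
  rewrite (expnS D m.+1) (expnS (D - e0) m.+1) /=.
  move: IH HD aD; rewrite /= (expnS D m).
  move: (D - e0)%N (D ^ m)%N ((D - e0) ^ m.+1)%N => a Z Y IH HD aD.
  have h1 : (a * (D * Z) <= a * Y + m.+1 * e0 * (D * Z))%N.
    have := leq_mul (leqnn a) IH; rewrite mulnDr => h.
    apply: leq_trans h _; rewrite leq_add2l mulnCA.
    by rewrite leq_mul // leq_mul.
  have h2 := leq_mul HD (leqnn (D * Z)).
  apply: leq_trans h2 _; rewrite mulnDl !mulSn; lia.
case: m mn key => [|m] mn key.
  exists 0%N; rewrite !expn0; have : (0 < 1 ^ n)%N by rewrite exp1n.
  lia.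
(* The difference is at most (m+1) e0 (D+1)^m, where D + 1 <= (E n + 1)(d + 1); this choice bounds
   it by d (d+1)^m. *)
pose d := (m.+1 * e0 * (E * n).+1 ^ m)%N; exists d.
apply: leq_ltn_trans (key _) _; rewrite [X in (_ < X)%N]addnC ltn_add2l /=.
apply: (@leq_ltn_trans (m.+1 * e0 * ((E * n).+1 * d.+1) ^ m)).
  have : ((E * (n * d)).+1 <= (E * n).+1 * d.+1)%N by nia.
  move: (_.+1) (_ * d.+1)%N => a b ab; rewrite leq_mul //.
  by elim: m {mn key d ab} (ab) => // m IH ab; rewrite !expnS leq_mul // IH.
rewrite expnMn mulnA -/d.
apply: (@leq_trans (d.+1 * d.+1 ^ m)).
  by rewrite ltn_pmul2r // expn_gt0.
by rewrite -expnS leq_pexp2l.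
Qed.

Section Elim.
Variables I T : finType.
Variables (G : T -> (I -> F) -> F) (den : (I -> F) -> F).
Hypotheses (pG : forall t, polyfun (G t)) (pden : polyfun den).

(** The pullbacks of monomials in [c], cleared of denominators, and the multiples of [Delta] lie in
    one space of polynomials of bounded degree, and for a suitable [d] they are too many to be
    independent. A relation reads den^(nd) P(G/den) + Delta Q = 0, so P vanishes on the image of
    Delta = 0. It is nonzero, since otherwise Delta Q = 0 with Q nonzero. *)
Lemma thin_image_hypersurface (Delta : (I -> F) -> F) :
  (#|I| <= #|T|)%N -> pnz Delta ->
  thin [set c | exists p, [/\ den p != 0, Delta p = 0 &
                           forall t, c t = G t p / den p]].
Proof.
move=> IT nzD.
have [E [bG bden]] : exists E, (forall t, bdeg E (G t)) /\ bdeg E den.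
  have [E0 b0] := polyfun_bdeg pden.
  have [E1 b1] := choice (fun t => polyfun_bdeg (pG t)).
  exists (maxn E0 (\max_t E1 t)); split=> [t|].
    by apply: bdegW (b1 t); rewrite leq_max leq_bigmax orbT.
  by apply: bdegW b0; rewrite leq_maxl.
have [e0 bD] := polyfun_bdeg nzD.1.
have [d cnt] := pow_count E e0 IT.
set n := #|T| in cnt; set m := #|I| in cnt.
set D := (E * (n * d))%N in cnt.
pose X := ({ffun T -> 'I_d.+1} + {ffun I -> 'I_(D.+1 - e0)})%type.
pose f (x : X) : (I -> F) -> F := match x with
  | inl e => fun p => \prod_t G t p ^+ e t * den p ^+ (n * d - \sum_t e t)
  | inr e => fun p => Delta p * mono (fun i => e i) p end.
have bf x : bdeg D (f x).
  case: x => e /=.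
    have se : (\sum_t e t <= n * d)%N.
      rewrite /n -sum_nat_const; apply: leq_sum => t _; exact: leq_ord.
    have b1 := bdegX (n * d - \sum_t e t) bden.
    have b2 := bdeg_prod (index_enum T) (fun t => bdegX (e t) (bG t)).
    apply: bdegW (bdegM b2 b1); rewrite -big_distrr /= -mulnDr.
    by rewrite /D leq_mul // subnKC.
  (* For D < e0 the subtraction truncates to 0: there is then no such [e], unless [I] is empty and
     every function is constant. *)
  have [] := leqP D.+1 e0 => h.
    case: (pickP (fun _ : I => true)) => [i _|noI].
      by have := ltn_ord (e i); lia.
    set g := (X in bdeg _ X).
    apply: bdeg_ext (bdegW (leq0n D) (bdeg_cst I (g (fun=> 0)))) => p.
    by congr g; apply/funext => i; have := noI i.
  have be : bdeg (D - e0) (mono (fun i => e i)).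
    apply: bdeg_ext (@bdeg_mono I (D - e0) 1 (fun i => e i) _) => [p|i].
      by rewrite mul1r.
    by have := ltn_ord (e i); lia.
  by apply: bdegW (bdegM bD be); lia.
have [u Hu] := choice (fun x => bdeg_coef (bf x)).
have [|a [x0 ax0] Ha] := @lin_dep X {ffun I -> 'I_D.+1} u.
  by rewrite card_sum !card_ffun !card_ord.
have rel p : \sum_x a x * f x p = 0.
  under eq_bigr do rewrite Hu big_distrr /=.
  rewrite exchange_big big1 // => e _.
  under eq_bigr do rewrite mulrA.
  by rewrite -big_distrl /= Ha mul0r.
pose P (c : T -> F) := \sum_e a (inl e) * mono (fun t => e t) c.
pose Q (p : I -> F) := \sum_e a (inr e) * mono (fun i => e i) p.
have pP : polyfun P.
  by apply: polyfun_sum => e; apply: polyfunM (polyfun_cst _) (polyfun_mono _).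
have pQ : polyfun Q.
  by apply: polyfun_sum => e; apply: polyfunM (polyfun_cst _) (polyfun_mono _).
have relPQ p : den p != 0 ->
    den p ^+ (n * d) * P (fun t => G t p / den p) + Delta p * Q p = 0.
  move=> dp; rewrite -(rel p) big_sumType /=; congr (_ + _).
    rewrite /P big_distrr; apply: eq_bigr => e _ /=; rewrite mulrCA; congr (_ * _).
    have se : (\sum_t e t <= n * d)%N.
      rewrite /n -sum_nat_const; apply: leq_sum => t _; exact: leq_ord.
    have -> : mono (fun t => e t) (fun t => G t p / den p) =
        (\prod_t G t p ^+ e t) / den p ^+ (\sum_t e t).
      rewrite /mono expr_sum -prodf_div; apply: eq_bigr => t _.
      by rewrite expr_div_n.
    by rewrite mulrCA; congr (_ * _); rewrite expfB_cond // (negPf dp).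
  by rewrite /Q big_distrr; apply: eq_bigr => e _ /=; rewrite mulrCA.
exists P; split; last first.
  move=> c [p [dp Dp cp]]; have -> : c = (fun t => G t p / den p) by apply/funext.
  have := relPQ p dp; rewrite Dp mul0r addr0 => /eqP.
  by rewrite mulf_eq0 expf_eq0 (negPf dp) andbF => /eqP.
split=> //; apply/not_existsP => P0.
have {}P0 e : a (inl e) = 0.
  by apply: (mono_indep (u := fun e => a (inl e))) => c; apply/eqP/negP/negP; move/negP: (P0 c); rewrite negbK.
have nzQ : exists q, Q q != 0.
  apply/not_existsP => Q0; case/eqP: ax0; case: x0 => e; first exact: P0.
  by apply: (mono_indep (u := fun e => a (inr e))) => c; apply/eqP/negP/negP; move/negP: (Q0 c); rewrite negbK.
have [_ [r]] := pnzM nzD (conj pQ nzQ).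
have : Delta r * Q r = 0.
  rewrite -(rel r) big_sumType /= big1 ?add0r => [|e _]; last by rewrite P0 mul0r.
  by rewrite /Q big_distrr; apply: eq_bigr => e _ /=; rewrite mulrCA.
by move=> ->; rewrite eqxx.
Qed.

End Elim.

(** A dummy variable is added, and the source becomes the hypersurface where it vanishes. *)
Lemma thin_image_lt (I T : finType) (G : T -> (I -> F) -> F) den :
  (forall t, polyfun (G t)) -> polyfun den -> (#|I| < #|T|)%N ->
  thin [set c | exists p, den p != 0 /\ forall t, c t = G t p / den p].
Proof.
move=> pG pden IT.
pose lift (f : (I -> F) -> F) (p : option I -> F) := f (fun i => p (Some i)).
have plift f : polyfun f -> polyfun (lift f).
  move=> pf; apply: (polyfun_comp (u := fun i p => p (Some i)) pf) => i.
  exact: polyfun_var.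
have nz : pnz (fun p : option I -> F => p None).
  by split; [exact: polyfun_var|exists (fun=> 1); rewrite oner_neq0].
have := thin_image_hypersurface (fun t => plift _ (pG t)) (plift _ pden) _ nz.
rewrite card_option => /(_ IT); apply: thinS => c [p [dp cp]].
by exists (fun o => if o is Some i then p i else 0).
Qed.

End PolyFun.

Arguments polyfun_cst {F I} c.

(** * An algebraic Sard lemma *)

Section Critical.
Variable F : numFieldType.

Definition opt_fun (T : Type) (c : T -> F) (s : F) (o : option T) : F :=
  if o is Some t then c t else s.

Lemma polyfun_option T (f : (option T -> F) -> F) : polyfun f ->
  exists K, exists r : nat -> (T -> F) -> F, (forall k, polyfun (r k)) /\
    forall c s, f (opt_fun c s) = \sum_(k < K) r k c * s ^+ k.
Proof.
elim=> [a|[t|]|g h _ [K [r [pr Hr]]] _ [K' [r' [pr' Hr']]]|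
    g h _ [K [r [pr Hr]]] _ [K' [r' [pr' Hr']]]].
- exists 1%N, (fun _ _ => a); split=> [k|c s]; first exact: polyfun_cst.
  by rewrite big_ord1 mulr1.
- exists 1%N, (fun _ c => c t); split=> [k|c s]; first exact: polyfun_var.
  by rewrite big_ord1 mulr1.
- exists 2%N, (fun k _ => (k == 1%N)%:R); split=> [k|c s]; first exact: polyfun_cst.
  by rewrite !big_ord_recl big_ord0 /= mul0r add0r addr0 mul1r.
- exists (K + K')%N, (fun k c => (k < K)%:R * r k c + (k < K')%:R * r' k c); split.
    by move=> k; apply: polyfunD; apply: polyfunM => //; exact: polyfun_cst.
  move=> c s; rewrite Hr Hr'.
  under [RHS]eq_bigr do rewrite mulrDl.
  rewrite big_split /=; congr (_ + _).
    rewrite (big_ord_widen_cond (K + K')%N xpredT (fun k => r k c * s ^+ k)) ?leq_addr //.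
    rewrite big_mkcond /=; apply: eq_bigr => k _.
    by case: ifP; rewrite ?mul1r // mul0r mul0r.
  rewrite (big_ord_widen_cond (K + K')%N xpredT (fun k => r' k c * s ^+ k)) ?leq_addl //.
  rewrite big_mkcond /=; apply: eq_bigr => k _.
  by case: ifP; rewrite ?mul1r // mul0r mul0r.
- exists (K + K').+1, (fun j c => \sum_(k < K) \sum_(l < K' | (k + l)%N == j) r k c * r' l c).
  split.
    by move=> j; apply: polyfun_sum => k; apply: polyfun_sum => l; exact: polyfunM.
  move=> c s; rewrite Hr Hr' big_distrl /=.
  under [RHS]eq_bigr do rewrite big_distrl /=.
  rewrite [RHS]exchange_big /=; apply: eq_bigr => k _.
  under [RHS]eq_bigr do rewrite big_distrl /=.
  rewrite big_distrr [RHS](exchange_big_dep predT) //=; apply: eq_bigr => l _.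
  have hk : (k + l < (K + K').+1)%N.
    by rewrite ltnS leq_add // ltnW.
  rewrite (bigD1 (Ordinal hk)) //= big1 ?addr0.
    by rewrite exprD mulrACA.
  by move=> j /andP[/eqP E] /eqP[]; apply/val_inj; rewrite /= E.
Qed.

Lemma polyfun_clear (I T : Type) (G : T -> (I -> F) -> F) den f :
  (forall t, polyfun (G t)) -> polyfun den -> polyfun f ->
  exists M H, polyfun H /\
    forall p, den p != 0 -> H p = den p ^+ M * f (fun t => G t p / den p).
Proof.
move=> pG pden; elim=> [a|t|g h _ [M [H [pH HH]]] _ [M' [H' [pH' HH']]]|
    g h _ [M [H [pH HH]]] _ [M' [H' [pH' HH']]]].
- by exists 0%N, (fun=> a); split=> [|p _]; [exact: polyfun_cst|rewrite mul1r].
- exists 1%N, (G t); split=> // p dp; by rewrite expr1 mulrCA mulfV // mulr1.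
- exists (M + M')%N, (fun p => den p ^+ M' * H p + den p ^+ M * H' p); split.
    by apply: polyfunD; apply: polyfunM => //; exact: polyfunX.
  by move=> p dp; rewrite HH // HH' // exprD; ring.
- exists (M + M')%N, (fun p => H p * H' p); split; first exact: polyfunM.
  by move=> p dp; rewrite HH // HH' // exprD; ring.
Qed.

(* Composing with a polynomial preserves congruence modulo t^2, denominators allowed. *)
Lemma polyfun_congr2 (X : Type) (u u0 : X -> F -> F) (q : X -> {poly F})
    (d : {poly F}) (L : X -> {poly F}) f :
  (forall x t, u0 x t = (L x).[t]) ->
  (forall x t, d.[t] != 0 -> u x t = u0 x t + t ^+ 2 * (q x).[t] / d.[t]) ->
  polyfun f -> exists M S, exists L0 : {poly F},
    (forall t, f (u0^~ t) = L0.[t]) /\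
    (forall t, d.[t] != 0 -> f (u^~ t) * d.[t] ^+ M =
                 f (u0^~ t) * d.[t] ^+ M + t ^+ 2 * S.[t]).
Proof.
move=> HL Hu; elim=> [a|x|g h _ [M [S [L0 [H0 H]]]] _ [M' [S' [L0' [H0' H']]]]|
    g h _ [M [S [L0 [H0 H]]]] _ [M' [S' [L0' [H0' H']]]]].
- exists 0%N, 0, a%:P; split=> t; first by rewrite hornerC.
  by rewrite horner0 mulr0 addr0.
- exists 1%N, (q x), (L x); split=> // t dt.
  by rewrite Hu // expr1 mulrDl mulfVK.
- exists (M + M')%N, (S * d ^+ M' + S' * d ^+ M), (L0 + L0'); split=> t.
    by rewrite hornerD H0 H0'.
  move=> dt; rewrite exprD mulrDl hornerD !hornerM !horner_exp.
  have -> : g (u^~ t) * (d.[t] ^+ M * d.[t] ^+ M') =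
            (g (u^~ t) * d.[t] ^+ M) * d.[t] ^+ M' by ring.
  have -> : h (u^~ t) * (d.[t] ^+ M * d.[t] ^+ M') =
            (h (u^~ t) * d.[t] ^+ M') * d.[t] ^+ M by ring.
  by rewrite H // H' //; ring.
- exists (M + M')%N.
  exists (L0 * d ^+ M * S' + S * L0' * d ^+ M' + 'X^2 * S * S'), (L0 * L0'); split=> t.
    by rewrite hornerM H0 H0'.
  move=> dt; rewrite exprD !hornerD !hornerM !horner_exp hornerX -H0 -H0'.
  have -> : g (u^~ t) * h (u^~ t) * (d.[t] ^+ M * d.[t] ^+ M') =
            (g (u^~ t) * d.[t] ^+ M) * (h (u^~ t) * d.[t] ^+ M') by ring.
  by rewrite H // H' //; ring.
Qed.

Lemma poly_eq0_off (P d : {poly F}) : d != 0 ->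
  (forall t, d.[t] != 0 -> P.[t] = 0) -> P = 0.
Proof.
move=> d0 H; apply/eqP; case: (eqVneq P 0) => // P0.
have [n] := poly_nonroot (mulf_neq0 d0 P0).
rewrite hornerM mulf_eq0 negb_or => /andP[dn].
by rewrite H // eqxx.
Qed.

Variables I T : finType.
Variables (G : T -> (I -> F) -> F) (den : (I -> F) -> F).
Hypotheses (pG : forall t, polyfun (G t)) (pden : polyfun den).
Hypothesis IT : (#|I| <= #|T|)%N.
Let Fr p t := G t p / den p.

(* If the image is not thin, each p i satisfies a polynomial equation over the
   image coordinates; one of minimal degree has simple root p i generically. *)
Lemma simple_algebraic_relation (i : I) :
  ~ thin [set c | exists p, den p != 0 /\ forall t, c t = Fr p t] ->
  exists K, exists r : nat -> (T -> F) -> F, [/\ forall k, polyfun (r k),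
    forall p, den p != 0 -> (\poly_(k < K) r k (Fr p)).[p i] = 0 &
    exists p, den p != 0 /\ (\poly_(k < K) r k (Fr p))^`().[p i] != 0].
Proof.
move=> nthin.
pose Q K := exists r : nat -> (T -> F) -> F, [/\ forall k, polyfun (r k),
  exists k c, (k < K)%N && (r k c != 0) &
  forall p, den p != 0 -> (\poly_(k < K) r k (Fr p)).[p i] = 0].
have exQ : exists K, Q K.
  (* Adjoining the coordinate [p i] to the map gives |T| + 1 target coordinates for at most |T|
     parameters, hence a relation. *)
  pose G' (o : option T) := if o is Some t then G t else fun p => p i * den p.
  have pG' o : polyfun (G' o).
    by case: o => [t|] //=; apply: polyfunM => //; exact: polyfun_var.
  have [|P [[pP [c0 Pc0]] HP]] := thin_image_lt pG' pden.
    by rewrite card_option ltnS.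
  have [K [r [pr Hr]]] := polyfun_option pP.
  exists K, r; split=> //.
    apply: contrapT => H; case/eqP: Pc0.
    have -> : c0 = opt_fun (fun t => c0 (Some t)) (c0 None).
      by apply/funext => -[].
    rewrite Hr big1 // => k _; case: (eqVneq (r k (fun t => c0 (Some t))) 0) => [->|nz].
      by rewrite mul0r.
    by case: H; exists k, (fun t => c0 (Some t)); rewrite ltn_ord.
  move=> p dp; rewrite horner_poly -Hr; apply: HP; exists p; split=> // -[t|] //=.
  by rewrite mulfK.
have exQb : exists K, `[< Q K >] by case: exQ => K /asboolP; exists K.
case: (ex_minnP exQb) => K /asboolP [r [pr [k [c /andP[kK rc]]] Hr]] Kmin.
exists K, r; split=> //; apply: contrapT => nd.
have derE c' : (\poly_(k < K) r k c')^`() = \poly_(k < K.-1) (r k.+1 c' *+ k.+1).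
  apply/polyP => j; rewrite coef_deriv !coef_poly.
  have -> : (j < K.-1)%N = (j.+1 < K)%N by lia.
  by case: ifP; rewrite ?mul0rn.
have der0 p : den p != 0 -> (\poly_(k < K.-1) (r k.+1 (Fr p) *+ k.+1)).[p i] = 0.
  move=> dp; apply: contrapT => /eqP nz; apply: nd; exists p; split=> //.
  by rewrite derE.
(* By minimality of [K] every coefficient of positive degree is the zero function. The remaining
   [r 0] is then nonzero and vanishes on the image, which was assumed not to be thin. *)
have rS j c' : (j.+1 < K)%N -> r j.+1 c' = 0.
  move=> jK; apply: contrapT => /eqP nz.
  have : Q K.-1.
    exists (fun k c => r k.+1 c *+ k.+1); split=> //.
      move=> l; apply: (@polyfun_ext _ _ (fun c => l.+1%:R * r l.+1 c)).
        by move=> c''; rewrite mulr_natl.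
      exact: polyfunM (polyfun_cst _) (pr _).
    exists j, c'; rewrite -mulr_natl mulf_neq0 // ?pnatr_eq0 // andbT.
    by rewrite -ltnS prednK // (leq_ltn_trans _ jK).
  by move/asboolP/Kmin; rewrite leqNgt prednK ?leqnn // (leq_ltn_trans _ jK).
case: nthin; exists (r 0%N); split.
  by split=> //; exists c; case: k kK rc => // k kK; rewrite rS // eqxx.
move=> c' [p [dp cp]]; have -> : c' = Fr p by apply/funext.
have := Hr p dp; rewrite horner_poly.
case: K kK {Hr Kmin nd derE der0} rS => // K kK rS.
rewrite big_ord_recl mulr1 big1 ?addr0 // => j _.
by rewrite rS ?mul0r // ltnS.
Qed.

(** The vector [v] lies in the kernel of the differential of G / den at [p]: along this direction
    the map is constant modulo s^2. This spares the derivatives of rational functions. *)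
Definition critical_values : set (T -> F) :=
  [set c | exists p v (Q : T -> {poly F}), [/\ den p != 0, forall t, c t = Fr p t,
     exists i, v i != 0 & forall t s, G t (fun i => p i + s * v i) =
       c t * den (fun i => p i + s * v i) + s ^+ 2 * (Q t).[s]]].

(** Differentiating the algebraic relation of [p i] over the image along [v] gives q'(p i) v i = 0.
    So a critical point with v i nonzero lies where the relation of [p i] has a multiple root, on a
    hypersurface, whose image is thin. *)
Lemma thin_critical_values : thin critical_values.
Proof.
have [th|nth] := pselect (thin [set c | exists p, den p != 0 /\ forall t, c t = Fr p t]).
  by apply: thinS th => c [p [v [Q [dp cp _ _]]]]; exists p.
have /choice[K HK] := fun i => simple_algebraic_relation i nth.
have /choice[r Hr] := HK.
pose der i c s := (\poly_(k < K i) r i k c)^`().[s].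
have pder i : polyfun (fun o : option T -> F => der i (fun t => o (Some t)) (o None)).
  apply: (@polyfun_ext _ _ (fun o : option T -> F => \sum_(k < (K i).-1)
      (k.+1%:R * r i k.+1 (fun t => o (Some t))) * o None ^+ k)).
    move=> o; rewrite /der; have -> : (\poly_(k < K i) r i k (fun t => o (Some t)))^`() =
        \poly_(k < (K i).-1) (k.+1%:R * r i k.+1 (fun t => o (Some t))).
      apply/polyP => j; rewrite coef_deriv !coef_poly mulr_natl.
      have -> : (j < (K i).-1)%N = (j.+1 < K i)%N by lia.
      by case: ifP; rewrite ?mul0rn.
    by rewrite horner_poly.
  apply: polyfun_sum => k; apply: polyfunM; last exact/polyfunX/polyfun_var.
  apply: polyfunM; first exact: polyfun_cst.
  apply: (polyfun_comp (u := fun t (o : option T -> F) => o (Some t))); last first.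
    by move=> t; exact: polyfun_var.
  by have [] := Hr i.
pose G' (i : I) (o : option T) := if o is Some t then G t else fun p => p i * den p.
have pG' i o : polyfun (G' i o).
  by case: o => [t|] //=; apply: polyfunM => //; exact: polyfun_var.
have /choice[M /choice[H HH]] := fun i => polyfun_clear (pG' i) pden (pder i).
have HE i p : den p != 0 -> H i p = den p ^+ M i * der i (Fr p) (p i).
  move=> dp; have [_ /(_ p dp) ->] := HH i; congr (_ * der _ _ _).
  by rewrite /= mulfK.
have nzH : pnz (fun p => \prod_i H i p).
  apply: pnz_prod => i; split; first by have [] := HH i.
  have [_ _ [p [dp nz]]] := Hr i.
  by exists p; rewrite HE // mulf_neq0 // expf_neq0.
apply: thinS (thin_image_hypersurface pG pden IT nzH) => c [p [v [Q [dp cp [i vi] HQ]]]].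
exists p; split=> //; apply: contrapT => /eqP nz.
have {}nz : der i c (p i) != 0.
  apply: contraNneq nz => E; rewrite (bigD1 i) //= HE //.
  by have <- : c = Fr p by [apply/funext]; rewrite E mulr0 mul0r.
have [D HD] := polyfun_line p v pden.
pose u (o : option T) s := if o is Some t then Fr (fun i => p i + s * v i) t else p i + s * v i.
pose u0 (o : option T) (s : F) := if o is Some t then c t else p i + s * v i.
pose q (o : option T) := if o is Some t then Q t else 0.
pose L (o : option T) := if o is Some t then (c t)%:P else (p i)%:P + (v i)%:P * 'X.
have [|||M' [S [L0 [HL0 HS]]]] := @polyfun_congr2 _ u u0 q D L
    (fun o : option T -> F => \sum_(k < K i) r i k (fun t => o (Some t)) * o None ^+ k).
- by case=> [t|] s; rewrite /= !hornerE // mulrC.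
- case=> [t|] s Ds; last by rewrite /= horner0 mulr0 mul0r addr0.
  by rewrite /= /Fr HQ HD mulrDl mulfK.
- apply: polyfun_sum => k; apply: polyfunM; last exact/polyfunX/polyfun_var.
  apply: (polyfun_comp (u := fun t (o : option T -> F) => o (Some t))); last first.
    by move=> t; exact: polyfun_var.
  by have [] := Hr i.
pose qc := \poly_(k < K i) r i k c.
have D0 : D.[0] != 0.
  by rewrite -HD; have -> : (fun i => p i + 0 * v i) = p by apply/funext => j; rewrite mul0r addr0.
have nD : D != 0 by apply: contraNneq D0 => ->; rewrite horner0.
(* The relation along the line, its coefficients frozen at s = 0 at the cost of a term in s^2. It
   vanishes identically, and its derivative at 0 is q'(p i) v i up to a nonzero factor. *)
pose W := (qc \Po ((p i)%:P + (v i)%:P * 'X)) * D ^+ M' + 'X^2 * S.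
have W0 : W = 0.
  apply: poly_eq0_off nD _ => s Ds.
  have := HS s Ds; rewrite /W hornerD !hornerM !horner_exp hornerX horner_comp.
  have [_ /(_ (fun i => p i + s * v i)) + _] := Hr i.
  rewrite HD horner_poly => /(_ Ds) E; rewrite E /= mul0r => {}E.
  apply: etrans (esym E); congr (_ * _ + _).
  by rewrite hornerD hornerM !hornerC hornerX (mulrC (v i)) horner_poly.
have qc0 : qc.[p i] = 0.
  have [_ /(_ p dp) + _] := Hr i.
  by have <- : c = Fr p by [apply/funext].
set l := (p i)%:P + _ in W W0.
have l0 : l.[0] = p i by rewrite /l !hornerE.
have dl : l^`() = (v i)%:P by rewrite /l derivD derivC derivM derivC derivX; ring.
have : W^`().[0] = qc^`().[p i] * v i * D.[0] ^+ M'.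
  rewrite /W derivD !derivM deriv_comp dl !hornerD !hornerM !horner_comp l0 hornerC.
  by rewrite qc0 horner_exp derivX mul1r mulr1 hornerD !hornerX !(mul0r, mulr0, addr0).
rewrite W0 deriv0 horner0 => /esym/eqP.
rewrite !mulf_eq0 expf_eq0 (negPf D0) andbF (negPf vi) !orbF.
by apply/negP.
Qed.

End Critical.

(** * Incidence varieties of linear conditions *)

Section LinearConditions.
Variables (F : numFieldType) (J T : finType) (k : nat).
Variable Phi : 'I_k -> T -> (J -> F) -> F.
Hypothesis pPhi : forall i t, polyfun (Phi i t).

Definition constrained (w : J -> F) (c : T -> F) :=
  forall i, \sum_t Phi i t w * c t = 0.

Definition independent_at (w : J -> F) :=
  forall u : 'I_k -> F, (forall t, \sum_i u i * Phi i t w = 0) -> forall i, u i = 0.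

Definition dirderiv (I : Type) (f : (I -> F) -> F) (w v : I -> F) (d : F) :=
  exists P : {poly F}, (forall s, f (fun i => w i + s * v i) = P.[s]) /\ P^`().[0] = d.

Section Minor.
Variable b : 'I_k -> T.

Definition cmat w := \matrix_(i < k, j < k) Phi i (b j) w.
Definition cminor w := \det (cmat w).

Local Notation CT := {t : T | t \in [predC codom b]}.
Local Notation I := (J + CT)%type.
Let wpart (p : I -> F) (j : J) := p (inl j).

Let den (p : I -> F) := cminor (wpart p).
(** Where the minor on the columns [b] is nonzero, the incidence variety is parametrized by w and
    the coefficients off [b]; Cramer's rule gives those at [b], with common denominator [den]. This
    leaves |J| + |T| - k parameters. *)
Let G (t : T) (p : I -> F) : F :=
  if insub t is Some s then den p * p (inr s : I) else
  if [pick j | b j == t] is Some j then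
    - \sum_i (\adj (cmat (wpart p))) j i * \sum_(s : CT) Phi i (val s) (wpart p) * p (inr s)
  else 0.

Let pwpart (f : (J -> F) -> F) : polyfun f -> polyfun (fun p => f (wpart p)).
Proof.
move=> pf; apply: (polyfun_comp (u := fun j (p : I -> F) => p (inl j))) => // j.
exact: polyfun_var.
Qed.

Lemma polyfun_cminor : polyfun cminor.
Proof.
apply: polyfun_det => i j; apply: polyfun_ext (pPhi i (b j)) => w.
by rewrite mxE.
Qed.

Let pden : polyfun den.
Proof. exact: pwpart polyfun_cminor. Qed.

Let pG t : polyfun (G t).
Proof.
rewrite /G; case: insubP => [s _ _|_].
  by apply: polyfunM => //; exact: polyfun_var.
case: pickP => [j _|_]; last exact: polyfun_cst.
apply: polyfunN; apply: polyfun_sum => i; apply: polyfunM.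
  apply: (pwpart (f := fun w => (\adj (cmat w)) j i)).
  apply: polyfun_adj => l m; apply: polyfun_ext (pPhi l (b m)) => w.
  by rewrite mxE.
by apply: polyfun_sum => s; apply: polyfunM; [exact: pwpart|exact: polyfun_var].
Qed.

Let b_inj w : cminor w != 0 -> injective b.
Proof.
move=> nz i j bij; apply/eqP; apply: contraNT nz => ij.
rewrite /cminor -det_tr; apply/eqP; apply: (determinant_alternate ij) => l.
by rewrite !mxE bij.
Qed.

Let cardI w : cminor w != 0 -> (#|J| <= k)%N -> (#|{: I}| <= #|T|)%N.
Proof.
move=> /b_inj bI Jk; rewrite card_sum card_sig.
have := cardC (mem (codom b)); rewrite (card_codom bI) card_ord => <-.
rewrite leq_add //; apply: eq_leq; apply: eq_card => t; by rewrite !inE.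
Qed.

Let cardI_lt w : cminor w != 0 -> (#|J| < k)%N -> (#|{: I}| < #|T|)%N.
Proof.
move=> /b_inj bI Jk; rewrite card_sum card_sig.
have := cardC (mem (codom b)); rewrite (card_codom bI) card_ord => <-.
rewrite -addSn leq_add //; apply: eq_leq; apply: eq_card => t; by rewrite !inE.
Qed.

Let join (w : J -> F) (c : T -> F) (x : I) : F :=
  match x with inl j => w j | inr s => c (val s) end.

Let sum_split w (f : T -> F) : cminor w != 0 ->
  \sum_t f t = \sum_j f (b j) + \sum_(s : CT) f (val s).
Proof.
move=> /b_inj bI; rewrite (bigID (fun t => t \in [predC codom b])) /= addrC; congr (_ + _).
  rewrite -[RHS](big_imset (h := b) (A := predT)) /=; last by move=> x y _ _ /bI.
  apply: eq_bigl => t; rewrite !inE negbK; apply/codomP/imsetP => [[x ->]|[x _ ->]];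
  by exists x.
exact: big_sub.
Qed.

Let adj_cmat w (x : 'I_k -> F) j :
  \sum_i (\adj (cmat w)) j i * (\sum_l Phi i (b l) w * x l) = cminor w * x j.
Proof.
have /matrixP/(_ j 0) : \adj (cmat w) *m (cmat w *m \col_l x l) = cminor w *: \col_l x l.
  by rewrite mulmxA mul_adj_mx mul_scalar_mx.
rewrite !mxE => <-; apply: eq_bigr => i _; rewrite mxE; congr (_ * _).
by rewrite mxE; apply: eq_bigr => l _; rewrite !mxE.
Qed.

(* Cramer's rule up to the defect of the linear conditions. *)
Let cramer w w' c t : cminor w != 0 ->
  exists a : 'I_k -> F, G t (join w' c) = c t * cminor w' -
    \sum_i (if [pick j | b j == t] is Some j then (\adj (cmat w')) j i else 0) *
     \sum_t Phi i t w' * c t.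
Proof.
move=> nz; exists (fun=> 0); rewrite /G.
have dE : den (join w' c) = cminor w' by [].
have wE : wpart (join w' c) = w' by [].
case: insubP => [s sC sE|]; rewrite ?dE ?wE.
  rewrite /= sE; case: pickP => [j /eqP bj|_].
    by move: sC; rewrite !inE -bj codom_f.
  by rewrite big1 ?subr0 => [|i _]; rewrite ?mul0r // mulrC.
rewrite !inE negbK => /codomP[j0 tj].
case: pickP => [j /eqP bj|/(_ j0)]; last by rewrite tj eqxx.
under [X in _ = _ - X]eq_bigr => i _.
  rewrite (sum_split (fun t => Phi i t w' * c t) nz) mulrDr; over.
rewrite big_split /= adj_cmat bj; ring.
Qed.

Let solve w c : cminor w != 0 -> constrained w c ->
  forall t, c t = G t (join w c) / den (join w c).
Proof.
move=> nz cw t; have [_ ->] := cramer w c t nz.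
rewrite big1 ?subr0; last by move=> i _; rewrite cw mulr0.
by rewrite mulfK.
Qed.

Lemma thin_minor_lt : (#|J| < k)%N ->
  thin [set c | exists w, cminor w != 0 /\ constrained w c].
Proof.
move=> Jk; have [[w0 nz0]|nex] := pselect (exists w, cminor w != 0).
  apply: thinS (thin_image_lt pG pden (cardI_lt nz0 Jk)) => c [w [nz cw]].
  by exists (join w c); split=> //; exact: solve.
by apply: thinS (@thin0 F T) => c [w [nz _]]; case: nex; exists w.
Qed.

Lemma thin_minor_hyp Delta : (#|J| <= k)%N -> pnz Delta ->
  thin [set c | exists w, [/\ cminor w != 0, Delta w = 0 & constrained w c]].
Proof.
move=> Jk [pD [wD nD]]; have [[w0 nz0]|nex] := pselect (exists w, cminor w != 0).
  have nzD : pnz (fun p : I -> F => Delta (wpart p)).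
    split; first exact: pwpart.
    by exists (join wD (fun=> 0)).
  apply: thinS (thin_image_hypersurface pG pden (cardI nz0 Jk) nzD) => c [w [nz Dw cw]].
  by exists (join w c); split=> //; exact: solve.
by apply: thinS (@thin0 F T) => c [w [nz _]]; case: nex; exists w.
Qed.

(** Moving w along [v] with [c] fixed changes the linear conditions only to second order. By
    [cramer] this defect is all that separates the image of the moved parameters from [c], so [c] is
    a critical value of the parametrization. *)
Lemma thin_minor_crit : (#|J| <= k)%N ->
  thin [set c | exists w, [/\ cminor w != 0, constrained w c &
    exists v, (exists j, v j != 0) /\
      exists d, (forall i t, dirderiv (Phi i t) w v (d i t)) /\
                forall i, \sum_t d i t * c t = 0]].
Proof.
move=> Jk; have [[w0 nz0]|nex] := pselect (exists w, cminor w != 0); last first.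
  by apply: thinS (@thin0 F T) => c [w [nz _]]; case: nex; exists w.
apply: thinS (thin_critical_values pG pden (cardI nz0 Jk)) => c.
move=> [w [nz cw [v [[j0 vj] [d [Hd dc]]]]]].
pose v' (x : I) := if x is inl j then v j else 0.
have lineE s : (fun x => join w c x + s * v' x) = join (fun j => w j + s * v j) c.
  by apply/funext => -[j|u] //=; rewrite mulr0 addr0.
have [A HA] : exists A : 'I_k -> 'I_k -> {poly F}, forall i j s,
    (\adj (cmat (fun j => w j + s * v j))) i j = (A i j).[s].
  have H (i j : 'I_k) : exists P : {poly F}, forall s,
      (\adj (cmat (fun j => w j + s * v j))) i j = P.[s].
    apply: (polyfun_line w v (f := fun w => (\adj (cmat w)) i j)).
    apply: polyfun_adj => l m; apply: polyfun_ext (pPhi l (b m)) => w'.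
    by rewrite mxE.
  have C i : exists f : 'I_k -> {poly F}, forall j s,
      (\adj (cmat (fun j => w j + s * v j))) i j = (f j).[s].
    by have [f Hf] := choice (H i); exists f.
  by have [f Hf] := choice C; exists f.
have [S HS] : exists S : 'I_k -> {poly F}, forall i s,
    \sum_t Phi i t (fun j => w j + s * v j) * c t = s ^+ 2 * (S i).[s].
  suff C i : exists U : {poly F}, forall s,
      \sum_t Phi i t (fun j => w j + s * v j) * c t = s ^+ 2 * U.[s].
    by have [f Hf] := choice C; exists f.
  have /choice[P HP] := Hd i.
  (* The i-th condition along the line; its value and derivative vanish at 0, so it is divisible by
     X^2. *)
  pose W : {poly F} := \sum_t P t * (c t)%:P.
  have W0 : W.[0] = 0.
    rewrite horner_sum; apply: etrans (cw i); apply: eq_bigr => t _.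
    rewrite hornerM hornerC; have [<- _] := HP t; congr (Phi _ _ _ * _).
    by apply/funext => j; rewrite mul0r addr0.
  have W1 : W^`().[0] = 0.
    rewrite /W raddf_sum horner_sum; apply: etrans (dc i); apply: eq_bigr => t _.
    rewrite /= derivM derivC mulr0 addr0 hornerM hornerC.
    by have [_ ->] := HP t.
  have [V WV] : exists V, W = V * 'X.
    have /factor_theorem[V VE] : root W 0 by exact/rootP.
    by exists V; rewrite VE polyC0 subr0.
  have V0 : V.[0] = 0.
    by move: W1; rewrite WV derivM derivX mulr1 hornerD hornerM hornerX mulr0 add0r.
  have [U VU] : exists U, V = U * 'X.
    have /factor_theorem[U UE] : root V 0 by exact/rootP.
    by exists U; rewrite UE polyC0 subr0.
  exists U => s; transitivity W.[s].
    rewrite horner_sum; apply: eq_bigr => t _; rewrite hornerM hornerC.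
    by have [-> _] := HP t.
  by rewrite WV VU !hornerM hornerX; ring.
exists (join w c), v', (fun t => - \sum_i
   (if [pick j | b j == t] is Some j then A j i else 0) * S i).
split=> //; first exact: solve.
  by exists (inl j0).
move=> t s; rewrite lineE.
have [_ ->] := cramer (fun j => w j + s * v j) c t nz; congr (_ + _).
rewrite hornerN mulrN horner_sum big_distrr /=; congr (- _).
apply: eq_bigr => i _; rewrite HS hornerM.
by case: pickP => [j _|_]; rewrite ?HA ?horner0; ring.
Qed.

End Minor.

Lemma independent_minor w : independent_at w ->
  exists b : {ffun 'I_k -> T}, cminor b w != 0.
Proof.
move=> ind; pose A := \matrix_(j < #|T|, i < k) Phi i (enum_val j) w.
have rA : row_full A.
  rewrite /row_full -mxrank_tr -[_ == _]/(row_free A^T) -kermx_eq0.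
  apply/rowV0P => u /sub_kermxP uA; apply/rowP => i; rewrite mxE.
  apply: (ind (fun i => u 0 i)) => t.
  have /rowP/(_ (enum_rank t)) := uA; rewrite !mxE; apply: etrans.
  by apply: eq_bigr => j _; rewrite !mxE enum_rankK.
exists [ffun j => enum_val (fullrankfun rA j)].
have := fullrowsub_unit rA; rewrite unitmxE unitfE -det_tr; congr (\det _ != 0).
apply/matrixP => i j; by rewrite !mxE [in RHS]ffunE.
Qed.

Lemma thin_rank_lt : (#|J| < k)%N ->
  thin [set c | exists w, independent_at w /\ constrained w c].
Proof.
move=> Jk; apply: thinS (thin_finU (fun b : {ffun 'I_k -> T} => thin_minor_lt b Jk)).
move=> c [w [iw cw]]; have [b nb] := independent_minor iw.
by exists b, w.
Qed.

Lemma thin_rank_hyp Delta : (#|J| <= k)%N -> pnz Delta ->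
  thin [set c | exists w, [/\ independent_at w, Delta w = 0 & constrained w c]].
Proof.
move=> Jk nD; apply: thinS (thin_finU (fun b : {ffun 'I_k -> T} => thin_minor_hyp b Jk nD)).
move=> c [w [iw Dw cw]]; have [b nb] := independent_minor iw.
by exists b, w.
Qed.

Lemma thin_rank_crit : (#|J| <= k)%N ->
  thin [set c | exists w, [/\ independent_at w, constrained w c &
    exists v, (exists j, v j != 0) /\
      exists d, (forall i t, dirderiv (Phi i t) w v (d i t)) /\
                forall i, \sum_t d i t * c t = 0]].
Proof.
move=> Jk; apply: thinS (thin_finU (fun b : {ffun 'I_k -> T} => thin_minor_crit b Jk)).
move=> c [w [iw cw H]]; have [b nb] := independent_minor iw.
by exists b, w.
Qed.

End LinearConditions.

(** * Directional derivatives of polynomial functions *)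

Section DirDeriv.
Variables (F : numFieldType) (I : Type) (w v : I -> F).
Implicit Types (f g : (I -> F) -> F).

Lemma dirderiv_cst c : dirderiv (fun=> c) w v 0.
Proof. by exists c%:P; split=> [s|]; rewrite ?derivC hornerC. Qed.

Lemma dirderiv_var i : dirderiv (fun p => p i) w v (v i).
Proof.
exists ((w i)%:P + (v i)%:P * 'X); split=> [s|]; first by rewrite !hornerE mulrC.
by rewrite derivD derivM !derivC derivX !hornerE.
Qed.

Lemma dirderivM f g d e : dirderiv f w v d -> dirderiv g w v e ->
  dirderiv (fun p => f p * g p) w v (d * g w + f w * e).
Proof.
have w0 : w = (fun i => w i + 0 * v i) by apply/funext => i; rewrite mul0r addr0.
move=> [P [HP <-]] [Q [HQ <-]]; exists (P * Q); split=> [s|].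
  by rewrite HP HQ hornerM.
by rewrite derivM hornerD !hornerM [in RHS]w0 HP HQ.
Qed.

Lemma dirderivX f d m : dirderiv f w v d ->
  dirderiv (fun p => f p ^+ m) w v (m%:R * f w ^+ m.-1 * d).
Proof.
move=> Hf; elim: m => [|m IH].
  have := dirderiv_cst 1; rewrite !mul0r.
  by congr dirderiv; apply/funext => p; rewrite expr0.
have := dirderivM Hf IH; congr dirderiv.
  by apply/funext => p; rewrite exprS.
rewrite [m.+1.-1]/= -[in m.+1%:R]addn1 natrD.
by case: m {IH} => [|m] /=; rewrite ?expr0 ?exprS; ring.
Qed.

End DirDeriv.

(** * Exponential sums on the set of heights *)

Section ExpoPoly.
Variable R : realType.

Lemma rolle_path (f f' : R -> R) (z : R) (zs : seq R) :
  (forall x : R, is_derive x (1 : R) f (f' x)) -> path <%R z zs ->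
  f z = 0 -> (forall y, y \in zs -> f y = 0) ->
  exists ws, [/\ size ws = size zs, path <%R z ws & forall y, y \in ws -> f' y = 0].
Proof.
move=> df; elim: zs z => [|z2 zs IH] z /=; first by exists [::].
move=> /andP[zz2 pz] fz fzs.
have fz2 : f z2 = 0 by apply: fzs; rewrite mem_head.
have [|ws [sw pw fw]] := IH z2 pz fz2.
  by move=> y yz; apply: fzs; rewrite in_cons yz orbT.
have [|||c] := @Rolle _ f z z2 zz2.
- by move=> x _; have [] := df x.
- apply: derivable_within_continuous => x _; by have [] := df x.
- by rewrite fz fz2.
rewrite in_itv /= => /andP[zc cz2] dc.
exists (c :: ws); split=> /=; first by rewrite sw.
  rewrite zc /=; case: (ws) pw => //= w ws' /andP[z2w ->].
  by rewrite (lt_trans cz2).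
move=> y; rewrite in_cons => /orP[/eqP ->|/fw //].
by have [_ <-] := df c; have [_] := dc.
Qed.

Lemma rolle_seq (f f' : R -> R) (zs : seq R) :
  (forall x : R, is_derive x (1 : R) f (f' x)) -> uniq zs -> (forall y, y \in zs -> f y = 0) ->
  exists ws, [/\ size ws = (size zs).-1, uniq ws & forall y, y \in ws -> f' y = 0].
Proof.
move=> df uz fz.
have : sorted <%R (sort <=%R zs) by rewrite sort_lt_sorted.
have fz' y : y \in sort <=%R zs -> f y = 0 by rewrite mem_sort; exact: fz.
rewrite -(size_sort <=%R zs); case: (sort _ _) fz' => [|z s] fz' /=.
  by exists [::].
move=> pz; have [||ws [sw pw fw]] := rolle_path df pz.
- by apply: fz'; rewrite mem_head.
- by move=> y ys; apply: fz'; rewrite in_cons ys orbT.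
exists ws; split=> //; apply: (@sorted_uniq _ <%R); first exact: lt_trans.
  exact: ltxx.
by apply: path_sorted pw.
Qed.

Definition expo (L : seq (R * {poly R})) (x : R) :=
  \sum_(p <- L) p.2.[x] * expR (p.1 * x).

Lemma is_derive_expo L (x : R) :
  is_derive x (1 : R) (expo L) (expo [seq (p.1, p.2^`() + p.1 *: p.2) | p <- L] x).
Proof.
elim: L => [|[k P] L IH].
  by rewrite /expo /= big_nil; under eq_fun do rewrite big_nil; exact: is_derive_cst.
rewrite /expo /= big_cons; under eq_fun do rewrite big_cons /=.
apply: is_deriveD => /=.
have -> : (fun y => P.[y] * expR (k * y)) = (horner P) * (expR \o ( *%R k)).
  by apply/funext.
apply: is_derive_eq.
rewrite !hornerE /GRing.scale /=; ring.
Qed.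

(** Induction on the number of coefficients. After multiplication by exp(- p.1 x) the polynomial of
    [p] has frequency zero, so differentiation shrinks it and enlarges no other one, while Rolle's
    theorem loses at most one zero. *)
Lemma expo_zeros L zs : uniq (unzip1 L) -> uniq zs ->
  (forall x, x \in zs -> expo L x = 0) ->
  (\sum_(p <- L) size p.2 <= size zs)%N -> forall p, p \in L -> p.2 = 0.
Proof.
move: {2}(\sum_(p <- L) size p.2)%N (leqnn (\sum_(p <- L) size p.2)%N) => n.
elim: n L zs => [|n IH] L zs sL uL uz Lz szs p pL.
  apply/eqP; rewrite -size_poly_eq0.
  by move: sL; rewrite leqn0 sum_nat_seq_eq0 => /allP/(_ _ pL).
apply: contrapT => /eqP p0.
pose L1 := [seq (q.1 - p.1, q.2) | q <- L].
pose L2 := [seq (q.1, q.2^`() + q.1 *: q.2) | q <- L1].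
have E1 x : expo L1 x = expR (- p.1 * x) * expo L x.
  rewrite /expo big_map big_distrr /=; apply: eq_bigr => q _.
  by rewrite mulrCA -expRD; congr (_ * expR _); ring.
have [|ws [sw uw fw]] := rolle_seq (is_derive_expo L1) uz.
  by move=> y yz; rewrite E1 Lz // mulr0.
have sz2 (k : R) (P : {poly R}) : (size (P^`() + k *: P)%R <= size P)%N.
  rewrite (leq_trans (size_polyD _ _)) // geq_max size_scale_leq andbT.
  by have [->|/lt_size_deriv/ltnW] := eqVneq P 0; rewrite ?deriv0.
have s2 : (\sum_(q <- L2) size q.2 < \sum_(q <- L) size q.2)%N.
  rewrite !big_map /= (big_rem p) //= [in X in (_ < X)%N](big_rem p) //= -addSn leq_add //.
    rewrite subrr scale0r addr0; exact: lt_size_deriv.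
  by apply: leq_sum => q _; exact: sz2.
have L20 q : q \in L2 -> q.2 = 0.
  apply: (IH L2 ws) => //.
  - by rewrite -ltnS (leq_trans s2).
  - rewrite /unzip1 -!map_comp (eq_map (g := (fun x => x - p.1) \o fst)) //.
    by rewrite map_comp map_inj_uniq // => a b /addIr.
  - by rewrite sw -ltnS (leq_trans s2) // (leq_trans szs) // leqSpred.
(* At a nonzero frequency k the term k q dominates q', so q' + k q = 0 forces q = 0. *)
have L0 q : q \in L -> q.1 != p.1 -> q.2 = 0.
  move=> qL qp; have /L20/= : (q.1 - p.1, q.2^`() + (q.1 - p.1) *: q.2) \in L2.
    by apply/mapP; exists (q.1 - p.1, q.2) => //; apply/mapP; exists q.
  move=> E; apply: contrapT => /eqP q0; have /polyP/(_ (size q.2).-1) := E.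
  have sq : (size q.2).-1.+1 = size q.2 by rewrite prednK // size_poly_gt0.
  rewrite coef0 coefD coefZ coef_deriv sq nth_default // mul0rn add0r => /eqP.
  by rewrite mulf_eq0 subr_eq0 (negPf qp) -/(lead_coef _) lead_coef_eq0 (negPf q0).
have dp : p.2^`() = 0.
  have /L20/= : (p.1 - p.1, p.2^`() + (p.1 - p.1) *: p.2) \in L2.
    by apply/mapP; exists (p.1 - p.1, p.2) => //; apply/mapP; exists p.
  by rewrite subrr scale0r addr0.
have [c pc] : exists c, p.2 = c%:P.
  exists p.2`_0; apply/polyP => -[|i]; rewrite coefC //=.
  have /polyP/(_ i) := dp; rewrite coef_deriv coef0 => /eqP.
  by rewrite -mulr_natl mulf_eq0 pnatr_eq0 => /eqP.
have [z zz] : exists z, z \in zs.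
  have : (0 < size zs)%N by apply: leq_trans szs; apply: leq_ltn_trans s2.
  by case: (zs) => // a s _; exists a; rewrite mem_head.
have := E1 z; rewrite Lz // mulr0 /expo big_map (big_rem p) //= big_seq big1 => [|q qL].
  rewrite addr0 subrr mul0r expR0 mulr1 pc hornerC => c0.
  by move: p0; rewrite pc c0 eqxx.
rewrite L0 ?horner0 ?mul0r //; first exact: mem_rem qL.
have uLL : uniq L by exact: map_uniq uL.
move: qL; rewrite mem_rem_uniq // inE => /andP[qp qL].
apply: contraNneq qp => q1.
have := uL; move: pL qL q1; rewrite /unzip1.
elim: (L) => // a s IHs; rewrite !in_cons /= => pa qa q1 /andP[na us].
case/orP: pa => [/eqP pa|pa]; case/orP: qa => [/eqP qa|qa].
- by rewrite pa qa.
- by move: na; rewrite -pa -q1 map_f.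
- by move: na; rewrite -qa q1 map_f.
- exact: IHs.
Qed.

Lemma expo_nat_zeros (L : seq (R * {poly R})) (hs : seq nat) :
  uniq (unzip1 L) -> (forall p, p \in L -> 0 < p.1) -> uniq hs ->
  (forall h, h \in hs -> \sum_(p <- L) p.2.[h%:R] * p.1 ^+ h = 0) ->
  (\sum_(p <- L) size p.2 <= size hs)%N -> forall p, p \in L -> p.2 = 0.
Proof.
move=> uL L0 uh Lh sh p pL.
apply: (@expo_zeros [seq (ln q.1, q.2) | q <- L] [seq h%:R | h <- hs] _ _ _ _ (ln p.1, p.2)).
- rewrite /unzip1 -map_comp (eq_map (g := (@ln R) \o fst)) // map_comp map_inj_in_uniq //.
  by move=> a b /mapP[q /L0 q0 ->] /mapP[q' /L0 q0' ->]; apply: ln_inj; rewrite posrE.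
- by rewrite map_inj_uniq // => a b /eqP; rewrite eqr_nat => /eqP.
- move=> x /mapP[h hh ->]; rewrite /expo big_map; apply: etrans (Lh h hh).
  rewrite [LHS]big_seq [RHS]big_seq.
  by apply: eq_bigr => q /L0 q0; rewrite /= expRM_natr lnK ?posrE.
- by rewrite big_map size_map.
- by apply/mapP; exists p.
Qed.

(** The bases stay real, so the real and imaginary parts of the coefficients satisfy separate real
    relations. *)
Lemma expo_complex_zeros (L : seq (R * {poly R[i]})) (hs : seq nat) :
  uniq (unzip1 L) -> (forall p, p \in L -> 0 < p.1) -> uniq hs ->
  (forall h, h \in hs -> \sum_(p <- L) p.2.[h%:R] * p.1%:C ^+ h = 0) ->
  (\sum_(p <- L) size p.2 <= size hs)%N -> forall p, p \in L -> p.2 = 0.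
Proof.
move=> uL L0 uh Lh sh p pL.
have key (f : {additive R[i] -> R}) :
    (forall (x : R[i]) (a : R), f (x * a%:C) = f x * a) -> map_poly f p.2 = 0.
  move=> fM; have hornf (P : {poly R[i]}) (a : R) : (map_poly f P).[a] = f P.[a%:C].
    rewrite /map_poly horner_poly horner_coef raddf_sum.
    by apply: eq_bigr => i _; rewrite -rmorphXn /= fM.
  apply: (@expo_nat_zeros [seq (q.1, map_poly f q.2) | q <- L] hs _ _ uh _ _ (p.1, map_poly f p.2)).
  - by rewrite /unzip1 -map_comp (eq_map (g := fst)).
  - by move=> q /mapP[q' /L0 q0 ->].
  - move=> h hh; rewrite big_map /= -[RHS](raddf0 f); apply: etrans (congr1 f (Lh h hh)).
    rewrite raddf_sum.
    apply: eq_bigr => q _.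
    have -> : q.1%:C ^+ h = (q.1 ^+ h)%:C by rewrite rmorphXn.
    by rewrite hornf fM rmorph_nat.
  - apply: leq_trans sh; rewrite big_map; apply: leq_sum => q _.
    exact: size_poly.
  - by apply/mapP; exists p.
apply/polyP => i; rewrite coef0; apply/eqP; rewrite eq_complex /=.
have RM (x : R[i]) (a : R) : complex.Re (x * a%:C) = complex.Re x * a.
  by case: x => x y /=; rewrite mulr0 subr0.
have IM (x : R[i]) (a : R) : complex.Im (x * a%:C) = complex.Im x * a.
  by case: x => x y /=; rewrite mulr0 add0r.
have /polyP/(_ i) := key (@complex.Re R) RM.
have /polyP/(_ i) := key (@complex.Im R) IM.
by rewrite !coef_map !coef0 /= => -> ->; rewrite !eqxx.
Qed.

End ExpoPoly.

(** * Elimination of one of two variables *)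

Section Elimination.
Variable C : numClosedFieldType.
Implicit Types (p q G w : {poly {poly C}}).

(* Bivariate evaluation: the outer variable is s, the coefficients are in t. *)
Definition ev2 p (t s : C) := p.[s%:P].[t].

Lemma ev2D p q t s : ev2 (p + q) t s = ev2 p t s + ev2 q t s.
Proof. by rewrite /ev2 !hornerD. Qed.

Lemma ev2M p q t s : ev2 (p * q) t s = ev2 p t s * ev2 q t s.
Proof. by rewrite /ev2 !hornerM. Qed.

Lemma ev2Z (c : {poly C}) p t s : ev2 (c *: p) t s = c.[t] * ev2 p t s.
Proof. by rewrite /ev2 hornerZ hornerM. Qed.

Lemma ev2E p t s : ev2 p t s = (map_poly (horner_eval t) p).[s].
Proof. by rewrite -[s in RHS](hornerC s t) (horner_map (horner_eval t)). Qed.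

Lemma pseudo_gcd p q : exists (D u v p1 q1 : {poly {poly C}}) (a b c d : {poly C}),
  [/\ [/\ a != 0, b != 0, c != 0 & d != 0], a *: (u * p + v * q) = b *: D,
      c *: p = p1 * D & d *: q = q1 * D].
Proof.
have [uv /Pdiv.Idomain.eqpP[[c1 c2] /= /andP[c10 c20] BE]] := Pdiv.Idomain.Bezoutp p q.
have /Pdiv.Idomain.dvdpP[[c3 p1] /= c30 pE] := Pdiv.Idomain.dvdp_gcdl p q.
have /Pdiv.Idomain.dvdpP[[c4 q1] /= c40 qE] := Pdiv.Idomain.dvdp_gcdr p q.
by exists (Pdiv.Idomain.gcdp p q), uv.1, uv.2, p1, q1, c1, c2, c3, c4.
Qed.

Lemma scale_eq0P (c : {poly C}) p : c != 0 -> c *: p = 0 -> p = 0.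
Proof.
move=> c0 /(congr1 (fun q : {poly {poly C}} => size q)).
by rewrite (size_scale _ c0) size_poly0 => /eqP; rewrite size_poly_eq0 => /eqP.
Qed.

Definition never_common (es : seq {poly {poly C}}) w (t : C) :=
  forall s, (forall e, e \in es -> ev2 e t s = 0) -> ev2 w t s = 0.

(** Zariski density of the set where [P] holds; on the affine line this says that the set is
    infinite. *)
Definition generically (P : C -> Prop) :=
  forall rho : {poly C}, rho != 0 -> exists t, rho.[t] != 0 /\ P t.

(** [G] is divided by its gcd with [w] over the field of rational functions in t. If the gcd is
    constant in s and [G] is not, then for most t a root of [G] is not a root of [w], against the
    assumption. So the division goes on until [G] is constant in s; the exceptional t are the roots
    of that constant and of the cleared denominators. *)
Lemma elim_single G w : generically (never_common [:: G] w) ->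
  exists2 rho : {poly C}, rho != 0 &
    forall t s, ev2 G t s = 0 -> ev2 w t s != 0 -> rho.[t] = 0.
Proof.
move: {2}(size G) (leqnn (size G)) => n; elim: n G => [|n IH] G sG HG.
  have G0 : G = 0 by apply/eqP; rewrite -size_poly_eq0 -leqn0.
  have [w0|w0] := eqVneq w 0.
    by exists 1; rewrite ?oner_neq0 // => t s _; rewrite w0 /ev2 !horner0 eqxx.
  have lw : lead_coef w != 0 by rewrite lead_coef_eq0.
  have [t [lt nt]] := HG _ lw.
  have : map_poly (horner_eval t) w != 0.
    by rewrite -size_poly_eq0 size_map_poly_id0 // size_poly_eq0.
  move=> /closed_nonrootP[s]; rewrite /root -ev2E nt ?eqxx // => e.
  by rewrite inE => /eqP ->; rewrite G0 /ev2 !horner0.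
have [G0|G0] := eqVneq G 0.
  by apply: IH; rewrite // G0 size_poly0.
have lG : lead_coef G != 0 by rewrite lead_coef_eq0.
have [sG1|sG1] := eqVneq (size G) 1%N.
  have [c c0 GE] := size_poly1P _ (introT eqP sG1).
  by exists c => // t s; rewrite GE /ev2 hornerC.
have [D [u [v [G1 [w1 [c1 [c2 [c3 [c4 [[c10 c20 c30 c40] BE GE wE]]]]]]]]]] := pseudo_gcd G w.
have D0 : D != 0.
  apply: contraNneq G0 => D0; move: GE; rewrite D0 mulr0 => GE.
  exact/eqP/(scale_eq0P c30 GE).
have G10 : G1 != 0.
  apply: contraNneq G0 => G10; move: GE; rewrite G10 mul0r => GE.
  exact/eqP/(scale_eq0P c30 GE).
have [sD|sD] := leqP (size D) 1.
  have [d d0 DE] : exists2 d, d != 0 & D = d%:P.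
    by apply/size_poly1P; rewrite eqn_leq sD size_poly_gt0.
  have [t [nt Ht]] := HG _ (mulf_neq0 lG (mulf_neq0 c20 d0)).
  move: nt; rewrite hornerM mulf_eq0 negb_or => /andP[lt dt].
  have /closed_rootP[s] : size (map_poly (horner_eval t) G) != 1%N.
    by rewrite size_map_poly_id0.
  rewrite /root -ev2E => /eqP Gs.
  have ws : ev2 w t s = 0 by apply: Ht => e; rewrite inE => /eqP ->.
  move: BE => /(congr1 (fun p => ev2 p t s)).
  rewrite !ev2Z ev2D !ev2M Gs ws !mulr0 addr0 mulr0 DE /ev2 hornerC -hornerM => /esym/eqP.
  by rewrite (negPf dt).
have sG1G : (size G1 < size G)%N.
  have <- : size (c3 *: G) = size G := size_scale G c30.
  rewrite GE size_mul //; move: (size D) sD => m; move: (size G1) => k; lia.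
have [|rho rho0 Hrho] := IH G1 (leq_trans sG1G sG).
  move=> rho rho0; have [t [nt Ht]] := HG _ (mulf_neq0 rho0 c30).
  move: nt; rewrite hornerM mulf_eq0 negb_or => /andP[nt c3t].
  exists t; split=> // s Hs; apply: Ht => e; rewrite inE => /eqP ->.
  have := Hs G1; rewrite mem_head => /(_ isT) G1s.
  move: GE => /(congr1 (fun p => ev2 p t s)); rewrite ev2Z ev2M G1s mul0r => /eqP.
  by rewrite mulf_eq0 (negPf c3t) => /eqP.
exists (rho * (c3 * c4)); first by rewrite !mulf_neq0.
move=> t s Gs ws; rewrite !hornerM; apply/eqP; rewrite !mulf_eq0.
have [e|c4t] := eqVneq c4.[t] 0; first by apply/or3P/Or33/eqP.
have Ds : ev2 D t s != 0.
  apply: contraNneq ws => Ds; move: wE => /(congr1 (fun p => ev2 p t s)).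
  by rewrite ev2Z ev2M Ds mulr0 => /eqP; rewrite mulf_eq0 (negPf c4t).
move: GE => /(congr1 (fun p => ev2 p t s)); rewrite ev2Z ev2M Gs mulr0 => /esym/eqP.
rewrite mulf_eq0 (negPf Ds) orbF => /eqP G1s.
by rewrite (Hrho t s) ?eqxx.
Qed.

(** Away from the roots of the denominators in the Bezout relations, common zeros are the zeros of
    the gcd. *)
Lemma gcd_family (es : seq {poly {poly C}}) : exists G, exists2 c : {poly C}, c != 0 &
  forall t s, c.[t] != 0 -> (ev2 G t s = 0 <-> forall e, e \in es -> ev2 e t s = 0).
Proof.
elim: es => [|e es [G [c c0 HG]]].
  exists 0, 1; rewrite ?oner_neq0 // => t s _.
  by split=> // _; rewrite /ev2 !horner0.
have [D [u [v [e1 [G1 [c1 [c2 [c3 [c4 [[c10 c20 c30 c40] BE eE GE]]]]]]]]]] := pseudo_gcd e G.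
exists D, (c * (c2 * (c3 * c4))); first by rewrite !mulf_neq0.
move=> t s; rewrite !hornerM !mulf_eq0 !negb_or => /and4P[ct c2t c3t c4t].
split=> [Ds e'|H].
  rewrite in_cons => /orP[/eqP ->|]; last first.
    move: e'; apply/HG => //.
    move: GE => /(congr1 (fun p => ev2 p t s)); rewrite ev2Z ev2M Ds mulr0 => /eqP.
    by rewrite mulf_eq0 (negPf c4t) => /eqP.
  move: eE => /(congr1 (fun p => ev2 p t s)); rewrite ev2Z ev2M Ds mulr0 => /eqP.
  by rewrite mulf_eq0 (negPf c3t) => /eqP.
have es0 : ev2 e t s = 0 by apply: H; rewrite mem_head.
have Gs : ev2 G t s = 0.
  by apply/HG => // e' e'es; apply: H; rewrite in_cons e'es orbT.
move: BE => /(congr1 (fun p => ev2 p t s)).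
rewrite !ev2Z ev2D !ev2M es0 Gs !mulr0 addr0 mulr0 => /esym/eqP.
by rewrite mulf_eq0 (negPf c2t) => /eqP.
Qed.

Lemma elim_family (es : seq {poly {poly C}}) w : generically (never_common es w) ->
  exists2 rho : {poly C}, rho != 0 &
    forall t s, (forall e, e \in es -> ev2 e t s = 0) -> ev2 w t s != 0 -> rho.[t] = 0.
Proof.
move=> Hes; have [G [c c0 HG]] := gcd_family es.
have [|rho rho0 Hrho] := @elim_single G w.
  move=> rho rho0; have [t [nt Ht]] := Hes _ (mulf_neq0 rho0 c0).
  move: nt; rewrite hornerM mulf_eq0 negb_or => /andP[nt ct].
  exists t; split=> // s Hs; apply: Ht; apply/HG => //.
  by apply: Hs; rewrite mem_head.
exists (rho * c); first exact: mulf_neq0.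
move=> t s Hs ws; rewrite hornerM; have [->|ct] := eqVneq c.[t] 0; first by rewrite mulr0.
by rewrite (Hrho t s) ?mul0r //; apply/HG.
Qed.

End Elimination.

(** * Relations between exponentials on the heights *)

Section Heights.
Variable R : realType.
Local Notation C := R[i].

Definition nsq (t : C) : R := complex.Re t ^+ 2 + complex.Im t ^+ 2.

Lemma nsqE t : (nsq t)%:C = t * conjc t.
Proof. by rewrite /nsq add_Re2_Im2 sqr_normc. Qed.

Lemma nsq_gt0 t : t != 0 -> 0 < nsq t.
Proof.
move=> t0; rewrite lt_def addr_ge0 ?sqr_ge0 // andbT.
apply: contraNneq t0 => E; rewrite eq_complex /=.
have := eqxx (0 : R); rewrite -{1}E paddr_eq0 ?sqr_ge0 // !sqrf_eq0.
by [].
Qed.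

Definition pconj (P : {poly C}) := map_poly conjc P.

Lemma pconj_nat P (n : nat) : (pconj P).[n%:R] = conjc P.[n%:R].
Proof. by rewrite -[in LHS](conjc_nat R n) horner_map. Qed.

Lemma size_pconj P : size (pconj P) = size P.
Proof. by rewrite size_map_inj_poly ?conjc0 //; exact: (can_inj (@conjcK R)). Qed.

Variables (T : finType) (h : T -> nat) (hs : seq nat).
Hypothesis hs_uniq : uniq hs.
Hypothesis hs6 : (6 <= size hs)%N.
Hypothesis hsP : forall n, n \in hs -> exists b, h b = n.
Hypothesis hAP : forall (t u : C) (h0 : nat), t != 0 -> t != 1 ->
  ~ forall b, h b != h0 -> t ^+ h b = u.

(** Here the heights are spent: six distinct zeros are enough to kill six coefficients, as long as
    the bases are positive reals. *)
Lemma expo_heights (L : seq (R * {poly C})) :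
  uniq (unzip1 L) -> (forall p, p \in L -> 0 < p.1) ->
  (forall b, \sum_(p <- L) p.2.[(h b)%:R] * p.1%:C ^+ h b = 0) ->
  (\sum_(p <- L) size p.2 <= 6)%N -> forall p, p \in L -> p.2 = 0.
Proof.
move=> uL L0 Lh sL; apply: (expo_complex_zeros uL L0 hs_uniq).
  by move=> n /hsP[b <-].
exact: leq_trans sL hs6.
Qed.

Lemma poly_heights (P : {poly C}) : (size P <= 6)%N ->
  (forall b, P.[(h b)%:R] = 0) -> P = 0.
Proof.
move=> sP P0; apply: (@expo_heights [:: (1, P)] _ _ _ _ (1, P)).
- by [].
- by move=> p; rewrite inE => /eqP -> /=.
- by move=> b; rewrite big_seq1 /= P0 mul0r.
- by rewrite big_seq1.
- by rewrite mem_head.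
Qed.

Lemma expo2_heights (r : R) (P Q : {poly C}) : 0 < r -> r != 1 ->
  (size P + size Q <= 6)%N ->
  (forall b, P.[(h b)%:R] + Q.[(h b)%:R] * r%:C ^+ h b = 0) -> P = 0 /\ Q = 0.
Proof.
move=> r0 r1 sz H.
have E : forall p, p \in [:: (1, P); (r, Q)] -> p.2 = 0.
  apply: expo_heights.
  - by rewrite /= inE eq_sym r1.
  - by move=> p; rewrite !inE => /orP[] /eqP -> /=.
  - by move=> b; rewrite big_cons big_seq1 /= expr1n mulr1.
  - by rewrite big_cons big_seq1.
by split; [apply: (E (1, P))|apply: (E (r, Q))]; rewrite !inE eqxx ?orbT.
Qed.

Lemma nsqX t n : (nsq t)%:C ^+ n = t ^+ n * conjc (t ^+ n).
Proof. by rewrite nsqE exprMn rmorphXn. Qed.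

Lemma const_heights (t u : C) : t != 0 -> t != 1 -> ~ forall b, t ^+ h b = u.
Proof. by move=> t0 t1 H; apply: (hAP (h0 := 0%N) (u := u) t0 t1) => b _. Qed.

(** As t is complex, one passes to squared moduli: |t|^(2h) equals P times its conjugate at h, a
    relation with four coefficients. It forces |t| = 1; then P divides 1, hence is constant, and so
    is t^h. *)
Lemma affine_heights (t a d : C) : t != 0 -> t != 1 ->
  ~ forall b, t ^+ h b = a + d * (h b)%:R.
Proof.
move=> t0 t1 H; pose P : {poly C} := a%:P + d%:P * 'X.
have PE b : t ^+ h b = P.[(h b)%:R] by rewrite !hornerE H.
have sP : (size P <= 2)%N.
  apply: leq_trans (size_polyD _ _) _; rewrite geq_max size_polyC.
  rewrite (leq_trans (leq_b1 _)) //= (leq_trans (size_polyMleq _ _)) //.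
  by rewrite size_polyX size_polyC; case: (d != 0).
have sPP : (size (P * pconj P)%R <= 3)%N.
  by apply: leq_trans (size_polyMleq _ _) _; rewrite size_pconj; lia.
have EE b : (nsq t)%:C ^+ h b = (P * pconj P).[(h b)%:R].
  by rewrite nsqX hornerM pconj_nat PE.
have [r1|r1] := eqVneq (nsq t) 1.
  have PP1 : P * pconj P = 1.
    apply/eqP; rewrite -subr_eq0; apply/eqP; apply: poly_heights.
      rewrite (leq_trans (size_polyD _ _)) // geq_max size_polyN size_poly1 andbT.
      by rewrite (leq_trans sPP).
    by move=> b; rewrite hornerD hornerN -EE r1 hornerC expr1n subrr.
  have sP1 : size P = 1%N.
    have : P \is a GRing.unit.
      apply/unitrP; exists (pconj P); by rewrite mulrC PP1.
    by rewrite poly_unitE => /andP[/eqP].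
  have /size_poly1P[u _ Pu] : size P == 1%N by rewrite sP1.
  by apply: (const_heights (u := u) t0 t1) => b; rewrite PE Pu hornerC.
have [||_ /eqP] := @expo2_heights (nsq t) (- (P * pconj P)) 1 (nsq_gt0 t0) r1.
- by rewrite size_polyN size_poly1; apply: leq_trans (leq_add sPP (leqnn 1%N)) _.
- by move=> b; rewrite hornerN -EE hornerC mul1r addNr.
by rewrite oner_eq0.
Qed.

(** Both expressions of h t^h agree on six heights, so X P = Q as polynomials; comparing degrees, P
    is affine. *)
Lemma quad_heights (t : C) (P Q : {poly C}) : t != 0 -> t != 1 ->
  (size P <= 3)%N -> (size Q <= 3)%N ->
  (forall b, t ^+ h b = P.[(h b)%:R]) ->
  ~ forall b, (h b)%:R * t ^+ h b = Q.[(h b)%:R].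
Proof.
move=> t0 t1 sP sQ HP HQ.
have E : 'X * P = Q.
  apply/eqP; rewrite -subr_eq0; apply/eqP; apply: poly_heights.
    rewrite (leq_trans (size_polyD _ _)) // geq_max size_polyN (leq_trans sQ) // andbT.
    by rewrite (leq_trans (size_polyMleq _ _)) // size_polyX; lia.
  by move=> b; rewrite hornerD hornerN hornerM hornerX -HP HQ subrr.
have P2 : P`_2 = 0.
  have /polyP/(_ 3%N) := E; rewrite coefXM /= => ->.
  by rewrite nth_default.
apply: (affine_heights (a := P`_0) (d := P`_1) t0 t1) => b.
rewrite HP (horner_coef_wide _ sP) !big_ord_recl big_ord0 /= P2.
by rewrite /bump /= expr0 expr1; ring.
Qed.

(** Squared moduli give a relation with 3 coefficients at the base 1 and 3 at |t|^2, just what six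
    heights exclude when |t|^2 differs from 1. *)
Lemma special_modulus (t : C) (P Q : {poly C}) : t != 0 ->
  (size P <= 3)%N -> (size Q <= 3)%N -> (size (P * pconj P)%R <= 3)%N ->
  (size (Q * pconj Q)%R <= 3)%N -> Q != 0 ->
  (forall b, Q.[(h b)%:R] * t ^+ h b = P.[(h b)%:R]) -> nsq t = 1.
Proof.
move=> t0 sP sQ sPP sQQ Q0 H; apply/eqP/negPn/negP => r1.
have [||_ /eqP] := @expo2_heights (nsq t) (- (P * pconj P)) (Q * pconj Q) (nsq_gt0 t0) r1.
- by rewrite size_polyN; apply: (leq_add sPP sQQ).
- move=> b; rewrite hornerN !hornerM !pconj_nat -H rmorphM nsqX; ring.
rewrite mulf_eq0 (negPf Q0) /= -size_poly_eq0 size_pconj size_poly_eq0.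
by rewrite (negPf Q0).
Qed.

(* If all six of 1, h, t^h, h t^h, s^h, h s^h lay in a 3-dimensional space, t^h
   would be a Moebius function of h with values in the intersection of two circles. *)
Lemma triple_heights (t s al be ga a b0 d a' b' d' : C) :
  t != 0 -> t != 1 -> s != 0 -> s != 1 -> s != t ->
  (forall b, (h b)%:R * t ^+ h b = al + be * (h b)%:R + ga * t ^+ h b) ->
  (forall b, s ^+ h b = a + b0 * (h b)%:R + d * t ^+ h b) ->
  ~ forall b, (h b)%:R * s ^+ h b = a' + b' * (h b)%:R + d' * t ^+ h b.
Proof.
move=> t0 t1 s0 s1 st H1 H2 H3.
pose Q : {poly C} := 'X - ga%:P.
pose P : {poly C} := al%:P + be%:P * 'X.
have sQ : size Q = 2%N by rewrite size_XsubC.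
have saff (x y : C) : (size (x%:P + y%:P * 'X)%R <= 2)%N.
  apply: leq_trans (size_polyD _ _) _; rewrite geq_max size_polyC.
  rewrite (leq_trans (leq_b1 _)) //= (leq_trans (size_polyMleq _ _)) //.
  by rewrite size_polyX size_polyC; case: (y != 0).
have sP : (size P <= 2)%N by exact: saff.
have QP b : Q.[(h b)%:R] * t ^+ h b = P.[(h b)%:R].
  by rewrite !hornerE mulrBl H1; ring.
(* The two expressions of h s^h, multiplied by Q and rewritten through Q t^h = P; their difference
   is a polynomial of size at most 4 that vanishes at all heights. *)
pose W : {poly C} := 'X * ((a%:P + b0%:P * 'X) * Q + d%:P * P)
   - ((a'%:P + b'%:P * 'X) * Q + d'%:P * P).
have sM (A B : {poly C}) m n : (size A <= m)%N -> (size B <= n)%N ->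
    (size (A * B)%R <= (m + n).-1)%N.
  by move=> *; apply: leq_trans (size_polyMleq _ _) _; lia.
have sD (A B : {poly C}) m : (size A <= m)%N -> (size B <= m)%N ->
    (size (A + B)%R <= m)%N.
  by move=> sA sB; rewrite (leq_trans (size_polyD _ _)) // geq_max sA.
have sC (x : C) : (size x%:P <= 1)%N by rewrite size_polyC leq_b1.
have sX : (size ('X : {poly C}) <= 2)%N by rewrite size_polyX.
have sQ2 : (size Q <= 2)%N by rewrite sQ.
have sdP (x : C) : (size (x%:P * P)%R <= 3)%N.
  by apply: leq_trans (sM _ _ 1%N 2%N (sC _) sP) _.
have s3 (x y z : C) : (size ((x%:P + y%:P * 'X) * Q + z%:P * P)%R <= 3)%N.
  by apply: sD; [apply: (sM _ _ 2%N 2%N)|exact: sdP].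
have W0 : W = 0.
  apply: poly_heights.
    apply: sD; first by apply: leq_trans (sM _ _ 2%N 3%N sX (s3 _ _ _)) _.
    by rewrite size_polyN (leq_trans (s3 _ _ _)).
  move=> b; rewrite /W !hornerE -/P -/Q.
  have e1 := QP b; have e2 := H2 b; have e3 := H3 b.
  rewrite /Q /P !hornerE in e1 *; set x := (h b)%:R in e1 e2 e3 *.
  set u := t ^+ h b in e1 e2 e3; set v := s ^+ h b in e2 e3.
  have -> : al + be * x = (x - ga) * u by rewrite e1.
  have -> : x * ((a + b0 * x) * (x - ga) + d * ((x - ga) * u)) =
            (x - ga) * (x * (a + b0 * x + d * u)) by ring.
  by rewrite -e2 e3; ring.
(* The coefficient of X^3 in [W] is [b0]. *)
have b00 : b0 = 0.
  have /polyP/(_ 3%N) := W0; rewrite /W coef0 coefB coefXM /= => /eqP.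
  rewrite [X in _ - X]nth_default ?s3 // subr0 coefD [X in _ + X]nth_default; last first.
    by apply: leq_trans (sM _ _ 1%N 2%N (sC _) sP) _.
  rewrite addr0 /Q mulrBr coefB [X in _ - X]nth_default; last first.
    by apply: leq_trans (sM _ _ 2%N 1%N (saff _ _) (sC _)) _.
  by rewrite subr0 coefMX /= coefD coefC /= add0r coefMX coefC /= => /eqP.
have {}H2 b : s ^+ h b = a + d * t ^+ h b by rewrite H2 b00 mul0r addr0.
have d0 : d != 0.
  apply/eqP => d0; apply: (const_heights (u := a) s0 s1) => b.
  by rewrite H2 d0 mul0r addr0.
have a0 : a != 0.
  apply/eqP => a0; apply: (const_heights (t := s / t) (u := d)).
  - by rewrite mulf_neq0 // invr_neq0.
  - by apply: contraNneq st => E; rewrite -(mulfVK t0 s) E mul1r.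
  - by move=> b; rewrite expr_div_n H2 a0 add0r mulfK // expf_neq0.
have Q0 : Q != 0 by rewrite polyXsubC_eq0.
have rt : nsq t = 1.
  apply: (special_modulus (P := P) (Q := Q)) => //.
  - exact: leq_trans sP _.
  - by rewrite sQ.
  - by apply: (sM _ _ 2%N 2%N); rewrite ?size_pconj.
  - by apply: (sM _ _ 2%N 2%N); rewrite ?size_pconj.
have rs : nsq s = 1.
  have sP2 : (size (a%:P * Q + d%:P * P)%R <= 2)%N.
    by apply: sD; [apply: leq_trans (sM _ _ 1%N 2%N (sC _) sQ2) _|
                   apply: leq_trans (sM _ _ 1%N 2%N (sC _) sP) _].
  apply: (special_modulus (P := a%:P * Q + d%:P * P) (Q := Q)) => //.
  - exact: leq_trans sP2 _.
  - by rewrite sQ.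
  - by apply: (sM _ _ 2%N 2%N); rewrite ?size_pconj.
  - by apply: (sM _ _ 2%N 2%N); rewrite ?size_pconj.
  - by move=> b; rewrite H2 mulrDr mulrCA QP [in RHS]hornerD ![in RHS]hornerM ![in RHS]hornerC (mulrC a).
(* The number u = t^h lies on the circles |u| = 1 and |a + d u| = 1. Eliminating its conjugate
   leaves a quadratic equation, nontrivial because [a] and [d] are nonzero. *)
pose k := a * conjc a + d * conjc d - 1.
have quad b : conjc a * d * (t ^+ h b) ^+ 2 + k * t ^+ h b + a * conjc d = 0.
  have := nsqX s (h b); rewrite rs expr1n H2 rmorphD rmorphM.
  have := nsqX t (h b); rewrite rt expr1n.
  set u := t ^+ h b => uu E.
  have E' : 1 = (a + d * u) * (conjc a + conjc d * conjc u) := E.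
  have -> : k = - (a * conjc d * conjc u + conjc a * d * u) + d * conjc d * (1 - u * conjc u).
    have aE : a * conjc a = 1 - a * conjc d * conjc u - d * u * conjc a
        - d * conjc d * (u * conjc u) by rewrite E'; ring.
    by rewrite /k aE; ring.
  rewrite -uu subrr mulr0 addr0.
  transitivity (a * conjc d * (1 - u * conjc u)); first by ring.
  by rewrite -uu subrr mulr0.
pose q : {poly C} := (conjc a * d)%:P * 'X^2 + k%:P * 'X + (a * conjc d)%:P.
have [u1 [u2 quE]] : exists u1 u2, forall u,
    conjc a * d * u ^+ 2 + k * u + a * conjc d = conjc a * d * ((u - u1) * (u - u2)).
  have l0 : conjc a * d != 0 by rewrite mulf_neq0 ?conjc_eq0.
  have sq : size q = 3%N.
    have sz1 : size ((conjc a * d)%:P * 'X^2) = 3%N.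
      by rewrite mul_polyC size_scale ?size_polyXn.
    rewrite /q -addrA size_polyDl sz1 // ltnS addrC; exact: saff.
  have [u1 ru1] : exists u1, root q u1 by apply/closed_rootP; rewrite sq.
  have E1 : conjc a * d * u1 ^+ 2 + k * u1 + a * conjc d = 0.
    by move: ru1; rewrite /root /q !hornerD !hornerM !hornerC !hornerX expr2 => /eqP.
  exists u1, (- k / (conjc a * d) - u1) => u.
  move: (conjc a * d) (a * conjc d) l0 E1 => e f e0 E1.
  have -> : f = - (e * u1 ^+ 2 + k * u1) by rewrite -[RHS]addr0 -E1; ring.
  by field.
(* Since t^h takes only the values u1 and u2, the product (P - u1 Q)(P - u2 Q), of size at most 3,
   vanishes at all heights. *)
have [i Pi] : exists u0, P = u0%:P * Q.
  have : (P - u1%:P * Q) * (P - u2%:P * Q) = 0.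
    apply: poly_heights.
      have s2 x : (size (P - x%:P * Q)%R <= 2)%N.
        apply: sD => //; rewrite size_polyN.
        by apply: leq_trans (sM _ _ 1%N 2%N (sC _) sQ2) _.
      by apply: leq_trans (sM _ _ 2%N 2%N (s2 _) (s2 _)) _.
    have gen (A B : {poly C}) x u : B.[x] * u = A.[x] ->
        ((A - u1%:P * B) * (A - u2%:P * B)).[x] = B.[x] ^+ 2 * ((u - u1) * (u - u2)).
      by move=> e; rewrite !(hornerM, hornerD, hornerN, hornerC) -e; ring.
    move=> b; rewrite (gen _ _ _ _ (QP b)).
    have := quad b; rewrite quE => /eqP.
    by rewrite mulf_eq0 mulf_eq0 conjc_eq0 (negPf a0) (negPf d0) /= => /eqP ->; rewrite mulr0.
  by move=> /eqP; rewrite mulf_eq0 !subr_eq0 => /orP[] /eqP; [exists u1|exists u2].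
have tQ b : Q.[(h b)%:R] * (t ^+ h b - i) = 0.
  by rewrite mulrBr QP {1}Pi hornerM hornerC mulrC subrr.
(* Now (h - ga)(t^h - i) = 0: the only height where t^h may differ from [i] is [ga]. This is where
   one height has to be left out of the progression. *)
have [[n nE]|nn] := pselect (exists n : nat, ga = n%:R).
  apply: (hAP (h0 := n) (u := i) t0 t1) => b hb.
  have := tQ b; rewrite /Q !hornerE nE => /eqP.
  by rewrite mulf_eq0 subr_eq0 eqr_nat (negPf hb) subr_eq0 => /eqP.
apply: (const_heights (u := i) t0 t1) => b.
have := tQ b; rewrite /Q !hornerE => /eqP.
rewrite mulf_eq0 subr_eq0 [X in _ || X]subr_eq0 => /orP[/eqP E|/eqP //].
by case: nn; exists (h b).
Qed.

Lemma two_heights : exists b0 b1, h b0 != h b1.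
Proof.
case: hs hs_uniq hs6 hsP => [|x [|y s]] //= /andP[nx _] _ H.
have [b0 E0] := H x (mem_head _ _).
have [|b1 E1] := H y; first by rewrite !inE eqxx orbT.
exists b0, b1; rewrite E0 E1; apply: contraNneq nx => ->; exact: mem_head.
Qed.

(** Squared moduli give a relation between the positive bases |s|^2, 1, n and n^2. If they are
    distinct it cannot hold. If |s|^2 is one of the other three, comparing coefficients leaves s^h
    or (s/n)^h constant, or p = q = 0. *)
Lemma trinomial_real (n : nat) (s p q : C) : (2 <= n)%N ->
  s != 0 -> s != 1 -> s != n%:R ->
  ~ forall b, s ^+ h b = p + q * n%:R ^+ h b.
Proof.
move=> n2 s0 s1 sn H.
have n0 : (n%:R : C) != 0 by rewrite pnatr_eq0 -lt0n ltnW.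
pose r := nsq s; have r0 : 0 < r := nsq_gt0 s0.
pose A := p * conjc p; pose B := p * conjc q + conjc p * q; pose D := q * conjc q.
have rn (m : nat) : (m%:R : R)%:C = m%:R :> C by rewrite rmorph_nat.
have E b : r%:C ^+ h b = A + B * n%:R ^+ h b + D * (n ^ 2)%:R ^+ h b.
  rewrite /r nsqX H rmorphD rmorphM rmorphXn /= conjc_nat natrX -exprM mulnC exprM /A /B /D.
  ring.
have sc (x : C) : (size x%:P <= 1)%N by rewrite size_polyC leq_b1.
have nn (m k : nat) : m != k -> (m%:R : R) != k%:R by rewrite eqr_nat.
have pc0 (x : C) : x%:P = 0 :> {poly C} -> x = 0.
  by move=> /eqP; rewrite polyC_eq0 => /eqP.
have pq0 (x : C) : x * conjc x = 0 -> x = 0.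
  by move=> /eqP; rewrite mulf_eq0 conjc_eq0 orbb => /eqP.
have n1 : (1 : R) != n%:R by rewrite (nn 1%N n) // neq_ltn n2.
have n3 : (1 : R) != (n ^ 2)%:R by rewrite (nn 1%N) // neq_ltn -(exp1n 2) ltn_exp2r // n2.
have n4 : (n%:R : R) != (n ^ 2)%:R.
  by rewrite nn // neq_ltn -{1}(expn1 n) ltn_exp2l.
have pos (m : nat) : (0 < m)%N -> (0 : R) < m%:R by rewrite ltr0n.
have np : (0 < n)%N by exact: ltnW.
have nnp : (0 < n ^ 2)%N by rewrite expn_gt0 np.
have key (a b d : C) :
    (forall x, a + b * n%:R ^+ h x + d * (n ^ 2)%:R ^+ h x = 0) -> [/\ a = 0, b = 0 & d = 0].
  move=> Hx; have H0 : forall P, P \in [:: (1 : R, a%:P); (n%:R, b%:P); ((n ^ 2)%:R, d%:P)] -> P.2 = 0.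
    apply: expo_heights.
    - by rewrite /= !inE negb_or n1 n3 n4.
    - by move=> P; rewrite !inE => /or3P[] /eqP -> /=; rewrite ?ltr01 ?pos.
    - by move=> x; rewrite !big_cons big_nil /= !hornerC !rn expr1n mulr1 addr0 addrA.
    - rewrite !big_cons big_nil /= addn0.
      by apply: leq_trans (leq_add (sc a) (leq_add (sc b) (sc d))) _.
  split; apply: pc0.
  - by apply: (H0 (1, a%:P)); rewrite !inE eqxx.
  - by apply: (H0 (n%:R, b%:P)); rewrite !inE eqxx !orbT.
  - by apply: (H0 ((n ^ 2)%:R, d%:P)); rewrite !inE eqxx !orbT.
have [r1|r1] := eqVneq r 1.
  have [|_ _ /pq0 q0] := key (A - 1) B D.
    by move=> x; have := E x; rewrite r1 expr1n => /eqP; rewrite eq_sym -subr_eq0 => /eqP <-; ring.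
  by apply: (const_heights (u := p) s0 s1) => b; rewrite H q0 mul0r addr0.
have [r2|r2] := eqVneq r n%:R.
  have [|/pq0 p0 _ /pq0 q0] := key A (B - 1) D.
    by move=> x; have := E x; rewrite r2 rn => /eqP; rewrite eq_sym -subr_eq0 => /eqP <-; ring.
  have [b0 _] := two_heights; have := H b0; rewrite p0 q0 mul0r addr0 => /eqP.
  by rewrite expf_eq0 (negPf s0) andbF.
have [r3|r3] := eqVneq r (n ^ 2)%:R.
  have [|/pq0 p0 _ _] := key A B (D - 1).
    by move=> x; have := E x; rewrite r3 rn => /eqP; rewrite eq_sym -subr_eq0 => /eqP <-; ring.
  apply: (const_heights (t := s / n%:R) (u := q)).
  - by rewrite mulf_neq0 // invr_neq0.
  - by apply: contraNneq sn => E'; rewrite -(mulfVK n0 s) E' mul1r.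
  - by move=> b; rewrite expr_div_n H p0 add0r mulfK // expf_neq0.
have H0 : forall P, P \in [:: (r, 1 : {poly C}); (1, (- A)%:P); (n%:R, (- B)%:P);
    ((n ^ 2)%:R, (- D)%:P)] -> P.2 = 0.
  apply: expo_heights.
  - by rewrite /= !inE !negb_or r1 r2 r3 n1 n3 n4.
  - by move=> P; rewrite !inE => /or4P[] /eqP -> /=; rewrite ?ltr01 ?pos.
  - move=> x; rewrite !big_cons big_nil /= !hornerC !rn E expr1n; ring.
  - rewrite !big_cons big_nil /= addn0 size_poly1.
    by apply: leq_trans (leq_add (leqnn 1%N) (leq_add (sc _) (leq_add (sc _) (sc _)))) _.
have /= /eqP := H0 (r, 1) (mem_head _ _).
by rewrite oner_eq0.
Qed.

(** The relation is impossible for all integers t >= 2, which are Zariski dense; by elimination of s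
    it is possible for finitely many t only. *)
Lemma trinomial_exceptional : exists2 rho : {poly C}, rho != 0 &
  forall t s p q, s != 0 -> s != 1 -> s != t ->
    (forall b, s ^+ h b = p + q * t ^+ h b) -> rho.[t] = 0.
Proof.
have [b0 [b1 h01]] := two_heights.
pose tX n : {poly {poly C}} := ('X^n)%:P.
(* This determinant eliminates p and q: the increments of s^h are proportional to those of t^h. The
   factors of [w] stand for the excluded values s = 0, 1, t. *)
pose e b := (tX (h b1) - tX (h b0)) * ('X^(h b) - 'X^(h b0))
          - ('X^(h b1) - 'X^(h b0)) * (tX (h b) - tX (h b0)).
pose w : {poly {poly C}} := 'X * ('X - 1) * ('X - 'X%:P).
have evB p q t s : ev2 (p - q) t s = ev2 p t s - ev2 q t s.
  by rewrite /ev2 !hornerD !hornerN.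
have evX n t s : ev2 'X^n t s = s ^+ n by rewrite /ev2 hornerXn -polyC_exp hornerC.
have evt n t s : ev2 (tX n) t s = t ^+ n by rewrite /ev2 hornerC hornerXn.
have eE b t s : ev2 (e b) t s = (t ^+ h b1 - t ^+ h b0) * (s ^+ h b - s ^+ h b0)
    - (s ^+ h b1 - s ^+ h b0) * (t ^+ h b - t ^+ h b0).
  by rewrite /e evB !ev2M !evB !evX !evt.
have wE t s : ev2 w t s = s * (s - 1) * (s - t).
  by rewrite /w !ev2M !evB /ev2 !hornerX !hornerC hornerX.
have [|rho rho0 Hrho] := @elim_family C [seq e b | b <- enum T] w.
  move=> rho rho0; have [n] := poly_nonroot (mulf_neq0 rho0 (mulf_neq0
    (negbT (polyX_eq0 C)) (negbT (polyXsubC_eq0 (1 : C))))).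
  rewrite !hornerM hornerX hornerD hornerN hornerX hornerC !mulf_eq0 !negb_or.
  move=> /and3P[nr n0 n1]; exists n%:R; split=> // s Hs; rewrite wE; apply/eqP/negPn/negP.
  rewrite !mulf_eq0 !negb_or !subr_eq0 => /andP[/andP[s0 s1] sn].
  have n2 : (2 <= n)%N.
    by case: (n) n0 n1 => [|[|m]] //; rewrite ?eqxx // subrr eqxx.
  have dn : (n%:R ^+ h b1 - n%:R ^+ h b0 : C) != 0.
    by rewrite subr_eq0 -!natrX eqr_nat eqn_exp2l // eq_sym.
  pose q := (s ^+ h b1 - s ^+ h b0) / (n%:R ^+ h b1 - n%:R ^+ h b0).
  apply: (@trinomial_real n s (s ^+ h b0 - q * n%:R ^+ h b0) q n2 s0 s1 sn) => b.
  have /eqP := Hs (e b) (map_f _ (mem_enum _ b)).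
  rewrite eE subr_eq0 => /eqP E.
  have : s ^+ h b - s ^+ h b0 = q * (n%:R ^+ h b - n%:R ^+ h b0).
    by apply: (mulfI dn); rewrite E /q; field.
  by move=> /eqP; rewrite subr_eq => /eqP ->; ring.
exists rho => // t s p q s0 s1 st H; apply: (Hrho t s).
  move=> _ /mapP[b _ ->]; rewrite eE !H; ring.
by rewrite wE !mulf_neq0 // subr_eq0.
Qed.

End Heights.

(** * Moments of a Laurent polynomial *)

Section GenericIndependence.
Variables (F : numClosedFieldType) (J T : finType) (k : nat).
Variable Phi : 'I_k -> T -> (J -> F) -> F.
Hypothesis pPhi : forall i t, polyfun (Phi i t).

Lemma minor_independent (b : 'I_k -> T) w : cminor Phi b w != 0 -> independent_at Phi w.
Proof.
move=> nz u Hu i.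
have uA : (\row_i u i) *m cmat Phi b w = 0.
  by apply/rowP => j; rewrite !mxE -[RHS](Hu (b j)); apply: eq_bigr => l _; rewrite !mxE.
have cu : cmat Phi b w \in unitmx by rewrite unitmxE unitfE.
have /rowP/(_ i) : \row_i u i = 0 by rewrite -(mulmxK cu (\row_i u i)) uA mul0mx.
by rewrite !mxE.
Qed.

Lemma generic_independence w0 : independent_at Phi w0 ->
  exists Delta, pnz Delta /\ forall w, Delta w != 0 -> independent_at Phi w.
Proof.
move=> /independent_minor[b nb]; exists (cminor Phi b); split.
  split; last by exists w0.
  exact: polyfun_cminor.
by move=> w; exact: minor_independent.
Qed.

End GenericIndependence.

Lemma poly_finite_roots (F : numClosedFieldType) (P : {poly F}) : P != 0 ->
  exists rs : seq F, forall t, P.[t] = 0 -> t \in rs.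
Proof.
move=> P0; have [rs PE] := closed_field_poly_normal P; exists rs => t /eqP.
by rewrite -/(root P t) PE rootZ ?lead_coef_eq0 // root_prod_XsubC.
Qed.

Lemma line_finite_zeros (F : numClosedFieldType) (f : ('I_1 -> F) -> F) : pnz f ->
  exists rs : seq F, forall t, f (fun=> t) = 0 -> t \in rs.
Proof.
move=> [pf [p0 fp0]]; have [P HP] := polyfun_line (fun=> 0) (fun=> 1) pf.
have fE t : f (fun=> t) = P.[t].
  by rewrite -HP; congr f; apply/funext => i; rewrite add0r mulr1.
have [|rs Hrs] := @poly_finite_roots F P; last by exists rs => t; rewrite fE => /Hrs.
apply: contraNneq fp0 => P0; have : f (fun=> p0 ord0) = 0 by rewrite fE P0 horner0.
have e : (fun=> p0 ord0) = p0 by apply/funext => i; rewrite (ord1 i).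
by rewrite e => ->.
Qed.

Section Families.
Variables (F : numClosedFieldType) (T : finType) (h e1 e2 : T -> nat).

Definition lindep_free k (g : nat -> T -> F) :=
  forall u : 'I_k -> F, (forall b, \sum_(i < k) u i * g i b = 0) -> forall i, u i = 0.

Lemma lindep_extend k (g : nat -> T -> F) : lindep_free k g -> ~ lindep_free k.+1 g ->
  exists a : 'I_k -> F, forall b, g k b = \sum_(i < k) a i * g i b.
Proof.
move=> fk nfk; apply: contrapT => nex; apply: nfk => u Hu.
have uk : u ord_max = 0.
  apply: contrapT => /eqP uk; apply: nex.
  exists (fun i => - (u ord_max)^-1 * u (widen_ord (leqnSn k) i)) => b.
  have := Hu b; rewrite big_ord_recr /= => /eqP; rewrite addr_eq0 => /eqP E.
  apply: (mulfI uk); rewrite -[LHS]opprK -E big_distrr /= -sumrN.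
  by apply: eq_bigr => i _; field.
have u0 (i : 'I_k) : u (widen_ord (leqnSn k) i) = 0.
  apply: (fk (fun i => u (widen_ord (leqnSn k) i))) => b.
  by have := Hu b; rewrite big_ord_recr /= uk mul0r addr0.
move=> i; case: (unliftP ord_max i) => [j ->|-> //].
by have <- : widen_ord (leqnSn k) j = lift ord_max j by apply/val_inj; rewrite /= /bump leqNgt ltn_ord.
Qed.

(** A coordinate of a point as a function of the parameters: a constant times a variable, or a
    constant. This covers at once independent roots z_j and roots tau_j z with prescribed ratios. *)
Definition atom (J : Type) := (F * option J)%type.
Definition aval (J : Type) (a : atom J) (w : J -> F) :=
  a.1 * (if a.2 is Some j then w j else 1).
Definition aweight (J : Type) (a : atom J) (om : J -> F) :=
  if a.2 is Some j then om j else 0.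

(** For f a polynomial in the exponents, this is the value at (x, y, z) of a polynomial in the Euler
    operators x d/dx, y d/dy, z d/dz applied to the Laurent polynomial shifted to nonnegative
    exponents. *)
Definition Smoment (c : T -> F) (x y z : F) (f : T -> F) :=
  \sum_b (f b * x ^+ e1 b * y ^+ e2 b * z ^+ h b) * c b.

Lemma SmomentD c x y z f g :
  Smoment c x y z (fun b => f b + g b) = Smoment c x y z f + Smoment c x y z g.
Proof. by rewrite /Smoment -big_split; apply: eq_bigr => b _ /=; ring. Qed.

Lemma SmomentZ c x y z a f :
  Smoment c x y z (fun b => a * f b) = a * Smoment c x y z f.
Proof. by rewrite /Smoment big_distrr; apply: eq_bigr => b _ /=; ring. Qed.

Section Fam.
Variables (J : finType) (k : nat) (ax ay : atom J) (az : nat -> atom J) (f : nat -> T -> F).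

Definition fam (i : 'I_k) b (w : J -> F) :=
  f i b * aval ax w ^+ e1 b * aval ay w ^+ e2 b * aval (az i) w ^+ h b.

Lemma polyfun_aval (a : atom J) : polyfun (aval a).
Proof.
apply: polyfunM; first exact: polyfun_cst.
by case: a.2 => [j|]; [exact: polyfun_var|exact: polyfun_cst].
Qed.

Lemma polyfun_fam i b : polyfun (fam i b).
Proof.
apply: polyfunM; last exact/polyfunX/polyfun_aval.
apply: polyfunM; last exact/polyfunX/polyfun_aval.
apply: polyfunM; last exact/polyfunX/polyfun_aval.
exact: polyfun_cst.
Qed.

Lemma constrained_fam w c : constrained fam w c <->
  forall i : 'I_k, Smoment c (aval ax w) (aval ay w) (aval (az i) w) (f i) = 0.
Proof. by split. Qed.

Lemma independent_fam w : aval ax w != 0 -> aval ay w != 0 ->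
  lindep_free k (fun i b => f i b * aval (az i) w ^+ h b) -> independent_at fam w.
Proof.
move=> x0 y0 fr u Hu; apply: fr => b.
have m0 : aval ax w ^+ e1 b * aval ay w ^+ e2 b != 0 by rewrite mulf_neq0 // expf_neq0.
apply: (mulfI m0); rewrite mulr0 -[RHS](Hu b) big_distrr /=.
by apply: eq_bigr => i _; rewrite /fam; ring.
Qed.

Lemma independent_fam_free w : aval ax w != 0 -> aval ay w != 0 ->
  independent_at fam w -> lindep_free k (fun i b => f i b * aval (az i) w ^+ h b).
Proof.
move=> x0 y0 ind u Hu; apply: ind => b.
transitivity ((aval ax w ^+ e1 b * aval ay w ^+ e2 b) *
    \sum_(i < k) u i * (f i b * aval (az i) w ^+ h b)); last by rewrite Hu mulr0.
by rewrite big_distrr; apply: eq_bigr => i _ /=; rewrite /fam; ring.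
Qed.

(** Directions of the form om w are logarithmic: differentiation multiplies each monomial by a
    weight, so the derivatives of moments are moments again. *)
Lemma dirderiv_aval (a : atom J) w om : dirderiv (aval a) w (fun j => om j * w j)
  (aweight a om * aval a w).
Proof.
case: a => t [j|]; rewrite /aval /aweight /=.
  have := dirderivM (dirderiv_cst w (fun j => om j * w j) t) (dirderiv_var w (fun j => om j * w j) j).
  by congr dirderiv; ring.
have := dirderiv_cst w (fun j => om j * w j) (t * 1).
by congr dirderiv; ring.
Qed.

Lemma dirderiv_avalX (a : atom J) w om m : dirderiv (fun w => aval a w ^+ m) w
  (fun j => om j * w j) (m%:R * aweight a om * aval a w ^+ m).
Proof.
have := dirderivX m (dirderiv_aval a w om); congr dirderiv.
by case: m => [|m]; rewrite ?exprS /=; ring.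
Qed.

Lemma dirderiv_fam i b w om : dirderiv (fam i b) w (fun j => om j * w j)
  (((e1 b)%:R * aweight ax om + (e2 b)%:R * aweight ay om + (h b)%:R * aweight (az i) om) * fam i b w).
Proof.
have := dirderivM (dirderivM (dirderivM (dirderiv_cst w (fun j => om j * w j) (f i b))
  (dirderiv_avalX ax w om (e1 b))) (dirderiv_avalX ay w om (e2 b)))
  (dirderiv_avalX (az i) w om (h b)).
by congr dirderiv; rewrite /fam; ring.
Qed.

Lemma thin_fam_lt : (#|J| < k)%N -> thin [set c | exists w,
  [/\ aval ax w != 0, aval ay w != 0,
      lindep_free k (fun i b => f i b * aval (az i) w ^+ h b) &
      forall i : 'I_k, Smoment c (aval ax w) (aval ay w) (aval (az i) w) (f i) = 0]].
Proof.
move=> Jk; apply: thinS (thin_rank_lt polyfun_fam Jk) => c [w [x0 y0 fr cw]].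
by exists w; split; [exact: independent_fam|exact/constrained_fam].
Qed.

Lemma thin_fam_hyp Delta : (#|J| <= k)%N -> pnz Delta -> thin [set c | exists w,
  [/\ aval ax w != 0 /\ aval ay w != 0,
      lindep_free k (fun i b => f i b * aval (az i) w ^+ h b), Delta w = 0 &
      forall i : 'I_k, Smoment c (aval ax w) (aval ay w) (aval (az i) w) (f i) = 0]].
Proof.
move=> Jk nD; apply: thinS (thin_rank_hyp polyfun_fam Jk nD) => c [w [[x0 y0] fr Dw cw]].
by exists w; split=> //; exact: independent_fam.
Qed.

Lemma thin_fam_crit : (#|J| <= k)%N -> thin [set c | exists w,
  [/\ aval ax w != 0 /\ aval ay w != 0,
      lindep_free k (fun i b => f i b * aval (az i) w ^+ h b),
      forall i : 'I_k, Smoment c (aval ax w) (aval ay w) (aval (az i) w) (f i) = 0 &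
      exists om, (exists j, om j * w j != 0) /\ forall i : 'I_k,
        Smoment c (aval ax w) (aval ay w) (aval (az i) w)
          (fun b => ((e1 b)%:R * aweight ax om + (e2 b)%:R * aweight ay om
                     + (h b)%:R * aweight (az i) om) * f i b) = 0]].
Proof.
move=> Jk; apply: thinS (thin_rank_crit polyfun_fam Jk) => c [w [[x0 y0] fr cw [om [nom Hom]]]].
exists w; split; [exact: independent_fam|exact/constrained_fam|].
exists (fun j => om j * w j); split=> //.
exists (fun (i : 'I_k) b => ((e1 b)%:R * aweight ax om + (e2 b)%:R * aweight ay om
                     + (h b)%:R * aweight (az i) om) * fam i b w); split.
  by move=> i b; exact: dirderiv_fam.
move=> i; rewrite -[RHS](Hom i); apply: eq_bigr => b _; rewrite /fam; ring.
Qed.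

Lemma generic_fam w0 : aval ax w0 != 0 -> aval ay w0 != 0 ->
  lindep_free k (fun i b => f i b * aval (az i) w0 ^+ h b) ->
  exists Delta, pnz Delta /\ forall w, aval ax w != 0 -> aval ay w != 0 -> Delta w != 0 ->
    lindep_free k (fun i b => f i b * aval (az i) w ^+ h b).
Proof.
move=> x0 y0 fr.
have [D [nD HD]] := generic_independence polyfun_fam (independent_fam x0 y0 fr).
exists D; split=> // w x y Dw; exact: independent_fam_free (HD w Dw).
Qed.

End Fam.

End Families.

(** * Conditions at several roots, with free roots or fixed ratios *)

Section Moments.
Variables (F : numClosedFieldType) (T : finType) (h e1 e2 : T -> nat).

Definition hpow (n : nat) (b : T) : F := (h b)%:R ^+ n.
Local Notation S := (Smoment h e1 e2).

(* A pair (e, j) in L stands for the functional h ^ e * z_j ^ h. *)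
Definition lnth (L : seq (nat * nat)) i := nth (0%N, 0%N) L i.

Definition lfree (L : seq (nat * nat)) (z : nat -> F) :=
  lindep_free (size L) (fun i b => hpow (lnth L i).1 b * z (lnth L i).2 ^+ h b).

Definition lsat (c : T -> F) (x y : F) (z : nat -> F) (L : seq (nat * nat)) :=
  forall p, p \in L -> S c x y (z p.2) (hpow p.1) = 0.

(** The logarithmic velocities of x, y and the roots z_j. Requiring that x or y moves makes the
    direction nonzero wherever x and y are nonzero. *)
Definition lcrit (c : T -> F) (x y : F) (z : nat -> F) (L : seq (nat * nat)) :=
  exists ox oy (oz : nat -> F), (ox != 0) || (oy != 0) /\ forall p, p \in L ->
    S c x y (z p.2) (fun b => ((e1 b)%:R * ox + (e2 b)%:R * oy + (h b)%:R * oz p.2)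
                               * hpow p.1 b) = 0.

Lemma lindep_freeP k (g : nat -> T -> F) : lindep_free k g <->
  forall v : nat -> F, (forall b, \sum_(i < k) v i * g i b = 0) ->
    forall i, (i < k)%N -> v i = 0.
Proof.
split=> [fr v Hv i ik|H u Hu i].
  exact: (fr (fun i => v i) Hv (Ordinal ik)).
pose v (i : nat) := if insub i is Some j then u j else 0.
have vE (j : 'I_k) : v j = u j by rewrite /v valK.
rewrite -vE; apply: H => // b; rewrite -[RHS](Hu b).
by apply: eq_bigr => j _; rewrite vE.
Qed.

Lemma lindep_free_ext k (g g' : nat -> T -> F) :
  (forall i b, (i < k)%N -> g i b = g' i b) -> lindep_free k g -> lindep_free k g'.
Proof.
move=> gg' fr u Hu; apply: fr => b; rewrite -[RHS](Hu b).
by apply: eq_bigr => i _; rewrite gg'.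
Qed.

Lemma lfree_scale L z l : l != 0 -> lfree L z <-> lfree L (fun j => z j * l).
Proof.
move=> l0; split=> fr u Hu; apply: fr => b.
  have lb : l ^+ h b != 0 by rewrite expf_neq0.
  apply: (mulfI lb); rewrite mulr0 -[RHS](Hu b) big_distrr /=.
  by apply: eq_bigr => i _; rewrite exprMn; ring.
transitivity (l ^+ h b * \sum_(i < size L) u i * (hpow (lnth L i).1 b * z (lnth L i).2 ^+ h b)).
  by rewrite big_distrr /=; apply: eq_bigr => i _; rewrite exprMn; ring.
by rewrite Hu mulr0.
Qed.

Lemma lfree_ext L z z' : (forall p, p \in L -> z p.2 = z' p.2) -> lfree L z -> lfree L z'.
Proof.
by move=> zz; apply: lindep_free_ext => i b iL; rewrite zz // mem_nth.
Qed.

Section Points.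
Variable m : nat.
Variable L : seq (nat * nat).
Hypothesis Lm : forall p, p \in L -> (p.2 < m)%N.

Let J := 'I_m.+2.
Let ax : atom F J := (1, Some (@Ordinal m.+2 0 isT)).
Let ay : atom F J := (1, Some (@Ordinal m.+2 1 isT)).
Let az (j : nat) : atom F J := (1, Some (inord j.+2)).
Let azL i := az (lnth L i).2.
Let fL i := hpow (lnth L i).1.
Let w_of (x y : F) (z : nat -> F) (j : J) : F :=
  match val j with 0 => x | 1 => y | j'.+2 => z j' end.

Let axE x y z : aval ax (w_of x y z) = x.
Proof. exact: mul1r. Qed.
Let ayE x y z : aval ay (w_of x y z) = y.
Proof. exact: mul1r. Qed.
Let azE x y z p : p \in L -> aval (az p.2) (w_of x y z) = z p.2.
Proof. by move=> /Lm pm; rewrite /aval /= mul1r /w_of /= inordK. Qed.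

Let freeE x y z : lfree L z <->
  lindep_free (size L) (fun i b => fL i b * aval (azL i) (w_of x y z) ^+ h b).
Proof.
by split; apply: lindep_free_ext => i b iL; rewrite /azL azE // mem_nth.
Qed.

Let satE x y z c : lsat c x y z L -> forall i : 'I_(size L),
  S c (aval ax (w_of x y z)) (aval ay (w_of x y z)) (aval (azL i) (w_of x y z)) (fL i) = 0.
Proof.
move=> sat i; have iL : lnth L i \in L by rewrite mem_nth.
by rewrite axE ayE /azL azE // sat.
Qed.

Lemma thin_points_lt : (m.+2 < size L)%N ->
  thin [set c | exists x y z, [/\ x != 0, y != 0, lfree L z & lsat c x y z L]].
Proof.
move=> mL; have := @thin_fam_lt F T h e1 e2 J (size L) ax ay azL fL.
rewrite card_ord => /(_ mL); apply: thinS => c [x [y [z [x0 y0 fr sat]]]].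
exists (w_of x y z); rewrite axE ayE; split=> //; first exact/freeE.
by move=> i; have := satE sat i; rewrite axE ayE.
Qed.

(** One independent condition may be missing, since the dependence of [L'] supplies an equation:
    independence at [z0] gives a nonzero minor, which vanishes wherever [L'] is dependent. *)
Lemma thin_points_hyp L' z0 : (m.+2 <= size L)%N -> (forall p, p \in L' -> (p.2 < m)%N) ->
  lfree L' z0 ->
  thin [set c | exists x y z, [/\ x != 0 /\ y != 0, lfree L z, ~ lfree L' z & lsat c x y z L]].
Proof.
move=> mL Lm' fr0.
have azE' x y z p : p \in L' -> aval (az p.2) (w_of x y z) = z p.2.
  by move=> /Lm' pm; rewrite /aval /= mul1r /w_of /= inordK.
have freeE' x y z : lfree L' z <-> lindep_free (size L')
    (fun i b => hpow (lnth L' i).1 b * aval (az (lnth L' i).2) (w_of x y z) ^+ h b).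
  by split; apply: lindep_free_ext => i b iL; rewrite azE' // mem_nth.
have [|||D [nD HD]] := @generic_fam F T h e1 e2 J (size L') ax ay
    (fun i => az (lnth L' i).2) (fun i => hpow (lnth L' i).1) (w_of 1 1 z0).
- by rewrite axE oner_neq0.
- by rewrite ayE oner_neq0.
- by apply/freeE'.
have := @thin_fam_hyp F T h e1 e2 J (size L) ax ay azL fL D.
rewrite card_ord => /(_ mL nD); apply: thinS => c [x [y [z [[x0 y0] fr nfr sat]]]].
exists (w_of x y z); rewrite axE ayE; split=> //; first exact/freeE.
  apply: contrapT => /eqP Dw; apply: nfr; apply/(freeE' x y).
  by apply: HD; rewrite // ?axE ?ayE.
by move=> i; have := satE sat i; rewrite axE ayE.
Qed.

Lemma thin_points_crit : (m.+2 <= size L)%N ->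
  thin [set c | exists x y z,
    [/\ x != 0 /\ y != 0, lfree L z, lsat c x y z L & lcrit c x y z L]].
Proof.
move=> mL; have := @thin_fam_crit F T h e1 e2 J (size L) ax ay azL fL.
rewrite card_ord => /(_ mL); apply: thinS => c [x [y [z [[x0 y0] fr sat]]]].
move=> [ox [oy [oz [nz H]]]].
exists (w_of x y z); rewrite axE ayE; split=> //; first exact/freeE.
  by move=> i; have := satE sat i; rewrite axE ayE.
exists (w_of ox oy oz); split.
  case/orP: nz => nz; [exists (@Ordinal m.+2 0 isT)|exists (@Ordinal m.+2 1 isT)];
  by rewrite mulf_neq0.
move=> i; have iL : lnth L i \in L by rewrite mem_nth.
rewrite /azL azE // -[RHS](H _ iL); congr Smoment; apply/funext => b.
by rewrite /aweight /w_of /= inordK // ltnS ltnS Lm.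
Qed.

End Points.

Section Ratio.
Variable (tau : nat -> F) (L : seq (nat * nat)).

Let J := 'I_3.
Let ax : atom F J := (1, Some (@Ordinal 3 0 isT)).
Let ay : atom F J := (1, Some (@Ordinal 3 1 isT)).
Let az (j : nat) : atom F J := (tau j, Some (@Ordinal 3 2 isT)).
Let azL i := az (lnth L i).2.
Let fL i := hpow (lnth L i).1.
Let w_of (x y z : F) (j : J) : F :=
  match val j with 0 => x | 1 => y | _ => z end.

Let axE x y z : aval ax (w_of x y z) = x.
Proof. exact: mul1r. Qed.
Let ayE x y z : aval ay (w_of x y z) = y.
Proof. exact: mul1r. Qed.

Let freeE x y z : z != 0 -> lfree L tau <->
  lindep_free (size L) (fun i b => fL i b * aval (azL i) (w_of x y z) ^+ h b).
Proof. by move=> z0; rewrite (lfree_scale L tau z0). Qed.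

(** With the ratios fixed, the only parameters are x, y and the common factor z. *)
Lemma thin_ratio_lt : (3 < size L)%N ->
  thin [set c | exists x y z, [/\ [/\ x != 0, y != 0 & z != 0],
    lfree L tau & lsat c x y (fun j => tau j * z) L]].
Proof.
move=> mL; have := @thin_fam_lt F T h e1 e2 J (size L) ax ay azL fL.
rewrite card_ord => /(_ mL); apply: thinS => c [x [y [z [[x0 y0 z0] fr sat]]]].
exists (w_of x y z); rewrite axE ayE; split=> //; first exact/freeE.
by move=> i; apply: sat; rewrite mem_nth.
Qed.

Lemma thin_ratio_crit : (3 <= size L)%N ->
  thin [set c | exists x y z, [/\ [/\ x != 0, y != 0 & z != 0], lfree L tau,
    lsat c x y (fun j => tau j * z) L &
    exists ox oy oz, (ox != 0) || (oy != 0) /\ forall p, p \in L ->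
      S c x y (tau p.2 * z) (fun b => ((e1 b)%:R * ox + (e2 b)%:R * oy + (h b)%:R * oz)
                               * hpow p.1 b) = 0]].
Proof.
move=> mL; have := @thin_fam_crit F T h e1 e2 J (size L) ax ay azL fL.
rewrite card_ord => /(_ mL); apply: thinS => c [x [y [z [[x0 y0 z0] fr sat]]]].
move=> [ox [oy [oz [nz H]]]].
exists (w_of x y z); rewrite axE ayE; split=> //; first exact/freeE.
  by move=> i; apply: sat; rewrite mem_nth.
exists (w_of ox oy oz); split.
  case/orP: nz => nz; [exists (@Ordinal 3 0 isT)|exists (@Ordinal 3 1 isT)];
  by rewrite mulf_neq0.
by move=> i; apply: H; rewrite mem_nth.
Qed.

End Ratio.

End Moments.

(** * Codimension of the degenerate fibers *)

Lemma forall_cons (X : eqType) (P : X -> Prop) x s :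
  P x -> (forall y, y \in s -> P y) -> forall y, y \in x :: s -> P y.
Proof. by move=> Px Ps y; rewrite in_cons => /orP[/eqP ->|/Ps]. Qed.

Lemma kernel2 (F : fieldType) (a b c d : F) : a * d - b * c = 0 ->
  exists u v, (u != 0) || (v != 0) /\ a * u + b * v = 0 /\ c * u + d * v = 0.
Proof.
move=> /eqP; rewrite subr_eq0 => /eqP E.
have [a0|a0] := eqVneq a 0; have [b0|b0] := eqVneq b 0.
- have [c0|c0] := eqVneq c 0.
    by exists 1, 0; rewrite oner_neq0 a0 c0 b0 !mulr0 !mul0r addr0.
  exists (- d), c; rewrite c0 orbT a0 b0; split=> //.
  by rewrite !mul0r addr0; split=> //; ring.
- exists b, (- a); rewrite b0; split=> //; split; first by ring.
  by rewrite mulrC -E; ring.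
- exists b, (- a); rewrite oppr_eq0 a0 orbT; split=> //; split; first by ring.
  by rewrite mulrC -E; ring.
- exists b, (- a); rewrite b0; split=> //; split; first by ring.
  by rewrite mulrC -E; ring.
Qed.

Ltac list_cases := lazymatch goal with
  | |- forall p, is_true (p \in [::]) -> _ => by []
  | |- _ => apply: forall_cons; [ | list_cases] end.

Section Genericity.
Variable R : realType.
Local Notation C := R[i].
Variables (T : finType) (h e1 e2 : T -> nat) (hs : seq nat).
Hypothesis hs_uniq : uniq hs.
Hypothesis hs6 : (6 <= size hs)%N.
Hypothesis hsP : forall n, n \in hs -> exists b, h b = n.
Hypothesis hAP : forall (t u : C) (h0 : nat), t != 0 -> t != 1 ->
  ~ forall b, h b != h0 -> t ^+ h b = u.

Local Notation S := (Smoment h e1 e2).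
Local Notation hp := (@hpow C T h).
Local Notation free := (@lfree C T h).
Local Notation sat := (@lsat C T h e1 e2).
Let poly0 := @poly_heights R _ _ _ hs_uniq hs6 hsP.
Let expo0 := @expo_heights R _ _ _ hs_uniq hs6 hsP.
Let affine0 := @affine_heights R _ _ _ hs_uniq hs6 hsP hAP.

Definition p2 (t : C) (j : nat) : C := nth 0 [:: 1; t] j.
Definition p3 (t s : C) (j : nat) : C := nth 0 [:: 1; t; s] j.

(** [L3], [L4], [L5] and [L6] are the conditions for a triple root, two double roots, a triple and a
    double root, and three double roots. [L3'] is a part of [L4] that stays independent at every
    ratio; [W6] serves to compare two expressions of h s^h in [rank4_exceptional]. *)
Definition L3 := [:: (0, 0); (1, 0); (2, 0)]%N.
Definition L3' := [:: (0, 0); (1, 0); (0, 1)]%N.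
Definition L4 := [:: (0, 0); (1, 0); (0, 1); (1, 1)]%N.
Definition L5 := [:: (0, 0); (1, 0); (2, 0); (0, 1); (1, 1)]%N.
Definition L6 := [:: (0, 0); (1, 0); (0, 1); (1, 1); (0, 2); (1, 2)]%N.
Definition W6 := [:: (0, 0); (1, 0); (2, 0); (0, 1); (1, 1); (2, 1)]%N.

Lemma S_crit c x y z ox oy oz k :
  S c x y z (fun b => ((e1 b)%:R * ox + (e2 b)%:R * oy + (h b)%:R * oz) * hp k b) =
  ox * S c x y z (fun b => (e1 b)%:R * hp k b) +
  oy * S c x y z (fun b => (e2 b)%:R * hp k b) + oz * S c x y z (hp k.+1).
Proof.
rewrite -!SmomentZ -!SmomentD; apply: eq_bigr => b _; rewrite /hpow exprS; ring.
Qed.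

Lemma S_e c x y z (e : T -> nat) :
  S c x y z (fun b => (e b)%:R * hp 0 b) = S c x y z (fun b => (e b)%:R).
Proof. by apply: eq_bigr => b _; rewrite /hpow expr0 mulr1. Qed.

Lemma lfree_rcons L z p : free L z -> ~ free (rcons L p) z ->
  exists a : nat -> C, forall b, hp p.1 b * z p.2 ^+ h b =
    \sum_(i < size L) a i * (hp (lnth L i).1 b * z (lnth L i).2 ^+ h b).
Proof.
pose g i b := hp (lnth (rcons L p) i).1 b * z (lnth (rcons L p) i).2 ^+ h b.
have gE i b : (i < size L)%N ->
    g i b = hp (lnth L i).1 b * z (lnth L i).2 ^+ h b.
  by move=> iL; rewrite /g /lnth nth_rcons iL.
rewrite /lfree size_rcons => fr nfr.
have [|a Ha] := lindep_extend _ nfr.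
  by apply: lindep_free_ext fr => i b iL; rewrite -gE.
exists (fun i => if insub i is Some j then a j else 0) => b.
transitivity (g (size L) b); first by rewrite /g /lnth nth_rcons ltnn eqxx.
rewrite {1}/g Ha; apply: eq_bigr => i _; rewrite valK; congr (_ * _).
exact: gE.
Qed.

Lemma lfree_norm L z : z 0%N != 0 -> (forall p, p \in L -> (p.2 < 2)%N) ->
  free L z <-> free L (p2 (z 1%N / z 0%N)).
Proof.
move=> z0 L2; rewrite (lfree_scale h L (p2 _) z0).
split; apply: lfree_ext => p /L2; case: p.2 => [|[|j]] //= _;
by rewrite /p2 /= ?mul1r ?mulfVK.
Qed.

Lemma lfree_L3 z : z 0%N != 0 -> free L3 z.
Proof.
move=> z0; apply/lindep_freeP => v Hv.
have P0 : Poly [:: v 0%N; v 1%N; v 2%N] = 0.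
  apply: poly0; first exact: leq_trans (size_Poly _) _.
  move=> b; have zb : z 0%N ^+ h b != 0 by rewrite expf_neq0.
  apply: (mulfI zb); rewrite mulr0 -[RHS](Hv b) horner_Poly.
  by rewrite !big_ord_recl big_ord0 /= /bump /= /hpow; ring.
by move=> [|[|[|i]]] // _; have /polyP := P0;
  [move=> /(_ 0%N)|move=> /(_ 1%N)|move=> /(_ 2%N)]; rewrite coef_Poly coef0.
Qed.

Definition P4 := [:: (0, 0); (1, 0); (2, 0); (3, 0)]%N.

Lemma lfree_P4 z : z 0%N != 0 -> free P4 z.
Proof.
move=> z0; apply/lindep_freeP => v Hv.
have P0 : Poly [:: v 0%N; v 1%N; v 2%N; v 3%N] = 0.
  apply: poly0; first exact: leq_trans (size_Poly _) _.
  move=> b; have zb : z 0%N ^+ h b != 0 by rewrite expf_neq0.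
  apply: (mulfI zb); rewrite mulr0 -[RHS](Hv b) horner_Poly.
  by rewrite !big_ord_recl big_ord0 /= /bump /= /hpow; ring.
by move=> [|[|[|[|i]]]] // _; have /polyP := P0;
  [move=> /(_ 0%N)|move=> /(_ 1%N)|move=> /(_ 2%N)|move=> /(_ 3%N)]; rewrite coef_Poly coef0.
Qed.

(** The bases 1, 2, 3 are positive reals, so Rolle's bound applies directly; this provides for each
    system a point at which it is independent. *)
Lemma expo3_heights (P0 P1 P2 : {poly C}) : (size P0 + (size P1 + size P2) <= 6)%N ->
  (forall b, P0.[(h b)%:R] + P1.[(h b)%:R] * 2%:R ^+ h b + P2.[(h b)%:R] * 3%:R ^+ h b = 0) ->
  [/\ P0 = 0, P1 = 0 & P2 = 0].
Proof.
move=> sz H.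
have E : forall p, p \in [:: (1 : R, P0); (2%:R, P1); (3%:R, P2)] -> p.2 = 0.
  apply: expo0.
  - by rewrite /= !inE negb_or -[1 : R]/(1%:R) !eqr_nat.
  - by move=> p; rewrite !inE => /or3P[] /eqP -> /=; rewrite ?ltr01 ?ltr0n.
  - by move=> b; rewrite !big_cons big_nil /= !rmorph_nat rmorph1 expr1n mulr1 addr0 addrA.
  - by rewrite !big_cons big_nil /= addn0.
split; [apply: (E (1, P0))|apply: (E (2%:R, P1))|apply: (E (3%:R, P2))];
by rewrite !inE eqxx ?orbT.
Qed.

Lemma lfree_L4_2 : free L4 (p2 2%:R).
Proof.
apply/lindep_freeP => v Hv.
have [||/polyP H0 /polyP H1 _] := @expo3_heights (Poly [:: v 0%N; v 1%N]) (Poly [:: v 2%N; v 3%N]) 0.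
- rewrite size_poly0 addn0.
  by apply: leq_trans (leq_add (size_Poly _) (size_Poly _)) _.
- move=> b; rewrite -[RHS](Hv b) !horner_Poly horner0.
  by rewrite !big_ord_recl big_ord0 /= /bump /= /hpow /p2 /= expr1n; ring.
move=> [|[|[|[|i]]]] // _.
- by have := H0 0%N; rewrite coef_Poly coef0.
- by have := H0 1%N; rewrite coef_Poly coef0.
- by have := H1 0%N; rewrite coef_Poly coef0.
- by have := H1 1%N; rewrite coef_Poly coef0.
Qed.

Lemma lfree_L5_2 : free L5 (p2 2%:R).
Proof.
apply/lindep_freeP => v Hv.
have [||/polyP H0 /polyP H1 _] := @expo3_heights (Poly [:: v 0%N; v 1%N; v 2%N])
  (Poly [:: v 3%N; v 4%N]) 0.
- rewrite size_poly0 addn0.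
  by apply: leq_trans (leq_add (size_Poly _) (size_Poly _)) _.
- move=> b; rewrite -[RHS](Hv b) !horner_Poly horner0.
  by rewrite !big_ord_recl big_ord0 /= /bump /= /hpow /p2 /= expr1n; ring.
move=> [|[|[|[|[|i]]]]] // _.
- by have := H0 0%N; rewrite coef_Poly coef0.
- by have := H0 1%N; rewrite coef_Poly coef0.
- by have := H0 2%N; rewrite coef_Poly coef0.
- by have := H1 0%N; rewrite coef_Poly coef0.
- by have := H1 1%N; rewrite coef_Poly coef0.
Qed.

Lemma lfree_W6_2 : free W6 (p2 2%:R).
Proof.
apply/lindep_freeP => v Hv.
have [||/polyP H0 /polyP H1 _] := @expo3_heights (Poly [:: v 0%N; v 1%N; v 2%N])
  (Poly [:: v 3%N; v 4%N; v 5%N]) 0.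
- rewrite size_poly0 addn0.
  by apply: leq_trans (leq_add (size_Poly _) (size_Poly _)) _.
- move=> b; rewrite -[RHS](Hv b) !horner_Poly horner0.
  by rewrite !big_ord_recl big_ord0 /= /bump /= /hpow /p2 /= expr1n; ring.
move=> [|[|[|[|[|[|i]]]]]] // _.
- by have := H0 0%N; rewrite coef_Poly coef0.
- by have := H0 1%N; rewrite coef_Poly coef0.
- by have := H0 2%N; rewrite coef_Poly coef0.
- by have := H1 0%N; rewrite coef_Poly coef0.
- by have := H1 1%N; rewrite coef_Poly coef0.
- by have := H1 2%N; rewrite coef_Poly coef0.
Qed.

Lemma lfree_L6_23 : free L6 (p3 2%:R 3%:R).
Proof.
apply/lindep_freeP => v Hv.
have [||/polyP H0 /polyP H1 /polyP H2] := @expo3_heights (Poly [:: v 0%N; v 1%N])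
  (Poly [:: v 2%N; v 3%N]) (Poly [:: v 4%N; v 5%N]).
- by apply: leq_trans (leq_add (size_Poly _) (leq_add (size_Poly _) (size_Poly _))) _.
- move=> b; rewrite -[RHS](Hv b) !horner_Poly.
  by rewrite !big_ord_recl big_ord0 /= /bump /= /hpow /p3 /= expr1n; ring.
move=> [|[|[|[|[|[|i]]]]]] // _.
- by have := H0 0%N; rewrite coef_Poly coef0.
- by have := H0 1%N; rewrite coef_Poly coef0.
- by have := H1 0%N; rewrite coef_Poly coef0.
- by have := H1 1%N; rewrite coef_Poly coef0.
- by have := H2 0%N; rewrite coef_Poly coef0.
- by have := H2 1%N; rewrite coef_Poly coef0.
Qed.

Lemma lfree_L3' t : t != 0 -> t != 1 -> free L3' (p2 t).
Proof.
move=> t0 t1; apply/lindep_freeP => v Hv.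
have E b : v 0%N + v 1%N * (h b)%:R + v 2%N * t ^+ h b = 0.
  rewrite -[RHS](Hv b) !big_ord_recl big_ord0 /= /bump /= /hpow /p2 /= expr1n; ring.
have v2 : v 2%N = 0.
  apply: contrapT => /eqP v2.
  apply: (affine0 (a := - v 0%N / v 2%N) (d := - v 1%N / v 2%N) t0 t1) => b.
  apply: (mulfI v2); apply/eqP; rewrite -subr_eq0 -[X in _ == X](E b).
  by apply/eqP; field.
have P0 : Poly [:: v 0%N; v 1%N] = 0.
  apply: poly0; first exact: leq_trans (size_Poly _) _.
  by move=> b; rewrite horner_Poly /= -[RHS](E b) v2; ring.
move=> [|[|[|i]]] // _; have /polyP := P0.
- by move=> /(_ 0%N); rewrite coef_Poly coef0.
- by move=> /(_ 1%N); rewrite coef_Poly coef0.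
Qed.

(** A maximal minor is a polynomial in t that is nonzero at t = 2, hence has finitely many roots. *)
Lemma lfree_exceptional L : (forall p, p \in L -> (p.2 < 2)%N) -> free L (p2 2%:R) ->
  exists rs : seq C, forall t, t \notin rs -> free L (p2 t).
Proof.
move=> L2 fr.
pose a1 : atom C 'I_1 := (1, None).
pose az (j : nat) : atom C 'I_1 := if j is 0%N then a1 else (1, Some ord0).
have azE t j : (j < 2)%N -> aval (az j) (fun=> t) = p2 t j.
  by case: j => [|[|j]] // _; rewrite /aval /= ?mulr1 ?mul1r.
have fE t : lindep_free (size L) (fun i b => hp (lnth L i).1 b * aval (az (lnth L i).2) (fun=> t) ^+ h b)
    <-> free L (p2 t).
  by split; apply: lindep_free_ext => i b iL; rewrite azE // L2 // mem_nth.
have [|||D [nD HD]] := @generic_fam C T h e1 e2 'I_1 (size L) a1 a1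
    (fun i => az (lnth L i).2) (fun i => hp (lnth L i).1) (fun=> 2%:R).
- by rewrite /aval /= mulr1 oner_neq0.
- by rewrite /aval /= mulr1 oner_neq0.
- exact/fE.
have [rs Hrs] := line_finite_zeros nD; exists rs => t nt; apply/fE.
apply: HD; rewrite /aval /= ?mulr1 ?oner_neq0 //.
by apply: contraNneq nt => /Hrs.
Qed.

Definition quadruple_root : set (T -> C) := [set c | exists x y z,
  [/\ x != 0, y != 0, z != 0 & forall k, (k < 4)%N -> S c x y z (hp k) = 0]].

Lemma thin_quadruple_root : thin quadruple_root.
Proof.
have H : forall p, p \in P4 -> (p.2 < 1)%N by apply/allP.
apply: thinS (thin_points_lt C h e1 e2 H _) => // c [x [y [z [x0 y0 z0 Hc]]]].
exists x, y, (fun=> z); split=> //; first exact: lfree_P4.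
by rewrite /lsat /P4 /L3; list_cases; exact: Hc.
Qed.

(** In logarithmic coordinates the last equation is the vanishing of the Jacobian in (x, y) of the
    fiber equation and its z-derivative: the fibers do not form a versal deformation of the triple
    root. *)
Definition degenerate_cusp : set (T -> C) := [set c | exists x y z,
  [/\ [/\ x != 0, y != 0 & z != 0], forall k, (k < 3)%N -> S c x y z (hp k) = 0 &
  S c x y z (fun b => (e1 b)%:R) * S c x y z (fun b => (e2 b)%:R * hp 1 b) -
  S c x y z (fun b => (e2 b)%:R) * S c x y z (fun b => (e1 b)%:R * hp 1 b) = 0]].

Lemma thin_degenerate_cusp : thin degenerate_cusp.
Proof.
have H : forall p, p \in L3 -> (p.2 < 1)%N by apply/allP.
have th := thin_points_crit C h e1 e2 H isT.
apply: thinS (thinU thin_quadruple_root th) => c [x [y [z [[x0 y0 z0] Hc]]]].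
move=> /kernel2[ox [oy [nz [E1 E2]]]].
have [S3|S3] := eqVneq (S c x y z (hp 3)) 0.
  left; exists x, y, z; split=> // k; rewrite ltnS leq_eqVlt => /orP[/eqP -> //|].
  exact: Hc.
right; exists x, y, (fun=> z); split=> //; first exact: lfree_L3.
  by rewrite /lsat /P4 /L3; list_cases; exact: Hc.
(* The kernel vector annihilates the variation of the first two conditions. The velocity of z is
   chosen to cancel that of the third, which is possible because S(h^3) is nonzero. *)
exists ox, oy, (fun=> - (ox * S c x y z (fun b => (e1 b)%:R * hp 2 b) +
   oy * S c x y z (fun b => (e2 b)%:R * hp 2 b)) / S c x y z (hp 3)); split=> //.
rewrite /L3; list_cases => /=.
- by rewrite S_crit !S_e Hc // mulr0 addr0 (mulrC ox) (mulrC oy).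
- by rewrite S_crit Hc // mulr0 addr0 (mulrC ox) (mulrC oy).
- by rewrite S_crit mulfVK // subrr.
Qed.

Definition cusp_and_fold : set (T -> C) := [set c | exists x y z1 z2,
  [/\ [/\ x != 0, y != 0, z1 != 0 & z2 != 0], z1 != z2,
    forall k, (k < 3)%N -> S c x y z1 (hp k) = 0 &
    forall k, (k < 2)%N -> S c x y z2 (hp k) = 0]].

(** Five conditions on four unknowns. If they are dependent but four of them are not, dependence is
    the missing equation. Otherwise t^h and h t^h are both quadratic polynomials in h, against
    [quad_heights]. *)
Lemma thin_cusp_and_fold : thin cusp_and_fold.
Proof.
have H5 : forall p, p \in L5 -> (p.2 < 2)%N by apply/allP.
have Ha : forall p, p \in rcons L3 (0, 1)%N -> (p.2 < 2)%N by apply/allP.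
have Hb : forall p, p \in rcons L3 (1, 1)%N -> (p.2 < 2)%N by apply/allP.
have th := thin_points_lt C h e1 e2 H5 isT.
have tha := thin_points_hyp e1 e2 Ha isT H5 lfree_L5_2.
have thb := thin_points_hyp e1 e2 Hb isT H5 lfree_L5_2.
apply: thinS (thinU th (thinU tha thb)) => c [x [y [z1 [z2 [[x0 y0 z10 z20] z12 H1 H2]]]]].
pose z (j : nat) := nth 0 [:: z1; z2] j.
have [f5|f5] := pselect (free L5 z).
  left; exists x, y, z; split=> //.
  by rewrite /lsat /L5 /L3 /rcons /=; list_cases; rewrite /z /=; (exact: H1 || exact: H2).
right.
have [fa|fa] := pselect (free (rcons L3 (0, 1)%N) z).
  left; exists x, y, z; split=> //.
  by rewrite /lsat /L5 /L3 /rcons /=; list_cases; rewrite /z /=; (exact: H1 || exact: H2).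
have [fb|fb] := pselect (free (rcons L3 (1, 1)%N) z).
  right; exists x, y, z; split=> //.
  by rewrite /lsat /L5 /L3 /rcons /=; list_cases; rewrite /z /=; (exact: H1 || exact: H2).
exfalso.
have t0 : z2 / z1 != 0 by rewrite mulf_neq0 // invr_neq0.
have t1 : z2 / z1 != 1 by apply: contraNneq z12 => E; rewrite -(mulfVK z10 z2) E mul1r.
have {}fa : ~ free (rcons L3 (0, 1)%N) (p2 (z2 / z1)).
  by move=> f; apply: fa; apply/(lfree_norm (z := z)).
have {}fb : ~ free (rcons L3 (1, 1)%N) (p2 (z2 / z1)).
  by move=> f; apply: fb; apply/(lfree_norm (z := z)).
have f3 : free L3 (p2 (z2 / z1)) by apply: lfree_L3; rewrite /p2 /= oner_neq0.
have [a Ea] := lfree_rcons f3 fa.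
have [d Ed] := lfree_rcons f3 fb.
apply: (@quad_heights R T h hs hs_uniq hs6 hsP hAP (z2 / z1)
  (Poly [:: a 0%N; a 1%N; a 2%N]) (Poly [:: d 0%N; d 1%N; d 2%N])) => //.
- exact: leq_trans (size_Poly _) _.
- exact: leq_trans (size_Poly _) _.
- move=> b; rewrite horner_Poly; have := Ea b; rewrite !big_ord_recl big_ord0 /= /bump /= /hpow /p2 /= expr1n.
  by rewrite mul1r => ->; ring.
- move=> b; rewrite horner_Poly; have := Ed b; rewrite !big_ord_recl big_ord0 /= /bump /= /hpow /p2 /= expr1n.
  by rewrite expr1 => ->; ring.
Qed.


(** The gradients in (x, y) of the fiber equation at the two double roots are normal to the two
    branches of the discriminant curve; the determinant detects that the branches are not
    transverse. *)
Definition tangent_folds : set (T -> C) := [set c | exists x y z1 z2,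
  [/\ [/\ x != 0, y != 0, z1 != 0 & z2 != 0], z1 != z2,
    forall k, (k < 2)%N -> S c x y z1 (hp k) = 0,
    forall k, (k < 2)%N -> S c x y z2 (hp k) = 0 &
    S c x y z1 (fun b => (e1 b)%:R) * S c x y z2 (fun b => (e2 b)%:R) -
    S c x y z1 (fun b => (e2 b)%:R) * S c x y z2 (fun b => (e1 b)%:R) = 0]].

(** A vector orthogonal to both gradients carries the two double roots along to first order, which
    makes the point critical on the incidence variety. At the finitely many ratios where [L4] is
    dependent, the three conditions [L3'] on the three remaining unknowns are critical in the same
    way. *)
Lemma thin_tangent_folds : thin tangent_folds.
Proof.
have H4 : forall p, p \in L4 -> (p.2 < 2)%N by apply/allP.
have th := thin_points_crit C h e1 e2 H4 isT.
have [rs Hrs] := lfree_exceptional H4 lfree_L4_2.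
have thr : thin [set c | exists2 t, t \in rs & exists x y z,
    [/\ [/\ x != 0, y != 0 & z != 0], free L3' (p2 t),
    sat c x y (fun j => p2 t j * z) L3' &
    exists ox oy oz, (ox != 0) || (oy != 0) /\ forall p, p \in L3' ->
      S c x y (p2 t p.2 * z) (fun b => ((e1 b)%:R * ox + (e2 b)%:R * oy + (h b)%:R * oz)
                               * hp p.1 b) = 0]].
  by apply: thin_bigU => t _; exact: thin_ratio_crit.
apply: thinS (thinU thin_cusp_and_fold (thinU th thr)) => c.
move=> [x [y [z1 [z2 [[x0 y0 z10 z20] z12 H1 H2 /kernel2[ox [oy [nz [E1 E2]]]]]]]]].
have [S1|S1] := eqVneq (S c x y z1 (hp 2)) 0.
  left; exists x, y, z1, z2; split=> // k; rewrite ltnS leq_eqVlt => /orP[/eqP -> //|].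
  exact: H1.
have [S2|S2] := eqVneq (S c x y z2 (hp 2)) 0.
  left; exists x, y, z2, z1; split=> //; first by rewrite eq_sym.
  by move=> k; rewrite ltnS leq_eqVlt => /orP[/eqP -> //|]; exact: H2.
right.
(* The logarithmic velocity of a double root z, found by differentiating the condition with h. It
   exists because S(h^2) is nonzero, the root not being triple. *)
pose oz z := - (ox * S c x y z (fun b => (e1 b)%:R * hp 1 b) +
   oy * S c x y z (fun b => (e2 b)%:R * hp 1 b)) / S c x y z (hp 2).
pose z (j : nat) := nth 0 [:: z1; z2] j.
have [f4|f4] := pselect (free L4 z).
  left; exists x, y, z; split=> //.
    by rewrite /lsat /L4; list_cases; rewrite /z /=; (exact: H1 || exact: H2).
  exists ox, oy, (fun j => oz (z j)); split=> //.
  rewrite /L4; list_cases; rewrite /z /= S_crit.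
  - by rewrite !S_e H1 // mulr0 addr0 (mulrC ox) (mulrC oy).
  - by rewrite mulfVK // subrr.
  - by rewrite !S_e H2 // mulr0 addr0 (mulrC ox) (mulrC oy).
  - by rewrite mulfVK // subrr.
right; pose t := z2 / z1.
have t0 : t != 0 by rewrite mulf_neq0 // invr_neq0.
have tz : t * z1 = z2 by rewrite mulfVK.
have t1 : t != 1 by apply: contraNneq z12 => E; rewrite -tz E mul1r.
exists t.
  apply: contrapT => /negP nt; apply: f4; apply/(lfree_norm (z := z)) => //.
  exact: Hrs.
exists x, y, z1; split=> //; first exact: lfree_L3'.
  by rewrite /lsat /L3'; list_cases; rewrite /p2 /= ?mul1r ?tz; (exact: H1 || exact: H2).
(* The roots now share one velocity, that of z1. At z2 only the condition of order 0 is kept, and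
   there the velocity is multiplied by S(h) = 0. *)
exists ox, oy, (oz z1); split=> //.
rewrite /L3'; list_cases; rewrite /p2 /= ?mul1r ?tz S_crit.
- by rewrite !S_e H1 // mulr0 addr0 (mulrC ox) (mulrC oy).
- by rewrite mulfVK // subrr.
- by rewrite !S_e H2 // mulr0 addr0 (mulrC ox) (mulrC oy).
Qed.

(** Here s^h and h s^h are both combinations of 1, h, t^h, h t^h. Multiplying the first by h and
    comparing gives a relation in [W6]. Outside finitely many t it is trivial, which leaves s^h = p
    + q t^h, possible for finitely many t only. *)
Lemma rank4_exceptional : exists E : seq C, forall z : nat -> C,
  z 0%N != 0 -> z 1%N != 0 -> z 2%N != 0 -> z 2%N != z 0%N -> z 2%N != z 1%N ->
  free L4 z -> ~ free (rcons L4 (0, 2)%N) z -> ~ free (rcons L4 (1, 2)%N) z ->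
  z 1%N / z 0%N \in E.
Proof.
have HW : forall p, p \in W6 -> (p.2 < 2)%N by apply/allP.
have [rs Hrs] := lfree_exceptional HW lfree_W6_2.
have [rho rho0 Hrho] := trinomial_exceptional hs_uniq hs6 hsP hAP.
have [rs' Hrs'] := poly_finite_roots rho0.
exists (rs ++ rs') => z z0 z1 z2 z20 z21 f4 na nb.
rewrite mem_cat; apply/orP.
have [|nt] := boolP (z 1%N / z 0%N \in rs); [by left|right].
pose t := z 1%N / z 0%N; pose s := z 2%N / z 0%N.
have s1 : s != 1 by apply: contraNneq z20 => E; rewrite -(mulfVK z0 (z 2%N)) -/s E mul1r.
have st : s != t.
  by apply: contraNneq z21 => E; rewrite -(mulfVK z0 (z 2%N)) -/s E /t mulfVK.
have s0 : s != 0 by rewrite mulf_neq0 // invr_neq0.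
have t0 : t != 0 by rewrite mulf_neq0 // invr_neq0.
have [a Ea] := lfree_rcons f4 na; have [d Ed] := lfree_rcons f4 nb.
have zX j b : z j ^+ h b = (z j / z 0%N) ^+ h b * z 0%N ^+ h b by rewrite -exprMn mulfVK.
have {}Ea b : s ^+ h b = a 0%N + a 1%N * (h b)%:R + a 2%N * t ^+ h b + a 3%N * (h b)%:R * t ^+ h b.
  have zb : z 0%N ^+ h b != 0 by rewrite expf_neq0.
  apply: (mulIf zb); have := Ea b.
  rewrite !big_ord_recl big_ord0 /= /bump /= /hpow expr0 expr1 mul1r.
  by rewrite (zX 2%N) (zX 1%N) -/s -/t => ->; ring.
have {}Ed b : (h b)%:R * s ^+ h b =
    d 0%N + d 1%N * (h b)%:R + d 2%N * t ^+ h b + d 3%N * (h b)%:R * t ^+ h b.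
  have zb : z 0%N ^+ h b != 0 by rewrite expf_neq0.
  apply: (mulIf zb); have := Ed b.
  rewrite !big_ord_recl big_ord0 /= /bump /= /hpow expr0 expr1 mul1r.
  by rewrite (zX 2%N) (zX 1%N) -/s -/t mulrA => ->; ring.
have /lindep_freeP fW := Hrs _ nt.
(* The coefficients in the order of [W6] of h times the first relation minus the second. *)
pose v i := nth 0 [:: - d 0%N; a 0%N - d 1%N; a 1%N; - d 2%N; a 2%N - d 3%N; a 3%N] i.
have vE : forall i, (i < 6)%N -> v i = 0.
  apply: fW => b; rewrite !big_ord_recl big_ord0 /= /bump /= /hpow /p2 /= -/t /v /= expr1n.
  transitivity ((h b)%:R * s ^+ h b - (h b)%:R * s ^+ h b); last by rewrite subrr.
  by rewrite {1}Ea Ed; ring.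
have a1 : a 1%N = 0 := vE 2%N isT.
have a3 : a 3%N = 0 := vE 5%N isT.
apply: Hrs'; apply: (Hrho t s (a 0%N) (a 2%N)) => // b.
by rewrite Ea a1 a3; ring.
Qed.

Definition triple_fold : set (T -> C) := [set c | exists x y (z : nat -> C),
  [/\ x != 0 /\ y != 0, [/\ z 0%N != 0, z 1%N != 0 & z 2%N != 0],
      [/\ z 1%N != z 0%N, z 2%N != z 0%N & z 2%N != z 1%N] &
      forall j k, (j < 3)%N -> (k < 2)%N -> S c x y (z j) (hp k) = 0]].

Definition triple_fold_free : set (T -> C) := [set c | exists x y (z : nat -> C),
  [/\ x != 0 /\ y != 0, [/\ z 0%N != 0, z 1%N != 0 & z 2%N != 0],
      [/\ z 1%N != z 0%N, z 2%N != z 0%N & z 2%N != z 1%N], free L4 z &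
      forall j k, (j < 3)%N -> (k < 2)%N -> S c x y (z j) (hp k) = 0]].

(** Six conditions on five unknowns. If they are dependent but five of them are not, dependence is
    the missing equation. Otherwise z_1 / z_0 has finitely many values, and the four conditions [L4]
    meet only three unknowns. *)
Lemma thin_triple_fold_free : thin triple_fold_free.
Proof.
have H6 : forall p, p \in L6 -> (p.2 < 3)%N by apply/allP.
have Ha : forall p, p \in rcons L4 (0, 2)%N -> (p.2 < 3)%N by apply/allP.
have Hb : forall p, p \in rcons L4 (1, 2)%N -> (p.2 < 3)%N by apply/allP.
have H4 : forall p, p \in L4 -> (p.2 < 2)%N by apply/allP.
have th := thin_points_lt C h e1 e2 H6 isT.
have tha := thin_points_hyp e1 e2 Ha isT H6 lfree_L6_23.
have thb := thin_points_hyp e1 e2 Hb isT H6 lfree_L6_23.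
have [E HE] := rank4_exceptional.
have thE : thin [set c | exists2 t, t \in E & exists x y z,
    [/\ [/\ x != 0, y != 0 & z != 0], free L4 (p2 t) &
         sat c x y (fun j => p2 t j * z) L4]].
  by apply: thin_bigU => t _; exact: thin_ratio_lt.
apply: thinS (thinU (thinU th thE) (thinU tha thb)) => c.
move=> [x [y [z [[x0 y0] [z0 z1 z2] [z10 z20 z21] f4 Hz]]]].
have [f6|f6] := pselect (free L6 z).
  left; left; exists x, y, z; split=> //.
  by rewrite /lsat /L6; list_cases; exact: Hz.
have [fa|fa] := pselect (free (rcons L4 (0, 2)%N) z).
  right; left; exists x, y, z; split=> //.
  by rewrite /lsat /L4 /rcons; list_cases; exact: Hz.
have [fb|fb] := pselect (free (rcons L4 (1, 2)%N) z).
  right; right; exists x, y, z; split=> //.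
  by rewrite /lsat /L4 /rcons; list_cases; exact: Hz.
left; right; exists (z 1%N / z 0%N); first exact: HE.
exists x, y, (z 0%N); split=> //; first exact: (proj1 (lfree_norm z0 H4) f4).
by rewrite /lsat /L4; list_cases; rewrite /p2 /= ?mul1r ?mulfVK //; exact: Hz.
Qed.

(** If both pairs containing z_0 have dependent conditions, both ratios to z_0 take finitely many
    values, which leaves three unknowns. Four independent conditions exist unless all six functions
    lie in a space of dimension three, and [triple_heights] excludes this. *)
Lemma thin_triple_fold : thin triple_fold.
Proof.
have H4 : forall p, p \in L4 -> (p.2 < 2)%N by apply/allP.
have [rs Hrs] := lfree_exceptional H4 lfree_L4_2.
have thS (e : nat) : thin [set c | exists2 t, t \in rs & exists2 s, s \in rs & exists x y z,
    [/\ [/\ x != 0, y != 0 & z != 0], free (rcons L3' (e, 2)%N) (p3 t s) &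
         sat c x y (fun j => p3 t s j * z) (rcons L3' (e, 2)%N)]].
  by apply: thin_bigU => t _; apply: thin_bigU => s _; exact: thin_ratio_lt.
apply: thinS (thinU thin_triple_fold_free (thinU (thS 0%N) (thS 1%N))) => c.
move=> [x [y [z [[x0 y0] [z0 z1 z2] [z10 z20 z21] Hz]]]].
have [f01|f01] := pselect (free L4 z); first by left; exists x, y, z.
(* Exchanging the last two roots lets z_2 / z_0 play the part of z_1 / z_0. *)
pose z' (j : nat) := nth 0 [:: z 0%N; z 2%N; z 1%N] j.
have [f02|f02] := pselect (free L4 z').
  left; exists x, y, z'; split=> //; first by split=> //; rewrite eq_sym.
  by move=> [|[|[|j]]] k // _ kl; exact: Hz.
right; pose t := z 1%N / z 0%N; pose s := z 2%N / z 0%N.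
have t0 : t != 0 by rewrite mulf_neq0 // invr_neq0.
have s0 : s != 0 by rewrite mulf_neq0 // invr_neq0.
have tz : t * z 0%N = z 1%N by rewrite mulfVK.
have sz : s * z 0%N = z 2%N by rewrite mulfVK.
have t1 : t != 1 by apply: contraNneq z10 => E; rewrite -tz E mul1r.
have s1 : s != 1 by apply: contraNneq z20 => E; rewrite -sz E mul1r.
have st : s != t by apply: contraNneq z21 => E; rewrite -tz -sz E.
have ft : ~ free L4 (p2 t) by move=> f; apply: f01; apply/(lfree_norm (z := z)).
have trs : t \in rs by apply: contrapT => /negP /Hrs.
have srs : s \in rs.
  apply: contrapT => /negP /Hrs f; apply: f02; exact/(lfree_norm (z := z')).
have satP e : (e < 2)%N -> sat c x y (fun j => p3 t s j * z 0%N) (rcons L3' (e, 2)%N).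
  by move=> e2'; rewrite /lsat /L3' /rcons; list_cases;
    rewrite /p3 /= ?mul1r ?tz ?sz; exact: Hz.
have [fa|fa] := pselect (free (rcons L3' (0, 2)%N) (p3 t s)).
  by left; exists t => //; exists s => //; exists x, y, (z 0%N); split=> //; exact: satP.
have [fb|fb] := pselect (free (rcons L3' (1, 2)%N) (p3 t s)).
  by right; exists t => //; exists s => //; exists x, y, (z 0%N); split=> //; exact: satP.
exfalso.
have f3 : free L3' (p3 t s).
  by apply: lfree_ext (lfree_L3' t0 t1) => p; rewrite !inE => /or3P[] /eqP ->.
have f3' : free L3' (p2 t) := lfree_L3' t0 t1.
have [a Ea] := lfree_rcons f3' (p := (1, 1)%N) ft.
have [d Ed] := lfree_rcons f3 fa; have [g Eg] := lfree_rcons f3 fb.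
apply: (@triple_heights R T h hs hs_uniq hs6 hsP hAP t s (a 0%N) (a 1%N) (a 2%N)
  (d 0%N) (d 1%N) (d 2%N) (g 0%N) (g 1%N) (g 2%N)) => // b.
- have := Ea b; rewrite !big_ord_recl big_ord0 /= /bump /= /hpow /p2 /= expr1n.
  by rewrite expr1 => ->; ring.
- have := Ed b; rewrite !big_ord_recl big_ord0 /= /bump /= /hpow /p3 /= expr1n.
  by rewrite expr0 mul1r => ->; ring.
- have := Eg b; rewrite !big_ord_recl big_ord0 /= /bump /= /hpow /p3 /= expr1n.
  by rewrite expr1 => ->; ring.
Qed.

End Genericity.

(** * Singular points in the torus *)

Section LatticeScaling.
Variables (F : numClosedFieldType) (T : finType).

(** The rank of an integer matrix is the same over the rationals and over [F]; a rational relation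
    is then cleared of denominators. *)
Lemma integer_relation k (f : 'I_k -> T -> nat) (u : 'I_k -> F) :
  (forall b, \sum_i u i * (f i b)%:R = 0) -> (exists i, u i != 0) ->
  exists m : 'I_k -> int, (forall b, \sum_i m i * (f i b)%:Z = 0) /\ exists i, m i != 0.
Proof.
move=> Hu [i0 ui0].
pose A : 'M[rat]_(k, #|T|) := \matrix_(i, j) (f i (enum_val j))%:R.
have nfree : ~~ row_free A.
  rewrite -(row_free_map (ratr : {rmorphism rat -> F}) A).
  apply: contra ui0 => /row_free_inj inj.
  have /rowP/(_ i0) : \row_i u i = 0 :> 'rV[F]_k.
    apply: inj; rewrite mul0mx; apply/rowP => j; rewrite !mxE -[RHS](Hu (enum_val j)).
    by apply: eq_bigr => i _; rewrite !mxE /= ratr_nat.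
  by rewrite !mxE => ->.
have [v v0 vA] : exists2 v : 'rV[rat]_k, v != 0 & v *m A = 0.
  move: nfree; rewrite -kermx_eq0 => /rowV0Pn[v /sub_kermxP vA v0].
  by exists v.
pose d : int := \prod_i denq (v 0 i).
have d0 : d != 0 by apply/prodf_neq0 => i _; rewrite denq_eq0.
pose m i : int := numq (v 0 i) * \prod_(j | j != i) denq (v 0 j).
have mE i : (m i)%:~R = d%:~R * v 0 i :> rat.
  have n0 : (denq (v 0 i))%:~R != 0 :> rat by rewrite intr_eq0 denq_eq0.
  have nE : (numq (v 0 i))%:~R = (denq (v 0 i))%:~R * v 0 i.
    by rewrite -[X in _ * X](divq_num_den (v 0 i)) mulrCA mulfV // mulr1.
  by rewrite /m /d [in RHS](bigD1 i) //= !rmorphM /= nE mulrAC.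
exists m; split.
  move=> b; apply: (@intr_inj rat); rewrite raddf_sum /=.
  have /rowP/(_ (enum_rank b)) := vA; rewrite !mxE => E.
  transitivity (d%:~R * (\sum_i v 0 i * A i (enum_rank b))); last by rewrite E mulr0.
  rewrite big_distrr; apply: eq_bigr => i _ /=.
  by rewrite intrM mE mxE enum_rankK mulrA.
have [i vi] : exists i, v 0 i != 0.
  apply: contrapT => nex; case/eqP: v0; apply/rowP => i; rewrite mxE.
  by apply/eqP/negP => /negP vi; apply: nex; exists i.
exists i; rewrite -(intr_eq0 rat) mE mulf_neq0 // intr_eq0 //.
Qed.

(** The second family of equations says that the logarithmic derivatives w_j d/dw_j vanish, so these
    are the coefficients of polynomials with a singular zero in the torus. *)
Definition log_singular n (E : 'I_n -> T -> nat) : set (T -> F) :=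
  [set c | exists w : 'I_n -> F, [/\ forall i, w i != 0,
     \sum_b mono (fun i => E i b) w * c b = 0 &
     forall j, \sum_b (E j b)%:R * mono (fun i => E i b) w * c b = 0]].

Lemma exprz_root (z : F) (m : int) : z != 0 -> m != 0 -> exists2 l : F, l != 0 & l ^ m * z = 1.
Proof.
move=> z0; case: m => [[|n]|n] // _.
  exists ((n.+1).-root z^-1); first by rewrite rootC_eq0 // invr_eq0.
  by rewrite -exprnP rootCK // mulVf.
exists ((n.+1).-root z); first by rewrite rootC_eq0.
by rewrite NegzE -exprnN rootCK // mulVf.
Qed.

(* If 1 and the exponents are dependent, the zero locus is invariant under a one-parameter
   subgroup of the torus, which normalizes one of the coordinates to 1. *)
Lemma thin_log_singular (b0 : T) n (E : 'I_n -> T -> nat) : thin (log_singular E).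
Proof.
elim: n E => [|n IH] E.
  exists (fun c => \sum_b 1 * c b); split; last first.
    move=> c [w [_ + _]]; under eq_bigr do rewrite /mono big_ord0.
    by [].
  split.
    apply: polyfun_sum => b; apply: polyfunM; [exact: polyfun_cst|exact: polyfun_var].
  exists (fun b => (b == b0)%:R); rewrite (bigD1 b0) //= big1 ?eqxx ?mulr1 ?addr0 ?oner_neq0 //.
  by move=> b /negPf ->; rewrite mulr0.
(* The exponents together with the constant 1: [n.+2] conditions on [n.+1] unknowns. *)
pose f (i : 'I_n.+2) b : nat := if unlift ord0 i is Some j then E j b else 1%N.
pose Phi (i : 'I_n.+2) b (w : 'I_n.+1 -> F) := (f i b)%:R * mono (fun i => E i b) w.
have pPhi i b : polyfun (Phi i b).
  by apply: polyfunM; [exact: polyfun_cst|exact: polyfun_mono].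
have Jk : (#|'I_n.+1| < n.+2)%N by rewrite card_ord.
have thI := thin_bigU (fun j _ => IH (fun i => E (lift j i))) (r := enum 'I_n.+1).
apply: thinS (thinU (thin_rank_lt pPhi Jk) thI) => c [w [w0 S0 SE]].
have mono0 b : mono (fun i => E i b) w != 0.
  by apply/prodf_neq0 => i _; rewrite expf_neq0.
have [ind|nind] := pselect (independent_at Phi w).
  left; exists w; split=> // i; rewrite /Phi /f; case: unliftP => [j _|_]; first exact: SE.
  by under eq_bigr do rewrite mul1r.
right.
have [u [Hu u0]] : exists u : 'I_n.+2 -> F,
    (forall b, \sum_i u i * (f i b)%:R = 0) /\ exists i, u i != 0.
  apply: contrapT => nex; apply: nind => u Hu i; apply: contrapT => /eqP ui; apply: nex.
  exists u; split; last by exists i.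
  move=> b; apply: (mulIf (mono0 b)); rewrite mul0r -[RHS](Hu b) big_distrl.
  by apply: eq_bigr => l _; rewrite /= /Phi mulrA.
have [m [Hm [i1 mi1]]] := integer_relation Hu u0.
pose m' i := m (lift ord0 i).
have Hm' b : \sum_i m' i * (E i b)%:Z = - m ord0.
  have := Hm b; rewrite big_ord_recl /f unlift_none mulr1 => /eqP.
  rewrite addrC addr_eq0 => /eqP <-; apply: eq_bigr => i _.
  by rewrite liftK.
have [j mj] : exists j, m' j != 0.
  apply: contrapT => nex.
  have z i : m' i = 0 by apply: contrapT => /eqP mi; apply: nex; exists i.
  case/eqP: mi1; case: (unliftP ord0 i1) => [i -> |->]; first exact: z.
  by apply: oppr_inj; rewrite -(Hm' b0) oppr0 big1 // => i _; rewrite z mul0r.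
have [l l0 lj] := exprz_root (w0 j) mj.
exists j; first by rewrite mem_enum.
(* By [Hm'] this rescaling multiplies all monomials by the same power of [l], so the equations
   persist; the j-th coordinate becomes 1 and is dropped. *)
pose w' i := l ^ m' i * w i.
have monoE b : mono (fun i => E (lift j i) b) (fun i => w' (lift j i)) =
    l ^ (- m ord0) * mono (fun i => E i b) w.
  transitivity (mono (fun i => E i b) w').
    by rewrite /mono (bigD1_ord j) //= {2}/w' lj expr1n mul1r.
  rewrite /mono -(Hm' b) /w'.
  under eq_bigr do rewrite exprMn.
  rewrite big_split /=; congr (_ * _).
  elim/big_rec2: _ => [|i x y _ ->]; first by rewrite expr0z.
  by rewrite expfzDr // -exprz_exp -exprnP.
have sc (g : T -> F) : \sum_b g b * mono (fun i => E i b) w * c b = 0 ->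
    \sum_b g b * mono (fun i => E (lift j i) b) (fun i => w' (lift j i)) * c b = 0.
  move=> H; transitivity (l ^ (- m ord0) * \sum_b g b * mono (fun i => E i b) w * c b).
    by rewrite big_distrr; apply: eq_bigr => b _ /=; rewrite monoE; ring.
  by rewrite H mulr0.
exists (fun i => w' (lift j i)); split.
- by move=> i; rewrite mulf_neq0 // expfz_neq0.
- have {}S0 : \sum_b 1 * mono (fun i => E i b) w * c b = 0.
    by rewrite -[RHS]S0; apply: eq_bigr => b _; rewrite mul1r.
  by rewrite -[RHS](sc (fun=> 1) S0); apply: eq_bigr => b _; rewrite mul1r.
- by move=> i; exact: (sc (fun b => (E (lift j i) b)%:R)).
Qed.

End LatticeScaling.

(** * General coefficients are tame *)

Section Tame.
Variable R : realType.
Local Notation C := R[i].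

Definition singular_point (T : finType) (h e1 e2 : T -> nat) : set (T -> C) :=
  [set c | exists x y z, [/\ [/\ x != 0, y != 0 & z != 0],
    Smoment h e1 e2 c x y z (fun=> 1) = 0,
    Smoment h e1 e2 c x y z (fun b => (e1 b)%:R) = 0,
    Smoment h e1 e2 c x y z (fun b => (e2 b)%:R) = 0 &
    Smoment h e1 e2 c x y z (fun b => (h b)%:R) = 0]].

Lemma thin_singular_point (T : finType) (b0 : T) (h e1 e2 : T -> nat) : thin (singular_point h e1 e2).
Proof.
pose E (i : 'I_3) := nth h [:: e1; e2; h] i.
apply: thinS (thin_log_singular C b0 E) => c [x [y [z [[x0 y0 z0] S0 S1 S2 S3]]]].
pose w (i : 'I_3) := nth 0 [:: x; y; z] i.
have mE b : mono (fun i => E i b) w = x ^+ e1 b * y ^+ e2 b * z ^+ h b.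
  by rewrite /mono !big_ord_recl big_ord0 /= mulr1 mulrA.
exists w; split.
- by case=> [[|[|[|i]]]].
- by rewrite -[RHS]S0; apply: eq_bigr => b _; rewrite mE; ring.
- case=> [[|[|[|i]]]] // i3.
  + by rewrite -[RHS]S1; apply: eq_bigr => b _; rewrite mE /E /=; ring.
  + by rewrite -[RHS]S2; apply: eq_bigr => b _; rewrite mE /E /=; ring.
  + by rewrite -[RHS]S3; apply: eq_bigr => b _; rewrite mE /E /=; ring.
Qed.

Definition tame (T : finType) (h e1 e2 : T -> nat) (c : T -> C) :=
  [/\ ~ quadruple_root h e1 e2 c, ~ singular_point h e1 e2 c, ~ degenerate_cusp h e1 e2 c &
  [/\ ~ tangent_folds h e1 e2 c, ~ cusp_and_fold h e1 e2 c & ~ triple_fold h e1 e2 c]].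

Lemma fset_pick (A : {fset int}) (x : int) : (1 < #|` A|)%N ->
  exists2 y, y \in A & y != x.
Proof.
move=> cA; have : (0 < #|` A `\ x|%fset)%N.
  move: cA; rewrite (cardfsD1 x A); case: (x \in A) => /=; first by rewrite add1n ltnS.
  by rewrite add0n; exact: ltnW.
by rewrite cardfs_gt0 => /fset0Pn[y]; rewrite in_fsetD1 => /andP[yx yA]; exists y.
Qed.

(** Two heights other than the excluded one give equal powers of t, so t is a root of unity of order
    d > 1. All heights but at most one are then congruent modulo d and lie in a proper
    progression. *)
Lemma heights_power (N : {fset lattice3}) (h : N -> nat) (K : nat) (t u : C) (h0 : nat) :
  (6 <= #|` heights N|)%N ->
  (forall a b : int, arith_prog a b `<` setT ->
      ~ exists2 B : {fset int},
          (B `<=` heights N)%fset /\ #|` B| = (#|` heights N| - 1)%N &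
          [set` B] `<=` arith_prog a b) ->
  (forall b, (h b)%:Z = height (val b) + K%:Z) ->
  t != 0 -> t != 1 -> ~ forall b, h b != h0 -> t ^+ h b = u.
Proof.
set A := heights N => A6 HAP hE t0 t1 H.
pose r0 : int := h0%:Z - K%:Z.
have pick a : a \in A -> exists2 b : N, height (val b) = a & (a != r0 -> h b != h0).
  move=> /imfsetP[/= b bN ->]; exists (FSetSub bN) => //= n.
  by apply: contraNneq n => e; rewrite /r0 -e hE addrK.
have [a1 a1A a1r] : exists2 a, a \in A & a != r0 by apply: fset_pick; lia.
have [a2 /fsetD1P[a21 a2A] a2r] : exists2 a, a \in (A `\ a1)%fset & a != r0.
  by apply: fset_pick; have := cardfsD1 a1 A; rewrite a1A; lia.
have [b1 E1 /(_ a1r) n1] := pick _ a1A; have [b2 E2 /(_ a2r) n2] := pick _ a2A.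
have tE b : h b != h0 -> t ^+ h b = t ^+ h b1 by move=> n; rewrite !H.
have [m m_gt0 tm] : exists2 m, (0 < m)%N & t ^+ m = 1.
  have ne : h b1 != h b2.
    by apply: contraNneq a21 => e; rewrite -E1 -E2 -(inj_eq (addIr K%:Z)) -!hE e.
  have pow n k : (n < k)%N -> t ^+ n = t ^+ k -> t ^+ (k - n) = 1.
    move=> nk e; apply: (mulIf (expf_neq0 n t0)).
    by rewrite -exprD subnK ?mul1r // ltnW.
  have [lt|le] := ltnP (h b1) (h b2).
    by exists (h b2 - h b1)%N; rewrite ?subn_gt0 //; apply: pow; rewrite ?tE.
  exists (h b1 - h b2)%N; first by rewrite subn_gt0 ltn_neqAle eq_sym ne.
  by apply: pow; rewrite ?tE // ltn_neqAle eq_sym ne.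
have [d pd _] := prim_order_exists m_gt0 tm.
have d_gt0 := prim_order_gt0 pd.
have d_gt1 : (1 < d)%N.
  rewrite ltn_neqAle d_gt0 andbT; apply: contraNneq t1 => d1.
  by have := prim_expr_order pd; rewrite -d1 expr1 => ->.
have inAP a : a \in A -> a != r0 -> arith_prog d a1 a.
  move=> aA ar; have [b Eb /(_ ar) nb] := pick _ aA.
  have /eqP := tE b nb; rewrite (eq_prim_root_expr pd) => /eqP e.
  exists ((h b %/ d)%N%:Z - (h b1 %/ d)%N%:Z) => //.
  have := divn_eq (h b) d; have := divn_eq (h b1) d; rewrite e.
  by have := hE b; have := hE b1; rewrite E1 Eb; nia.
apply: (HAP d a1).
  split; first by [].
  move=> /(_ (a1 + 1) I) [k _ e].
  have : (d%:Z %| 1)%Z by apply/dvdzP; exists k; move: e; lia.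
  by rewrite dvdzE /= dvdn1 => /eqP d1; rewrite d1 in d_gt1.
(* If the excluded value is not a height, the height [a1] is discarded instead, so that exactly |A|
   - 1 elements are left. *)
have [r rA rP] : exists2 r, r \in A & forall a, a \in A -> a != r -> a != r0.
  have [r0A|r0A] := boolP (r0 \in A); first by exists r0.
  by exists a1 => // a aA _; apply: contraNneq r0A => <-.
exists (A `\ r)%fset; first split.
- exact: fsubD1set.
- by have := cardfsD1 r A; rewrite rA; lia.
- by move=> a /fsetD1P[ar aA]; apply: inAP => //; exact: (rP a).
Qed.

Lemma generic_tame (N : {fset lattice3}) :
  (6 <= #|` heights N|)%N ->
  (forall a b : int, arith_prog a b `<` setT ->
      ~ exists2 B : {fset int},
          (B `<=` heights N)%fset /\ #|` B| = (#|` heights N| - 1)%N &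
          [set` B] `<=` arith_prog a b) ->
  exists (U : set (N -> C)) (e1 e2 h : N -> nat) (K : nat),
    [/\ zariski_open U, U !=set0,
      forall b, [/\ (e1 b)%:Z = (val b).1.1 + K%:Z, (e2 b)%:Z = (val b).1.2 + K%:Z
                  & (h b)%:Z = (val b).2 + K%:Z] &
      forall c, U c -> tame h e1 e2 c].
Proof.
move=> A6 HAP.
(* Multiplying f by (x y z)^K makes all exponents nonnegative and keeps its zeros in the torus. *)
pose K := (\sum_(b : N) (`|(val b).1.1| + `|(val b).1.2| + `|(val b).2|))%N.
have Kb (b : N) : (`|(val b).1.1| + `|(val b).1.2| + `|(val b).2| <= K)%N.
  by rewrite /K (bigD1 b) //= leq_addr.
pose e1 (b : N) := `|((val b).1.1 + K%:Z)%R|%N.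
pose e2 (b : N) := `|((val b).1.2 + K%:Z)%R|%N.
pose h (b : N) := `|((val b).2 + K%:Z)%R|%N.
have E1 b : (e1 b)%:Z = (val b).1.1 + K%:Z by rewrite /e1; have := Kb b; lia.
have E2 b : (e2 b)%:Z = (val b).1.2 + K%:Z by rewrite /e2; have := Kb b; lia.
have E3 b : (h b)%:Z = (val b).2 + K%:Z by rewrite /h; have := Kb b; lia.
pose hs := [seq `|(a + K%:Z)%R|%N | a <- enum_fset (heights N)].
have absK a : a \in heights N -> (`|(a + K%:Z)%R|%N)%:Z = a + K%:Z.
  by move=> /imfsetP[/= b bN ->]; have := Kb (FSetSub bN); rewrite /height /=; lia.
have hs_uniq : uniq hs.
  rewrite map_inj_in_uniq ?fset_uniq // => a b aA bA e.
  by apply: (addIr K%:Z); rewrite /= -(absK a aA) e; exact: absK.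
have hs6 : (6 <= size hs)%N by rewrite size_map.
have hsP n : n \in hs -> exists b, h b = n.
  move=> /mapP[a aA ->]; have /imfsetP[/= b bN aE] := aA.
  by exists (FSetSub bN); rewrite /h aE.
have hAP (t u : C) h0 : t != 0 -> t != 1 -> ~ forall b, h b != h0 -> t ^+ h b = u.
  exact: heights_power E3.
have [b0 _] : exists b : N, true.
  case: hs hs6 hsP {hs_uniq} => // n hs _ /(_ n (mem_head _ _)) [b _].
  by exists b.
have [P [[pP [p0 Pp0]] HP]] := thinU (thinU (thinU (thin_quadruple_root R e1 e2 hs_uniq hs6 hsP)
   (thin_singular_point b0 h e1 e2))
  (thinU (thin_degenerate_cusp R e1 e2 hs_uniq hs6 hsP) (thin_tangent_folds e1 e2 hs_uniq hs6 hsP hAP)))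
  (thinU (thin_cusp_and_fold e1 e2 hs_uniq hs6 hsP hAP) (thin_triple_fold e1 e2 hs_uniq hs6 hsP hAP)).
have [Q QE] := polyfun_mpoly pP.
exists [set c | P c != 0], e1, e2, h, K; split=> //.
- exists [set Q]; apply/seteqP; split=> c /=.
    by move=> Pc; exists Q => //; rewrite QE.
  by move=> [_ ->]; rewrite QE.
- by exists p0.
- move=> c /eqP Pc; split; last split; move=> B; apply/Pc/HP; rewrite /setU /=; tauto.
Qed.

End Tame.

(** * Strict differentiability and the inverse function theorem over the complex numbers *)

Section RealNorm.
Variable R : realType.
Local Notation C := R[i].
Implicit Types (U V W : normedModType C).

(** Norms take values in [R[i]], which is only partially ordered; this is the same number in [R],
    where the estimates are made. *)
Definition nm V (x : V) : R := complex.Re `|x|.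

Lemma nmE V (x : V) : `|x| = (nm x)%:C.
Proof.
have : `|x| \is Num.real by exact: normr_real.
by rewrite /nm; case: `|x| => a b; rewrite complex_real /= => /eqP ->.
Qed.

Lemma nm_ge0 V (x : V) : 0 <= nm x.
Proof. by have := normr_ge0 x; rewrite nmE lecR. Qed.

Lemma nm_le V (x : V) e : (nm x <= e) = (`|x| <= e%:C).
Proof. by rewrite nmE lecR. Qed.

Lemma nm0 V : nm (0 : V) = 0.
Proof. by rewrite /nm normr0. Qed.

Lemma nm_eq0 V (x : V) : nm x <= 0 -> x = 0.
Proof.
move=> x0; apply/normr0_eq0; rewrite nmE.
by have -> : nm x = 0 by apply/eqP; rewrite eq_le x0 nm_ge0.
Qed.

Lemma nmD V (x y : V) : nm (x + y) <= nm x + nm y.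
Proof. by rewrite nm_le rmorphD /= -!nmE ler_normD. Qed.

Lemma nmN V (x : V) : nm (- x) = nm x.
Proof. by rewrite /nm normrN. Qed.

Lemma nmB V (x y : V) : nm (x - y) <= nm x + nm y.
Proof. by rewrite -(nmN y) nmD. Qed.

Lemma nmC V (x y : V) : nm (x - y) = nm (y - x).
Proof. by rewrite -nmN opprB. Qed.

Lemma nm_trans V (y x z : V) : nm (x - z) <= nm (x - y) + nm (y - z).
Proof. by rewrite (le_trans _ (nmD _ _)) // addrA subrK. Qed.

Lemma nmZ V (c : C) (x : V) : nm (c *: x) = nm (c : C^o) * nm x.
Proof. by apply: complexI; rewrite rmorphM /= -!nmE normrZ. Qed.

Lemma nmM (x y : C^o) : nm (x * y : C^o) = nm x * nm y.
Proof. exact: nmZ. Qed.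

Lemma nm_real (r : R) : 0 <= r -> nm (r%:C : C^o) = r.
Proof. by move=> r0; apply: complexI; rewrite -nmE ger0_norm // lecR. Qed.

Lemma nm_gt0 V (x : V) : x != 0 -> 0 < nm x.
Proof.
move=> x0; rewrite lt_neqAle nm_ge0 andbT eq_sym; apply: contraNneq x0 => e.
by apply/eqP/nm_eq0; rewrite e.
Qed.

Lemma nm_pair V W (x : V * W) e : (nm x <= e) = (nm x.1 <= e) && (nm x.2 <= e).
Proof. by rewrite !nm_le prod_normE num_ge_max. Qed.

Lemma nm_pair_lt V W (x : V * W) e : (nm x < e) = (nm x.1 < e) && (nm x.2 < e).
Proof. by rewrite -!ltcR -!nmE prod_normE num_gt_max. Qed.

Lemma nm_row n (x : 'rV[C]_n) e : 0 <= e ->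
  nm x <= e <-> forall i, nm (x 0 i : C^o) <= e.
Proof.
move=> e0; rewrite nm_le -[ `|x|]/(mx_norm x) mx_normE.
have e0' : 0 <= e%:C by rewrite lecR.
rewrite -[e%:C]/((NngNum e0')%:num) num_le; split=> [/bigmax_leP[_ H] i|H].
  by have := H (0, i) isT; rewrite nm_le.
apply/bigmax_leP; split=> // -[i j] _.
by have := H j; rewrite nm_le (ord1 i).
Qed.

Lemma nm_coord n (x : 'rV[C]_n) i : nm (x 0 i : C^o) <= nm x.
Proof. exact: (nm_row x (nm_ge0 x)).1. Qed.

Definition close V (x : V) (P : V -> Prop) :=
  exists2 d : R, 0 < d & forall u, nm (u - x) < d -> P u.

Lemma closeP V (x : V) (P : V -> Prop) : close x P <-> \forall u \near x, P u.
Proof.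
split.
  move=> [d d0 H]; apply/nbhs_normP; exists d%:C; first by rewrite /= ltcR.
  by move=> u /=; rewrite -normrN opprB nmE ltcR => /H.
move=> /nbhs_normP[d /= d0 H]; exists (complex.Re d).
  by move: d0; case: d {H} => a b; rewrite ltcE /= => /andP[].
move=> u ud; apply: H => /=; rewrite -normrN opprB nmE.
move: d0 ud; case: d => a b; rewrite !ltcE /= => /andP[/eqP -> _] ->.
by rewrite eqxx.
Qed.

Lemma closeI V (x : V) (P Q : V -> Prop) : close x P -> close x Q ->
  close x (fun u => P u /\ Q u).
Proof.
move=> [d d0 HP] [e e0 HQ]; exists (Num.min d e); first by rewrite lt_min d0.
by move=> u; rewrite lt_min => /andP[/HP Pu /HQ Qu].
Qed.

Lemma closeS V (x : V) (P Q : V -> Prop) : (forall u, P u -> Q u) -> close x P -> close x Q.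
Proof. by move=> PQ [d d0 H]; exists d => // u /H/PQ. Qed.

Lemma close_self V (x : V) (P : V -> Prop) : close x P -> P x.
Proof. by move=> [d d0]; apply; rewrite subrr nm0. Qed.

Lemma close_ball V (x : V) e : 0 < e -> close x (fun u => nm (u - x) < e).
Proof. by exists e. Qed.

End RealNorm.

Section StrictDerivative.
Variable R : realType.
Local Notation C := R[i].
Implicit Types (U V W : normedModType C).

Definition bounded_linear V W (L : V -> W) :=
  [/\ forall u v, L (u + v) = L u + L v, forall c u, L (c *: u) = c *: L u &
      exists2 k : R, 0 < k & forall h, nm (L h) <= k * nm h].

(* Unlike differentiability, strict differentiability at a point is inherited by
   the local inverse. *)
Definition sderiv V W (f : V -> W) (a : V) (L : V -> W) :=
  bounded_linear L /\ forall e : R, 0 < e -> exists2 d, 0 < d &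
    forall u v, nm (u - a) < d -> nm (v - a) < d ->
      nm (f u - f v - L (u - v)) <= e * nm (u - v).

Definition sholo V W (f : V -> W) (a : V) := close a (fun u => exists L, sderiv f u L).

Lemma bl0 V W (L : V -> W) : bounded_linear L -> L 0 = 0.
Proof. by move=> [_ LZ _]; rewrite -(scale0r (0 : V)) LZ scale0r. Qed.

Lemma blN V W (L : V -> W) u : bounded_linear L -> L (- u) = - L u.
Proof. by move=> [_ LZ _]; rewrite -scaleN1r LZ scaleN1r. Qed.

Lemma blB V W (L : V -> W) u v : bounded_linear L -> L (u - v) = L u - L v.
Proof. by move=> bL; have [LD _ _] := bL; rewrite LD blN. Qed.

Lemma sderiv_lipschitz V W (f : V -> W) a L : sderiv f a L -> exists2 k : R, 0 < k &
  exists2 d, 0 < d & forall u v, nm (u - a) < d -> nm (v - a) < d ->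
    nm (f u - f v) <= k * nm (u - v).
Proof.
move=> [[_ _ [k k0 Hk]] H]; exists (1 + k); first by rewrite addr_gt0.
have [d d0 Hd] := H 1 ltr01; exists d => // u v ud vd.
have := Hd u v ud vd; have := Hk (u - v).
have := nmD (f u - f v - L (u - v)) (L (u - v)); rewrite subrK; lra.
Qed.

Lemma sderiv_continuous V W (f : V -> W) a L (P : W -> Prop) : sderiv f a L ->
  close (f a) P -> close a (fun u => P (f u)).
Proof.
move=> /sderiv_lipschitz[k k0 [d d0 H]] [e e0 HP].
exists (Num.min d (e / k)); first by rewrite lt_min d0 divr_gt0.
move=> u; rewrite lt_min => /andP[ud ue]; apply: HP.
apply: le_lt_trans (H u a ud _) _; first by rewrite subrr nm0.
by rewrite mulrC -ltr_pdivlMr.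
Qed.

Lemma sholo_continuous V W (f : V -> W) a (P : W -> Prop) : sholo f a ->
  close (f a) P -> close a (fun u => P (f u)).
Proof. by move=> /close_self[L fL]; exact: sderiv_continuous fL. Qed.

Lemma bl_id V : bounded_linear (id : V -> V).
Proof. by split=> //; exists 1 => // h; rewrite mul1r. Qed.

Lemma bl_comp U V W (L : U -> V) (M : V -> W) : bounded_linear L -> bounded_linear M ->
  bounded_linear (fun u => M (L u)).
Proof.
move=> [LD LZ [k k0 Hk]] [MD MZ [l l0 Hl]]; split=> [u v|c u|].
- by rewrite LD MD.
- by rewrite LZ MZ.
exists (l * k); first by rewrite mulr_gt0.
move=> h; apply: le_trans (Hl _) _; rewrite -mulrA ler_wpM2l //; exact: ltW.
Qed.

Lemma bl_cst0 V W : bounded_linear (fun _ : V => 0 : W).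
Proof.
split=> [u v|c u|]; rewrite ?addr0 ?scaler0 //.
by exists 1 => // h; rewrite nm0 mul1r nm_ge0.
Qed.

Lemma bl_add V W (L M : V -> W) : bounded_linear L -> bounded_linear M ->
  bounded_linear (fun u => L u + M u).
Proof.
move=> [LD LZ [k k0 Hk]] [MD MZ [l l0 Hl]]; split=> [u v|c u|].
- by rewrite LD MD addrACA.
- by rewrite LZ MZ scalerDr.
exists (k + l); first by rewrite addr_gt0.
by move=> h; rewrite (le_trans (nmD _ _)) // mulrDl lerD.
Qed.

Lemma bl_scale V W (c : C) (L : V -> W) : bounded_linear L ->
  bounded_linear (fun u => c *: L u).
Proof.
move=> [LD LZ [k k0 Hk]]; split=> [u v|d u|].
- by rewrite LD scalerDr.
- by rewrite LZ !scalerA mulrC.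
exists ((nm (c : C^o) + 1) * k); first by rewrite mulr_gt0 // ltr_wpDl // nm_ge0.
move=> h; rewrite nmZ -mulrA ler_pM ?nm_ge0 //; lra.
Qed.

Lemma bl_pair U V W (L : U -> V) (M : U -> W) : bounded_linear L -> bounded_linear M ->
  bounded_linear (fun u => (L u, M u)).
Proof.
move=> [LD LZ [k k0 Hk]] [MD MZ [l l0 Hl]]; split=> [u v|d u|].
- by rewrite LD MD.
- by rewrite LZ MZ.
exists (k + l); first by rewrite addr_gt0.
move=> h; rewrite nm_pair /=; have := Hk h; have := Hl h; have := nm_ge0 h.
by move=> h0 Hlh Hkh; apply/andP; split; nra.
Qed.

Lemma bl_fst V W : bounded_linear (fst : V * W -> V).
Proof.
split=> //; exists 1 => // h; rewrite mul1r.
by have := lexx (nm h); rewrite nm_pair => /andP[].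
Qed.

Lemma bl_snd V W : bounded_linear (snd : V * W -> W).
Proof.
split=> //; exists 1 => // h; rewrite mul1r.
by have := lexx (nm h); rewrite nm_pair => /andP[].
Qed.

Lemma bl_coord n i : bounded_linear (fun u : 'rV[C]_n => u 0 i : C^o).
Proof.
split=> [u v|c u|]; rewrite ?mxE //.
by exists 1 => // h; rewrite mul1r; exact: nm_coord.
Qed.

Lemma bl_row V n (L : 'I_n -> V -> C^o) : (forall i, bounded_linear (L i)) ->
  bounded_linear (fun u => \row_i L i u : 'rV[C]_n).
Proof.
move=> bL; split=> [u v|c u|].
- by apply/rowP => i; rewrite !mxE; have [-> _ _] := bL i.
- by apply/rowP => i; rewrite !mxE; have [_ -> _] := bL i.
have /choice[k Hk] : forall i, exists k : R, 0 < k /\ forall h, nm (L i h) <= k * nm h.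
  by move=> i; have [_ _ [k k0 H]] := bL i; exists k.
have S0 : 0 <= \sum_i k i by apply: sumr_ge0 => i _; apply: ltW (Hk i).1.
exists (1 + \sum_i k i); first by rewrite ltr_pwDl.
move=> h; apply/nm_row; first by rewrite mulr_ge0 ?nm_ge0 // addr_ge0.
move=> i; rewrite mxE; apply: le_trans ((Hk i).2 h) _; rewrite ler_wpM2r ?nm_ge0 //.
rewrite (bigD1 i) //= ler_wpDl // lerDl; apply: sumr_ge0 => j _; exact: ltW (Hk j).1.
Qed.

Lemma sderiv_lin V W (L : V -> W) a : bounded_linear L -> sderiv L a L.
Proof.
move=> bL; split=> // e e0; exists 1 => // u v _ _.
by rewrite blB // subrr nm0 mulr_ge0 ?nm_ge0 // ltW.
Qed.

Lemma sderiv_cst V W (c : W) (a : V) : sderiv (fun=> c) a (fun=> 0).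
Proof.
split; first exact: bl_cst0.
move=> e e0; exists 1 => // u v _ _.
by rewrite !subrr nm0 mulr_ge0 ?nm_ge0 // ltW.
Qed.

Lemma sderiv_comp U V W (f : U -> V) (g : V -> W) a L M :
  sderiv f a L -> sderiv g (f a) M -> sderiv (fun u => g (f u)) a (fun h => M (L h)).
Proof.
move=> fL gM; split; first exact: bl_comp fL.1 gM.1.
move=> e e0; have [k k0 [d d0 Hk]] := sderiv_lipschitz fL.
have [[_ _ [l l0 Hl]] Hg] := gM; have [bM _] := gM.
have [d1 d10 H1] := Hg (e / (2 * k)) (divr_gt0 e0 (mulr_gt0 (ltr0n _ 2) k0)).
have [d2 d20 H2] := fL.2 (e / (2 * l)) (divr_gt0 e0 (mulr_gt0 (ltr0n _ 2) l0)).
have [d3 d30 H3] := sderiv_continuous fL (close_ball (f a) d10).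
exists (Num.min d (Num.min d2 d3)); first by rewrite !lt_min d0 d20.
move=> u v; rewrite !lt_min => /and3P[u1 u2 u3] /and3P[v1 v2 v3].
have G := H1 (f u) (f v) (H3 u u3) (H3 v v3).
have F := H2 u v u2 v2; have K := Hk u v u1 v1.
have -> : g (f u) - g (f v) - M (L (u - v)) =
  (g (f u) - g (f v) - M (f u - f v)) + M (f u - f v - L (u - v)).
  by rewrite (blB _ (L _) bM) addrA subrK.
apply: le_trans (nmD _ _) _.
have A : e / (2 * k) * nm (f u - f v) <= e / 2 * nm (u - v).
  apply: le_trans (ler_wpM2l _ K) _; first by rewrite divr_ge0 // ltW // mulr_gt0.
  by rewrite le_eqVlt; apply/orP; left; apply/eqP; field; rewrite gt_eqF.
have B : nm (M (f u - f v - L (u - v))) <= e / 2 * nm (u - v).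
  apply: le_trans (Hl _) _; apply: le_trans (ler_wpM2l (ltW l0) F) _.
  by rewrite le_eqVlt; apply/orP; left; apply/eqP; field; rewrite gt_eqF.
by apply: le_trans (lerD (le_trans G A) B) _; rewrite -mulrDl -splitr.
Qed.

Lemma sderiv_pair U V W (f : U -> V) (g : U -> W) a L M :
  sderiv f a L -> sderiv g a M -> sderiv (fun u => (f u, g u)) a (fun h => (L h, M h)).
Proof.
move=> fL gM; split; first exact: bl_pair fL.1 gM.1.
move=> e e0; have [d1 d10 H1] := fL.2 e e0; have [d2 d20 H2] := gM.2 e e0.
exists (Num.min d1 d2); first by rewrite !lt_min d10 d20.
move=> u v; rewrite !lt_min => /andP[u1 u2] /andP[v1 v2].
by rewrite nm_pair H1 //= H2.
Qed.

Lemma sderiv_row V n (f L : 'I_n -> V -> C^o) a : (forall i, sderiv (f i) a (L i)) ->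
  sderiv (fun u => \row_i f i u : 'rV[C]_n) a (fun h => \row_i L i h).
Proof.
move=> fL; split; first by apply: bl_row => i; exact: (fL i).1.
move=> e e0.
have [d d0 H] : exists2 d : R, 0 < d & forall i u v, nm (u - a) < d -> nm (v - a) < d ->
    nm (f i u - f i v - L i (u - v)) <= e * nm (u - v).
  have /choice[d Hd] : forall i, exists d : R, 0 < d /\ forall u v, nm (u - a) < d ->
      nm (v - a) < d -> nm (f i u - f i v - L i (u - v)) <= e * nm (u - v).
    by move=> i; have [d d0 H] := (fL i).2 e e0; exists d.
  exists (\big[Num.min/1]_i d i).
    by apply: lt_bigmin => // i _; exact: (Hd i).1.
  move=> i u v /bigmin_gtP[_ u1] /bigmin_gtP[_ v1]; apply: (Hd i).2; [exact: u1|exact: v1].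
exists d => // u v ud vd; apply/nm_row; first by rewrite mulr_ge0 ?nm_ge0 // ltW.
by move=> i; rewrite !mxE; exact: H.
Qed.

Lemma sderiv_add V W (f g : V -> W) a L M : sderiv f a L -> sderiv g a M ->
  sderiv (fun u => f u + g u) a (fun h => L h + M h).
Proof.
move=> fL gM.
have bA : bounded_linear (fun x : W * W => x.1 + x.2).
  by apply: bl_add; [exact: bl_fst|exact: bl_snd].
exact: (sderiv_comp (sderiv_pair fL gM) (sderiv_lin _ bA)).
Qed.

Lemma sderiv_scale V W c (f : V -> W) a L : sderiv f a L ->
  sderiv (fun u => c *: f u) a (fun h => c *: L h).
Proof. by move=> fL; apply: (sderiv_comp fL (sderiv_lin _ (bl_scale c (@bl_id W)))). Qed.

Lemma sderiv_sum V W (I : Type) (r : seq I) (f L : I -> V -> W) a :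
  (forall i, sderiv (f i) a (L i)) ->
  sderiv (fun u => \sum_(i <- r) f i u) a (fun h => \sum_(i <- r) L i h).
Proof.
move=> H; elim: r => [|i r IH].
  by have := sderiv_cst (0 : W) a; congr sderiv; apply/funext => u; rewrite big_nil.
by have := sderiv_add (H i) IH; congr sderiv; apply/funext => u; rewrite big_cons.
Qed.

Lemma sderiv_prod2 (a : C^o * C^o) : sderiv (fun x : C^o * C^o => x.1 * x.2 : C^o) a
  (fun h => a.1 * h.2 + a.2 * h.1 : C^o).
Proof.
have bl : bounded_linear (fun h : C^o * C^o => a.1 * h.2 + a.2 * h.1 : C^o).
  by apply: bl_add; apply: (@bl_scale _ C^o); [exact: bl_snd|exact: bl_fst].
split=> // e e0; exists (e / 2); first by rewrite divr_gt0.
move=> u v; rewrite !nm_pair_lt /= => /andP[u1 u2] /andP[v1 v2].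
have -> : u.1 * u.2 - v.1 * v.2 - (a.1 * (u.2 - v.2) + a.2 * (u.1 - v.1)) =
   (u.1 - a.1) * (u.2 - v.2) + (v.2 - a.2) * (u.1 - v.1) by ring.
apply: le_trans (nmD _ _) _; rewrite !nmM.
have := lexx (nm (u - v)); rewrite nm_pair /= => /andP[l1 l2].
have := nm_ge0 (u.1 - v.1); have := nm_ge0 (u.2 - v.2).
have := nm_ge0 (u.1 - a.1); have := nm_ge0 (v.2 - a.2).
move=> n1 n2 n3 n4.
have A : nm (u.1 - a.1) * nm (u.2 - v.2) <= e / 2 * nm (u - v).
  by apply: ler_pM => //; exact: ltW.
have B : nm (v.2 - a.2) * nm (u.1 - v.1) <= e / 2 * nm (u - v).
  by apply: ler_pM => //; exact: ltW.
by apply: le_trans (lerD A B) _; rewrite -mulrDl -splitr.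
Qed.

Lemma sderivM V (f g : V -> C^o) a L M : sderiv f a L -> sderiv g a M ->
  sderiv (fun u => f u * g u : C^o) a (fun h => f a * M h + g a * L h : C^o).
Proof. by move=> fL gM; exact: (sderiv_comp (sderiv_pair fL gM) (sderiv_prod2 _)). Qed.

Lemma sderivX V (f : V -> C^o) a L n : sderiv f a L ->
  sderiv (fun u => f u ^+ n : C^o) a (fun h => n%:R * f a ^+ n.-1 * L h : C^o).
Proof.
move=> fL; elim: n => [|n IH].
  have := sderiv_cst (1 : C^o) a; congr sderiv; apply/funext => u; rewrite ?expr0 //.
  by rewrite !mul0r.
have := sderivM fL IH; congr sderiv; apply/funext => h; first by rewrite exprS.
rewrite /=; case: n {IH} => [|n]; first by rewrite expr0 !mul0r mulr0 add0r; ring.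
by rewrite /= !exprS; ring.
Qed.

Lemma sholo_lin V W (L : V -> W) a : bounded_linear L -> sholo L a.
Proof. by move=> bL; exists 1 => // u _; exists L; exact: sderiv_lin. Qed.

Lemma sholo_cst V W (c : W) (a : V) : sholo (fun=> c) a.
Proof. by exists 1 => // u _; exists (fun=> 0); exact: sderiv_cst. Qed.

Lemma sholo_comp U V W (f : U -> V) (g : V -> W) a :
  sholo f a -> sholo g (f a) -> sholo (fun u => g (f u)) a.
Proof.
move=> sf sg; apply: closeS (closeI sf (sholo_continuous sf sg)) => u [[L fL] [M gM]].
by exists (fun h => M (L h)); exact: sderiv_comp fL gM.
Qed.

Lemma sholo_pair U V W (f : U -> V) (g : U -> W) a :
  sholo f a -> sholo g a -> sholo (fun u => (f u, g u)) a.
Proof.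
move=> sf sg; apply: closeS (closeI sf sg) => u [[L fL] [M gM]].
by exists (fun h => (L h, M h)); exact: sderiv_pair fL gM.
Qed.

Lemma sholo_add V W (f g : V -> W) a :
  sholo f a -> sholo g a -> sholo (fun u => f u + g u) a.
Proof.
move=> sf sg; apply: closeS (closeI sf sg) => u [[L fL] [M gM]].
by exists (fun h => L h + M h); exact: sderiv_add fL gM.
Qed.

Lemma sholo_scale V W c (f : V -> W) a : sholo f a -> sholo (fun u => c *: f u) a.
Proof.
move=> sf; apply: closeS sf => u [L fL].
by exists (fun h => c *: L h); exact: sderiv_scale.
Qed.

Lemma sholoM V (f g : V -> C^o) a :
  sholo f a -> sholo g a -> sholo (fun u => f u * g u : C^o) a.
Proof.
move=> sf sg; apply: closeS (closeI sf sg) => u [[L fL] [M gM]].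
by exists (fun h => f u * M h + g u * L h : C^o); exact: sderivM fL gM.
Qed.

Lemma sholoX V (f : V -> C^o) a n : sholo f a -> sholo (fun u => f u ^+ n : C^o) a.
Proof.
move=> sf; apply: closeS sf => u [L fL].
by exists (fun h => n%:R * f u ^+ n.-1 * L h : C^o); exact: sderivX.
Qed.

(** A strict derivative is a Frechet derivative: one of the two points in the estimate is fixed at
    the center. *)
Lemma sholo_holomorphic V W (f : V -> W) a : sholo f a -> holomorphic_at f a.
Proof.
move=> sf; apply/closeP; apply: closeS sf => x [L [[LD LZ [k k0 Hk]] H]] {a}.
have LL : linear L by move=> c u v; rewrite LD LZ.
pose LM := GRing.isLinear.Build C V W *:%R L LL.
pose Lh : {linear V -> W} := HB.pack L LM.
have cL : continuous Lh.
  move=> u B /closeP[e e0 HB]; apply/closeP; exists (e / k); first by rewrite divr_gt0.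
  move=> v vu; apply: HB; rewrite -linearB; apply: le_lt_trans (Hk _) _.
  by rewrite mulrC -ltr_pdivlMr.
suff Lo : f \o shift x = cst (f x) + Lh +o_ 0 id.
  by apply/diff_locallyP; rewrite (diff_unique cL Lo).
apply/eqaddoP => e e0; apply/closeP.
have e0' : 0 < complex.Re e by move: e0; case: e => a b; rewrite ltcE /= => /andP[].
have eE : e = (complex.Re e)%:C.
  by move: e0; case: e {e0'} => a b; rewrite ltcE /= => /andP[/eqP -> _].
have [d d0 Hd] := H _ e0'; exists d => // u ud.
rewrite /= eE !nmE -rmorphM /= lecR; rewrite subr0 in ud.
have := Hd (u + x) x; rewrite addrK subrr nm0 => /(_ ud d0).
by congr (nm _ <= _); rewrite -addrA -opprD.
Qed.

End StrictDerivative.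

(** * Completeness and the contraction argument *)

Section InverseFunction.
Variable R : realType.
Local Notation C := R[i].
Implicit Types (U V W : normedModType C).
Local Notation half := (2^-1 : R).

Lemma half_gt0 : 0 < half. Proof. by rewrite invr_gt0. Qed.

Lemma le_geometric_limit (x y K : R) : (forall n : nat, x <= y + K * half ^+ n) -> x <= y.
Proof.
move=> H; have [//|yx] := leP x y; have Kx := H 0%N; rewrite expr0 mulr1 in Kx.
have d0 : 0 < x - y by rewrite subr_gt0.
have K0 : 0 < K by lra.
have [n Kn] : exists n : nat, K / (x - y) < n%:R.
  by exists (Num.bound (K / (x - y))); rewrite archi_boundP // divr_ge0 // ltW.
have n2 : n%:R < 2 ^+ n :> R by rewrite -natrX ltr_nat ltn_expl.
have := H n; rewrite exprVn.
have p0 : 0 < 2 ^+ n :> R by rewrite exprn_gt0.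
have : K / 2 ^+ n < x - y.
  by rewrite ltr_pdivrMr // mulrC -ltr_pdivrMr //; apply: lt_trans n2.
lra.
Qed.

(** Completeness for sequences with geometrically small increments, which is all that a contraction
    with factor 1/2 requires. It passes from [R] to the complex numbers, pairs and row vectors. *)
Definition gcomplete V := forall (u : nat -> V) (M : R),
  (forall n, nm (u n.+1 - u n) <= M * half ^+ n) ->
  exists l K, forall n, nm (u n - l) <= K * half ^+ n.

(** Nested intervals: the intervals of radius 2 M / 2^n around r n decrease, and the supremum of
    their left ends lies in each of them. *)
Lemma gcomplete_real (r : nat -> R) (M : R) :
  (forall n, `|r n.+1 - r n| <= M * half ^+ n) ->
  exists l, forall n, `|r n - l| <= 2 * M * half ^+ n.
Proof.
move=> H; pose lo n := r n - 2 * M * half ^+ n; pose hi n := r n + 2 * M * half ^+ n.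
have p0 n : 0 < half ^+ n by rewrite exprn_gt0 // half_gt0.
have M0 : 0 <= M by have := H 0%N; rewrite expr0 mulr1; apply: le_trans.
have step n : lo n <= lo n.+1 /\ hi n.+1 <= hi n.
  have := H n; rewrite ler_norml => /andP[h1 h2].
  rewrite /lo /hi !exprS; have := p0 n; split; lra.
have lohi n : lo n <= hi n.
  by rewrite /lo /hi; have := mulr_ge0 M0 (ltW (p0 n)); lra.
have lo_mono m n : (m <= n)%N -> lo m <= lo n.
  by move=> /subnKC <-; elim: (n - m)%N => [|k IH]; rewrite ?addn0 // addnS (le_trans IH) // (step _).1.
have hi_mono m n : (m <= n)%N -> hi n <= hi m.
  by move=> /subnKC <-; elim: (n - m)%N => [|k IH]; rewrite ?addn0 // addnS (le_trans _ IH) // (step _).2.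
have cross m n : lo m <= hi n.
  have [mn|nm] := leqP m n; first by apply: le_trans (lo_mono _ _ mn) _.
  by apply: le_trans (lohi _) (hi_mono _ _ (ltnW nm)).
exists (sup (range lo)) => n.
have ub m : ubound (range lo) (hi m) by move=> _ [k _ <-]; exact: cross.
have l1 : lo n <= sup (range lo).
  by apply: ub_le_sup; [exists (hi 0%N)|exists n].
have l2 : sup (range lo) <= hi n by apply: ge_sup => //; exists (lo 0%N); exists 0%N.
by move: l1 l2; rewrite ler_norml /lo /hi => l1 l2; apply/andP; split; lra.
Qed.

Lemma nm_Re_Im (z : C^o) : [/\ `|complex.Re z| <= nm z, `|complex.Im z| <= nm z &
  nm z <= `|complex.Re z| + `|complex.Im z|].
Proof.
case: z => a b /=.
have -> : nm ((a +i* b)%C : C^o) = Num.sqrt (a ^+ 2 + b ^+ 2).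
  by transitivity (complex.Re `|(a +i* b)%C : C|); rewrite // normc_def.
have e : Num.sqrt (a ^+ 2 + b ^+ 2) ^+ 2 = `|a| ^+ 2 + `|b| ^+ 2.
  by rewrite sqr_sqrtr ?addr_ge0 ?sqr_ge0 // !real_normK // num_real.
have s0 := sqrtr_ge0 (a ^+ 2 + b ^+ 2).
have := normr_ge0 a; have := normr_ge0 b; move: e s0.
move: (Num.sqrt _) (`|a|) (`|b|) => s p q e s0 q0 p0; split.
- by rewrite -(ler_pXn2r (ltn0Sn 1)) ?nnegrE // e lerDl sqr_ge0.
- by rewrite -(ler_pXn2r (ltn0Sn 1)) ?nnegrE // e lerDr sqr_ge0.
- rewrite -(ler_pXn2r (ltn0Sn 1)) ?nnegrE // ?addr_ge0 // e.
  by have := mulr_ge0 p0 q0; lra.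
Qed.

Lemma gcomplete_complex : gcomplete C^o.
Proof.
move=> u M H.
have [|a Ha] := @gcomplete_real (fun n => complex.Re (u n)) M.
  move=> n; have [h _ _] := nm_Re_Im (u n.+1 - u n); apply: le_trans (H n).
  by rewrite -raddfB.
have [|b Hb] := @gcomplete_real (fun n => complex.Im (u n)) M.
  move=> n; have [_ h _] := nm_Re_Im (u n.+1 - u n); apply: le_trans (H n).
  by rewrite -raddfB.
exists (a +i* b)%C, (4 * M) => n.
have [_ _ h] := nm_Re_Im (u n - (a +i* b)%C); apply: le_trans h _.
rewrite !raddfB /=; have := Ha n; have := Hb n; lra.
Qed.

Lemma gcomplete_pair V W : gcomplete V -> gcomplete W -> gcomplete (V * W)%type.
Proof.
move=> cV cW u M H.
have H' n : nm ((u n.+1).1 - (u n).1) <= M * half ^+ n /\ nm ((u n.+1).2 - (u n).2) <= M * half ^+ n.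
  by have := H n; rewrite nm_pair => /andP[].
have [l [K Hl]] := cV _ _ (fun n => (H' n).1).
have [l' [K' Hl']] := cW _ _ (fun n => (H' n).2).
have p0 n : 0 <= half ^+ n by rewrite exprn_ge0 // ltW // half_gt0.
have K0 : 0 <= K by have := Hl 0%N; rewrite expr0 mulr1; apply: le_trans; exact: nm_ge0.
have K0' : 0 <= K' by have := Hl' 0%N; rewrite expr0 mulr1; apply: le_trans; exact: nm_ge0.
exists (l, l'), (K + K') => n; rewrite nm_pair mulrDl /=; apply/andP; split.
  by rewrite (le_trans (Hl n)) // lerDl mulr_ge0.
by rewrite (le_trans (Hl' n)) // lerDr mulr_ge0.
Qed.

Lemma gcomplete_row n : gcomplete 'rV[C]_n.
Proof.
move=> u M H.
have /choice[lK HlK] : forall i, exists lK : C^o * R, forall k, nm (u k 0 i - lK.1 : C^o) <= lK.2 * half ^+ k.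
  move=> i; have [|l [K HK]] := @gcomplete_complex (fun k => u k 0 i) M; last by exists (l, K).
  by move=> k; apply: le_trans (H k); have := nm_coord (u k.+1 - u k) i; rewrite !mxE.
have p0 k : 0 <= half ^+ k by rewrite exprn_ge0 // ltW // half_gt0.
have K0 i : 0 <= (lK i).2.
  by have := HlK i 0%N; rewrite expr0 mulr1; apply: le_trans; exact: nm_ge0.
exists (\row_i (lK i).1), (\sum_i (lK i).2) => k; apply/nm_row.
  by rewrite mulr_ge0 // sumr_ge0.
move=> i; rewrite !mxE; apply: le_trans (HlK i k) _; rewrite ler_wpM2r //.
by rewrite (bigD1 i) //= lerDl sumr_ge0.
Qed.

(* The sequence u' = u - L' (f u - y) is a contraction. *)
Lemma approx_solve V W (f L : V -> W) (L' : W -> V) (a : V) (c d : R) :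
  gcomplete V -> 0 < c -> 0 < d ->
  (forall u v, L' (u - v) = L' u - L' v) -> (forall w, nm (L' w) <= c * nm w) ->
  (forall u, L' (L u) = u) -> (forall w, L (L' w) = w) -> L 0 = 0 ->
  (forall u v, nm (u - a) < d -> nm (v - a) < d ->
     nm (f u - f v - L (u - v)) <= (2 * c)^-1 * nm (u - v)) ->
  forall y, nm (y - f a) < d / (4 * c) -> exists2 x, nm (x - a) < d & f x = y.
Proof.
move=> cV c0 d0 LB Lc LK LK' L0 H y yd.
pose N u := u - L' (f u - y).
have NB u v : nm (u - a) < d -> nm (v - a) < d -> nm (N u - N v) <= half * nm (u - v).
  move=> ud vd; have -> : N u - N v = - L' (f u - f v - L (u - v)).
    rewrite LB LK /N !LB !opprB [_ - _ - v]addrC addrACA [X in _ + X]addrC.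
    by rewrite [X in _ + X = _]addrA subrK.
  rewrite nmN; apply: le_trans (Lc _) _; apply: le_trans (ler_wpM2l (ltW c0) (H u v ud vd)) _.
  by rewrite mulrA invfM mulrCA mulfV ?gt_eqF // mulr1.
pose u n := iter n N a.
have h0 n : 0 < half ^+ n by rewrite exprn_gt0 // half_gt0.
have inv n : nm (u n - a) <= d / 2 * (1 - half ^+ n) /\ nm (u n.+1 - u n) <= d / 4 * half ^+ n.
  elim: n => [|n [IH1 IH2]].
    rewrite !expr0 (subrr a) (subrr 1) mulr0 mulr1 nm0; split=> //=.
    rewrite /N addrAC subrr add0r nmN; apply: le_trans (Lc _) _.
    rewrite mulrC -ler_pdivlMr // nmC; apply: le_trans (ltW yd) _.
    by rewrite invfM mulrA.
  have A : nm (u n.+1 - a) <= d / 2 * (1 - half ^+ n.+1).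
    apply: le_trans (nm_trans (u n) _ _) _; rewrite exprS.
    by have := mulr_gt0 d0 (h0 n); lra.
  split=> //.
  have B : nm (u n - a) < d by have := mulr_gt0 d0 (h0 n); lra.
  have D : nm (u n.+1 - a) < d by have := mulr_gt0 d0 (h0 n.+1); lra.
  by apply: le_trans (NB _ _ D B) _; rewrite exprS; lra.
have [l [K HK]] := cV u (d / 4) (fun n => (inv n).2).
have ld : nm (l - a) <= d / 2.
  apply: (@le_geometric_limit _ _ K) => n; apply: le_trans (nm_trans (u n) _ _) _.
  rewrite addrC nmC [X in _ + X <= _]nmC.
  by have := (inv n).1; have := HK n; rewrite nmC [nm (a - _)]nmC; have := mulr_gt0 d0 (h0 n); lra.
have ld' : nm (l - a) < d by lra.
have Nl : N l = l.
  apply/eqP; rewrite -subr_eq0; apply/eqP/nm_eq0.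
  apply: (@le_geometric_limit _ _ K) => n; rewrite add0r.
  apply: le_trans (nm_trans (u n.+1) _ _) _; have := HK n; have := HK n.+1.
  have ud : nm (u n - a) < d by have := (inv n).1; have := mulr_gt0 d0 (h0 n); lra.
  by have := NB l (u n) ld' ud; rewrite (nmC l) exprS /=; lra.
exists l => //; apply/eqP; rewrite -subr_eq0; apply/eqP; rewrite -(LK' (f l - y)).
suff -> : L' (f l - y) = 0 by [].
by apply/eqP; rewrite -oppr_eq0 -(inj_eq (addrI l)) addr0; apply/eqP.
Qed.

End InverseFunction.

(** * The inverse function theorem *)

Section InverseFunctionTheorem.
Variable R : realType.
Local Notation C := R[i].
Variables (V W : normedModType C) (f L : V -> W) (L' : W -> V) (a : V).
Hypothesis cV : gcomplete V.
Hypothesis fL : sderiv f a L.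
Hypothesis bL' : bounded_linear L'.
Hypothesis LK : forall u, L' (L u) = u.
Hypothesis LK' : forall w, L (L' w) = w.

Section Ball.
Variables c d : R.
Hypotheses (c0 : 0 < c) (d0 : 0 < d).
Hypothesis Lc : forall w, nm (L' w) <= c * nm w.
Hypothesis H : forall u v, nm (u - a) < d -> nm (v - a) < d ->
  nm (f u - f v - L (u - v)) <= (2 * c)^-1 * nm (u - v).

Let bL : bounded_linear L := fL.1.

Let cc2 : c * (2 * c)^-1 = 2^-1.
Proof. by rewrite invfM mulrCA mulfV ?gt_eqF // mulr1. Qed.

(** [L] stretches distances by at least 1/c, and the perturbation takes away at most half of
    this. *)
Let lower (A : V -> W) u v : nm (A u - A v - L (u - v)) <= (2 * c)^-1 * nm (u - v) ->
  nm (u - v) <= 2 * c * nm (A u - A v).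
Proof.
move=> HA; have := nm_trans (A u - A v) 0 (L (u - v)); rewrite !sub0r !nmN.
have := Lc (L (u - v)); rewrite LK => h1.
have := ler_wpM2l (ltW c0) HA; rewrite mulrA cc2 => h2 h3.
by have := ler_wpM2l (ltW c0) h3; rewrite mulrDr; lra.
Qed.

Let bilip u v : nm (u - a) < d -> nm (v - a) < d -> nm (u - v) <= 2 * c * nm (f u - f v).
Proof. by move=> ud vd; exact/lower/H. Qed.

Let g (y : W) : V := xget a [set x | nm (x - a) < d /\ f x = y].

Let gK y : nm (y - f a) < d / (4 * c) -> nm (g y - a) < d /\ f (g y) = y.
Proof.
move=> yd; apply: (@xgetPex _ a [set x | nm (x - a) < d /\ f x = y]).
have [|x xd xy] := @approx_solve R V W f L L' a c d cV c0 d0 _ Lc LK LK' (bl0 bL) H y yd.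
  by move=> u v; exact: blB.
by exists x.
Qed.

Let fK x : nm (x - a) < d -> g (f x) = x.
Proof.
move=> xd.
have [gd gf] := @xgetPex _ a [set z | nm (z - a) < d /\ f z = f x] (ex_intro _ x (conj xd erefl)).
apply/eqP; rewrite -subr_eq0; apply/eqP/nm_eq0.
by apply: le_trans (bilip gd xd) _; rewrite gf subrr nm0 mulr0.
Qed.

(** The error of g is minus [M] applied to the error of f at the points g u and g v; the Lipschitz
    bound for g turns nm (g u - g v) into nm (u - v). *)
Let inverse_deriv y Lx M : nm (y - f a) < d / (4 * c) -> sderiv f (g y) Lx ->
  bounded_linear M -> (forall u, M (Lx u) = u) -> sderiv g y M.
Proof.
move=> yd [bLx Hx] bM MK; split=> // e e0; have [_ _ [m m0 Hm]] := bM.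
have [r r0 Hr] := Hx (e / (m * (2 * c))) (divr_gt0 e0 (mulr_gt0 m0 (mulr_gt0 (ltr0n _ 2) c0))).
exists (Num.min (d / (4 * c) - nm (y - f a)) (r / (2 * c))).
  by rewrite lt_min subr_gt0 yd divr_gt0 // mulr_gt0.
have near z : nm (z - y) < d / (4 * c) - nm (y - f a) -> nm (z - f a) < d / (4 * c).
  by move=> zd; apply: le_lt_trans (nm_trans y _ _) _; lra.
have [gyd gyK] := gK yd.
move=> u v; rewrite !lt_min => /andP[/near /gK[gu fu] u2] /andP[/near/gK[gv fv] v2].
have lip z : nm (g z - a) < d -> f (g z) = z -> nm (z - y) < r / (2 * c) -> nm (g z - g y) < r.
  move=> gz fz zr; apply: le_lt_trans (bilip gz gyd) _.
  by rewrite fz gyK mulrC -ltr_pdivlMr // mulr_gt0.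
have := Hr _ _ (lip u gu fu u2) (lip v gv fv v2).
rewrite fu fv => K.
have -> : g u - g v - M (u - v) = - M (u - v - Lx (g u - g v)).
  by rewrite (blB (u - v) _ bM) MK opprB.
rewrite nmN; apply: le_trans (Hm _) _; apply: le_trans (ler_wpM2l (ltW m0) K) _.
have := bilip gu gv; rewrite fu fv => B.
have p : 0 <= m * (e / (m * (2 * c))).
  by apply/mulr_ge0/divr_ge0; rewrite ltW // !mulr_gt0.
have -> : e * nm (u - v) = m * (e / (m * (2 * c))) * (2 * c * nm (u - v)).
  by field; rewrite !gt_eqF.
by rewrite [leLHS]mulrA; exact: (ler_wpM2l p B).
Qed.

(** Both estimates, of f against [L] on the ball and of f against [Lx] near x, are applied to a
    small multiple of [h], and the result is rescaled. *)
Let deriv_close x Lx h : nm (x - a) < d -> sderiv f x Lx ->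
  nm (Lx h - L h) <= (2 * c)^-1 * nm h.
Proof.
move=> xd [bLx Hx]; apply: (@le_geometric_limit _ _ _ (nm h)) => n.
have e0 : 0 < 2^-1 ^+ n :> R by rewrite exprn_gt0 // half_gt0.
have [r r0 Hr] := Hx _ e0.
have xd' : 0 < d - nm (x - a) by rewrite subr_gt0.
pose rho := Num.min r (d - nm (x - a)).
have rho0 : 0 < rho by rewrite lt_min r0.
have h1 : 0 < nm h + 1 by rewrite ltr_wpDl // nm_ge0.
pose t := rho / (nm h + 1); have t0 : 0 < t by rewrite divr_gt0.
have nt (w : V) : nm (t%:C *: w) = t * nm w by rewrite nmZ nm_real // ltW.
have nt' (w : W) : nm (t%:C *: w) = t * nm w by rewrite nmZ nm_real // ltW.
have small : nm (t%:C *: h) < rho.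
  by rewrite nt /t mulrAC ltr_pdivrMr // ltr_pM2l // ltrDl.
move: small; rewrite lt_min => /andP[s1 s2].
have y1 : nm (x + t%:C *: h - x) < r by rewrite addrAC subrr add0r.
have y2 : nm (x + t%:C *: h - a) < d.
  by apply: le_lt_trans (nm_trans x _ _) _; rewrite addrAC subrr add0r; lra.
have x1 : nm (x - x) < r by rewrite subrr nm0.
have A := Hr _ _ y1 x1; have B := H y2 xd.
have xt : x + t%:C *: h - x = t%:C *: h by rewrite addrAC subrr add0r.
rewrite xt in A B; have [_ LZ _] := bL; have [_ LxZ _] := bLx.
rewrite -(ler_pM2l t0) -nt' scalerBr -LZ -LxZ mulrDr [t * (nm h * _)]mulrA mulrCA -nt.
move: A B; set p := f _; set q := f x; set k := t%:C *: h => A B.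
have -> : Lx k - L k = (p - q - L k) - (p - q - Lx k).
  by rewrite opprB [RHS]addrC addrA subrK.
by apply: le_trans (nmB _ _) _; rewrite [nm k * _]mulrC; exact: lerD B A.
Qed.

(** [Lx] is itself a perturbation of [L] by at most half, so [lower] gives its injectivity and
    [approx_solve] its surjectivity. *)
Let deriv_inverse x Lx : nm (x - a) < d -> sderiv f x Lx ->
  exists M, bounded_linear M /\ forall u, M (Lx u) = u.
Proof.
move=> xd fLx; have bLx := fLx.1.
have Hc u v : nm (Lx u - Lx v - L (u - v)) <= (2 * c)^-1 * nm (u - v).
  by rewrite -(blB _ _ bLx); exact: deriv_close fLx.
have inj u v : Lx u = Lx v -> u = v.
  move=> e; apply/eqP; rewrite -subr_eq0; apply/eqP/nm_eq0.
  by apply: le_trans (lower (Hc u v)) _; rewrite e subrr nm0 mulr0.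
have /choice[M HM] : forall y, exists x, Lx x = y.
  (* The radius is such that the ball of solvable values, of radius nm y + 1, contains y. *)
  move=> y; have n1 : 0 < 4 * c * (nm y + 1) by rewrite !mulr_gt0 // ltr_wpDl // nm_ge0.
  have [|||z _ zy] := @approx_solve R V W Lx L L' 0 c _ cV c0 n1 _ Lc LK LK' (bl0 bL) _ y.
  - by move=> u v; exact: blB.
  - by move=> u v _ _; exact: Hc.
  - rewrite (bl0 bLx) subr0 mulrC mulKf ?ltrDl //.
    by rewrite gt_eqF // mulr_gt0.
  - by exists z.
exists M; split; last by move=> u; apply: inj; rewrite HM.
have [LxD LxZ _] := bLx; split=> [u v|k u|].
- by apply: inj; rewrite LxD !HM.
- by apply: inj; rewrite LxZ !HM.
exists (2 * c); first by rewrite mulr_gt0.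
by move=> y; have := lower (Hc (M y) 0); rewrite (bl0 bLx) !subr0 HM.
Qed.

Lemma inverse_function_ball : (forall u, nm (u - a) < d -> exists Lu, sderiv f u Lu) ->
  exists g : W -> V, [/\ g (f a) = a, sholo g (f a), sderiv g (f a) L',
    close (f a) (fun y => f (g y) = y) & close a (fun x => g (f x) = x)].
Proof.
move=> sf; have ga : g (f a) = a by apply: fK; rewrite subrr nm0.
have r0 : 0 < d / (4 * c) by rewrite divr_gt0 // mulr_gt0.
exists g; split=> //.
- exists (d / (4 * c)) => // y yd; have [gd gf] := gK yd.
  have [Lx fLx] := sf _ gd; have [M [bM MK]] := deriv_inverse gd fLx.
  by exists M; exact: inverse_deriv fLx bM MK.
- by apply: inverse_deriv bL' LK; rewrite ?ga // subrr nm0.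
- by exists (d / (4 * c)) => // y /gK[].
- by exists d.
Qed.

End Ball.

Theorem inverse_function : sholo f a ->
  exists g : W -> V, [/\ g (f a) = a, sholo g (f a), sderiv g (f a) L',
    close (f a) (fun y => f (g y) = y) & close a (fun x => g (f x) = x)].
Proof.
move=> [d1 d10 sf]; have [_ _ [c c0 Lc]] := bL'; have [_ Hf] := fL.
have c2 : 0 < (2 * c)^-1 by rewrite invr_gt0 mulr_gt0.
have [d2 d20 H] := Hf _ c2.
apply: (@inverse_function_ball c (Num.min d1 d2)) => //.
- by rewrite lt_min d10.
- by move=> u v; rewrite !lt_min => /andP[_ u2] /andP[_ v2]; exact: H.
- by move=> u; rewrite lt_min => /andP[u1 _]; exact: sf.
Qed.

End InverseFunctionTheorem.

(** * Local factorization of a family of polynomials *)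

Section Hensel.
Variable R : realType.
Local Notation C := R[i].
Implicit Types (V W : normedModType C).

Lemma sholo_sum V W (I : Type) (r : seq I) (f : I -> V -> W) a :
  (forall i, sholo (f i) a) -> sholo (fun u => \sum_(i <- r) f i u) a.
Proof.
move=> H; elim: r => [|i r IH].
  by have := sholo_cst (0 : W) a; congr sholo; apply/funext => u; rewrite big_nil.
by have := sholo_add (H i) IH; congr sholo; apply/funext => u; rewrite big_cons.
Qed.

Lemma bl_lsubmx m r : bounded_linear (lsubmx : 'rV[C]_(m + r) -> 'rV[C]_m).
Proof.
have := @bl_row R 'rV[C]_(m + r) m (fun i u => u 0 (lshift r i)) (fun i => bl_coord R (lshift r i)).
by congr bounded_linear; apply/funext => u; apply/rowP => i; rewrite !mxE.
Qed.

Lemma bl_rsubmx m r : bounded_linear (rsubmx : 'rV[C]_(m + r) -> 'rV[C]_r).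
Proof.
have := @bl_row R 'rV[C]_(m + r) r (fun i u => u 0 (rshift m i)) (fun i => bl_coord R (rshift m i)).
by congr bounded_linear; apply/funext => u; apply/rowP => i; rewrite !mxE.
Qed.

Lemma bl_mulmx m n (B : 'M[C]_(m, n)) : bounded_linear (fun u : 'rV[C]_m => u *m B).
Proof.
have bs V (I : Type) (s : seq I) (L : I -> V -> C^o) : (forall i, bounded_linear (L i)) ->
    bounded_linear (fun u => \sum_(i <- s) L i u).
  move=> bL; have := sderiv_sum s (fun i => sderiv_lin 0 (bL i)).
  by case.
have := @bl_row R 'rV[C]_m n (fun j u => \sum_i B i j *: (u 0 i : C^o)) (fun j => bs _ _ _ _
  (fun i => bl_scale (B i j) (bl_coord R i))).
congr bounded_linear; apply/funext => u; apply/rowP => i; rewrite !mxE.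
by apply: eq_bigr => j _; exact: mulrC.
Qed.

Lemma bl_injective_inverse n (L : 'rV[C]_n -> 'rV[C]_n) : bounded_linear L ->
  (forall h, L h = 0 -> h = 0) ->
  exists L', [/\ bounded_linear L', forall u, L' (L u) = u & forall w, L (L' w) = w].
Proof.
move=> bL inj; have [LD LZ _] := bL.
have LL : linear L by move=> c u v; rewrite LD LZ.
pose LM := GRing.isLinear.Build C 'rV[C]_n 'rV[C]_n *:%R L LL.
pose Lh : {linear 'rV[C]_n -> 'rV[C]_n} := HB.pack L LM.
have LE u : L u = u *m lin1_mx Lh by rewrite mul_rV_lin1.
have uA : lin1_mx Lh \in unitmx.
  rewrite -row_free_unit -kermx_eq0; apply/rowV0P => v /sub_kermxP vA.
  by apply: inj; rewrite LE.
exists (fun w => w *m invmx (lin1_mx Lh)); split=> [|u|w].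
- exact: bl_mulmx.
- by rewrite LE mulmxK.
- by rewrite LE mulmxKV.
Qed.

Lemma bl_rVpoly n i : bounded_linear (fun u : 'rV[C]_n => (rVpoly u)`_i : C^o).
Proof.
case: (insubP 'I_n i) => [j _ ji|nj].
  have := @bl_coord R n j; congr bounded_linear; apply/funext => u.
  by rewrite coef_rVpoly; case: insubP => [k _ ki|]; [congr (u 0 _); apply/val_inj; rewrite /= ki ji|
    rewrite -ji ltn_ord].
have := @bl_cst0 R 'rV[C]_n C^o; congr bounded_linear; apply/funext => u.
by rewrite coef_rVpoly insubF //; apply/negbTE.
Qed.

Lemma horner_rVpoly_sum n (u : 'rV[C]_n) (w : C) :
  (rVpoly u).[w] = \sum_(i < n) u 0 i * w ^+ i.
Proof.
rewrite horner_poly; apply: eq_bigr => i _; congr (_ * _).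
by rewrite valK.
Qed.

Lemma sholo_horner V n (k : V -> 'rV[C]_n) (f : V -> C^o) a : sholo k a -> sholo f a ->
  sholo (fun q => (rVpoly (k q)).[f q] : C^o) a.
Proof.
move=> sk sf.
have -> : (fun q => (rVpoly (k q)).[f q] : C^o) = (fun q => \sum_(i < n) k q 0 i * f q ^+ i : C^o).
  by apply/funext => q; rewrite horner_rVpoly_sum.
apply: sholo_sum => i; apply: sholoM; last exact: sholoX.
exact: (sholo_comp sk (sholo_lin _ (bl_coord R i))).
Qed.

Section Factorization.
Variables (m r : nat).

(** Multiplication of a monic polynomial of degree m by a cofactor of size at most r, on coefficient
    vectors; both sides have dimension m + r. *)
Let f (u : 'rV[C]_(m + r)) : 'rV[C]_(m + r) :=
  poly_rV (('X^m + rVpoly (lsubmx u)) * rVpoly (rsubmx u)).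

Let Df (a h : 'rV[C]_(m + r)) : 'rV[C]_(m + r) :=
  poly_rV (('X^m + rVpoly (lsubmx a)) * rVpoly (rsubmx h) + rVpoly (lsubmx h) * rVpoly (rsubmx a)).

Let fD a : sderiv f a (Df a).
Proof.
have lc i : sderiv (fun u : 'rV[C]_(m + r) => ('X^m + rVpoly (lsubmx u))`_i : C^o) a
    (fun h => (rVpoly (lsubmx h))`_i).
  have := sderiv_add (sderiv_cst ('X^m`_i : C^o) a)
     (sderiv_lin a (bl_comp (@bl_lsubmx m r) (@bl_rVpoly m i))).
  by congr sderiv; apply/funext => u; rewrite ?coefD ?add0r.
have rc i : sderiv (fun u : 'rV[C]_(m + r) => (rVpoly (rsubmx u))`_i : C^o) a
    (fun h => (rVpoly (rsubmx h))`_i).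
  exact: sderiv_lin (bl_comp (@bl_rsubmx m r) (@bl_rVpoly r i)).
have := @sderiv_row R _ _ (fun (j : 'I_(m + r)) u => \sum_(i < j.+1)
     ('X^m + rVpoly (lsubmx u))`_i * (rVpoly (rsubmx u))`_(j - i) : C^o) _ a
  (fun j => sderiv_sum _ (fun i : 'I_j.+1 => sderivM (lc i) (rc (j - i)%N))).
congr sderiv; apply/funext => u; apply/rowP => j; rewrite !mxE ?coefM //.
rewrite coefD !coefM -big_split; apply: eq_bigr => i _ /=; congr (_ + _).
exact: mulrC.
Qed.

Let sizeP (t : 'rV[C]_m) (k : 'rV[C]_r) :
  (size (('X^m + rVpoly t) * rVpoly k)%R <= m + r)%N.
Proof.
apply: leq_trans (size_polyMleq _ _) _.
have : (size ('X^m + rVpoly t)%R <= m.+1)%N.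
  apply: leq_trans (size_polyD _ _) _; rewrite geq_max size_polyXn leqnn.
  by apply: leq_trans (size_poly _ _) _.
have : (size (rVpoly k) <= r)%N by exact: size_poly.
by move=> h1 h2; rewrite -subn1 leq_subLR add1n -addSn leq_add.
Qed.

(** At (X^m, k0) the differential of the multiplication sends (p, q) to p k0 + X^m q with deg p < m.
    It is injective because X^m and k0 are coprime, so the inverse function theorem applies. The
    last clause gives the variation of the monic factor modulo X^m, from which the Jacobians are
    computed. *)
Lemma hensel V (G : V -> {poly C}) (DG : V -> V -> 'rV[C]_(m + r)) (q0 : V) (k0 : {poly C}) :
  (forall q, (size (G q) <= m + r)%N) ->
  (forall q, sderiv (fun q => poly_rV (G q) : 'rV[C]_(m + r)) q (DG q)) ->
  G q0 = 'X^m * k0 -> k0.[0] != 0 ->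
  exists (t : V -> 'rV[C]_m) (k : V -> 'rV[C]_r), [/\ sholo t q0 /\ sholo k q0,
    t q0 = 0, rVpoly (k q0) = k0,
    close q0 (fun q => G q = ('X^m + rVpoly (t q)) * rVpoly (k q)) &
    exists (D : V -> 'rV[C]_m) (E : V -> 'rV[C]_r), sderiv t q0 D /\
      forall v, rVpoly (D v) * k0 + 'X^m * rVpoly (E v) = rVpoly (DG q0 v)].
Proof.
move=> sG dG G0 k00.
have k0n : k0 != 0 by apply: contraNneq k00 => ->; rewrite horner0.
have sk0 : (size k0 <= r)%N.
  by have := sG q0; rewrite G0 size_monicM ?monicXn // size_polyXn addSn /= leq_add2l.
pose a : 'rV[C]_(m + r) := row_mx 0 (poly_rV k0).
have la : lsubmx a = 0 by rewrite row_mxKl.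
have ra : rVpoly (rsubmx a) = k0 by rewrite row_mxKr poly_rV_K.
have fa : f a = poly_rV (G q0) by rewrite /f la ra linear0 addr0 G0.
have rv0 n (u : 'rV[C]_n) : rVpoly u = 0 -> u = 0.
  by move=> u0; rewrite -(rVpolyK u) u0 linear0.
have sizeD (h : 'rV[C]_(m + r)) : (size ('X^m * rVpoly (rsubmx h) + rVpoly (lsubmx h) * k0)%R <= m + r)%N.
  apply: leq_trans (size_polyD _ _) _; rewrite geq_max; apply/andP; split.
    by have := sizeP 0 (rsubmx h); rewrite linear0 addr0.
  apply: leq_trans (size_polyMleq _ _) _.
  have h1 : (size (rVpoly (lsubmx h)) <= m)%N by exact: size_poly.
  by apply: leq_trans (leq_pred _) (leq_add h1 sk0).
have DE h : Df a h = poly_rV ('X^m * rVpoly (rsubmx h) + rVpoly (lsubmx h) * k0).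
  by rewrite /Df la ra linear0 addr0.
have inj h : Df a h = 0 -> h = 0.
  rewrite DE => /(congr1 rVpoly); rewrite poly_rV_K // linear0 => e.
  have l0 : lsubmx h = 0.
    apply: rv0; apply/eqP; apply: contraTT isT => n0.
    have : 'X^m %| rVpoly (lsubmx h).
      have cp : coprimep 'X^m k0.
        by apply: coprimep_expl; rewrite coprimep_sym coprimepX /root.
      rewrite -(Gauss_dvdpl _ cp) -(dvdp_addr _ (dvdp_mulr (rVpoly (rsubmx h)) (dvdpp 'X^m))).
      by rewrite e dvdp0.
    by move/(dvdp_leq n0); rewrite size_polyXn leqNgt ltnS size_poly.
  have r0 : rsubmx h = 0.
    move: e; rewrite l0 linear0 mul0r addr0 => /eqP.
    rewrite mulf_eq0 -size_poly_eq0 size_polyXn /= => /eqP; exact: rv0.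
  by rewrite -(hsubmxK h) l0 r0 row_mx0.
have [L' [bL' LK LK']] := bl_injective_inverse (fD a).1 inj.
have sf : sholo f a by exists 1 => // u _; exists (Df u).
have [g [ga sg gD fg _]] := inverse_function (@gcomplete_row R _) (fD a) bL' LK LK' sf.
pose gam q : 'rV[C]_(m + r) := poly_rV (G q).
have sgam : sholo gam q0 by exists 1 => // u _; exists (DG u).
rewrite fa in ga sg gD fg.
exists (fun q => lsubmx (g (gam q))), (fun q => rsubmx (g (gam q))); split.
- split; apply: (sholo_comp (sholo_comp sgam sg)); apply: sholo_lin.
    exact: bl_lsubmx.
  exact: bl_rsubmx.
- by rewrite ga la.
- by rewrite ga ra.
- apply: closeS (sholo_continuous sgam fg) => q /(congr1 rVpoly).
  by rewrite /f !poly_rV_K //; exact: sizeP.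
exists (fun v => lsubmx (L' (DG q0 v))), (fun v => rsubmx (L' (DG q0 v))); split.
  exact: (sderiv_comp (sderiv_comp (dG q0) gD) (sderiv_lin _ (@bl_lsubmx m r))).
move=> v; rewrite -[in RHS](LK' (DG q0 v)) DE poly_rV_K ?sizeD //.
by rewrite addrC.
Qed.

End Factorization.

Lemma close_rVpoly_nonroot V r (k : V -> 'rV[C]_r) (q0 : V) (w0 : C^o) :
  sholo k q0 -> (rVpoly (k q0)).[w0] != 0 ->
  close (q0, w0) (fun x => (rVpoly (k x.1)).[x.2] != 0).
Proof.
move=> sk n0.
have s1 : sholo (fun x : V * C^o => k x.1) (q0, w0).
  have sf := sholo_lin (q0, w0) (@bl_fst R V C^o).
  exact: (sholo_comp sf sk).
have s2 := sholo_horner s1 (sholo_lin _ (@bl_snd R V C^o)).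
apply: (sholo_continuous s2 (P := fun y => y != 0)).
exists (nm ((rVpoly (k q0)).[w0] : C^o)); first exact: nm_gt0.
by move=> u ud; apply: contraTneq ud => ->; rewrite sub0r nmN -leNgt.
Qed.

End Hensel.

(** * Normal forms of the germs of the projection *)

Section NormalForms.
Variable R : realType.
Local Notation C := R[i].
Local Notation Cp := (Cplane R).
Local Notation Cs := (Cspace R).

Definition local_iso (V W : normedModType C) (psi : V -> W) (psi' : W -> V) a b :=
  [/\ sholo psi a, sholo psi' b, psi a = b /\ psi' b = a,
      close a (fun u => psi' (psi u) = u) & close b (fun y => psi (psi' y) = y)].

Lemma local_iso_germ (V W : normedModType C) (psi : V -> W) psi' a b :
  local_iso psi psi' a b -> biholomorphic_germ setT a setT b psi.
Proof.
move=> [s s' e K K']; exists psi'; split; [exact: sholo_holomorphic s|exact: sholo_holomorphic s'|exact: e| |].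
- by apply/closeP; apply: closeS K.
- by apply/closeP; apply: closeS K'.
Qed.

Lemma local_coordinates (a b : Cp -> Cplx R) (A B : Cp -> Cplx R) (q0 : Cp) :
  sholo a q0 -> sholo b q0 -> a q0 = 0 -> b q0 = 0 -> sderiv a q0 A -> sderiv b q0 B ->
  A (1, 0) * B (0, 1) - A (0, 1) * B (1, 0) != 0 ->
  exists psi', local_iso (fun q => (a q, b q)) psi' q0 (0, 0).
Proof.
move=> sa sb a0 b0 aA bB; set D : C := _ - _ => D0.
have lE (L : Cp -> Cplx R) h : bounded_linear L -> L h = L (1, 0) * h.1 + L (0, 1) * h.2.
  move=> [LD LZ _]; have {1}-> : h = h.1 *: (1, 0) + h.2 *: (0, 1).
    case: h => h1 h2; congr pair; rewrite /=.
      by rewrite /GRing.scale /= mulr1 mulr0 addr0.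
    by rewrite /GRing.scale /= mulr1 mulr0 add0r.
  by rewrite LD !LZ [RHS]addrC mulrC addrC; congr (_ + _); exact: mulrC.
pose L h : Cp := (A h, B h).
(* Cramer's rule for the matrix whose rows are [A] and [B]. *)
pose L' (y : Cp) : Cp := (D^-1 *: (B (0, 1) *: y.1 + - A (0, 1) *: y.2),
                          D^-1 *: (- B (1, 0) *: y.1 + A (1, 0) *: y.2)).
have bL' : bounded_linear L'.
  by apply: bl_pair; apply: bl_scale; apply: bl_add; apply: bl_scale;
    [exact: bl_fst|exact: bl_snd|exact: bl_fst|exact: bl_snd].
have LK u : L' (L u) = u.
  rewrite /L' /L /= (lE _ u aA.1) (lE _ u bB.1); case: u => u1 u2 /=.
  by congr pair; rewrite /GRing.scale /=; apply: (mulfI D0); rewrite mulrA mulfV // mul1r /D; ring.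
have cD (x y : C) : x * (D^-1 * y) = D^-1 * (x * y) by exact: mulrCA.
have LK' w : L (L' w) = w.
  rewrite /L (lE _ _ aA.1) (lE _ _ bB.1) /L'; case: w => w1 w2 /=.
  by congr pair; rewrite /GRing.scale /=; apply: (mulfI D0);
    rewrite !cD -mulrDr mulrA mulfV // mul1r /D; ring.
have sab := sholo_pair sa sb.
have cC : gcomplete Cp by apply: gcomplete_pair; exact: gcomplete_complex.
have [g [gq sg _ K K']] := inverse_function cC (sderiv_pair aA bB) bL' LK LK' sab.
rewrite a0 b0 in gq sg K.
by exists g; split; [exact: sab|exact: sg|rewrite a0 b0; split; [|exact: gq]|exact: K'|exact: K].
Qed.

Variables (M : set Cs) (q0 : Cp) (z0 : Cplx R).

Lemma regular_normal_form (sg : Cp -> Cplx R) : sholo sg q0 -> sg q0 = 0 ->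
  close (q0, z0) (fun x => M x <-> x.2 - z0 + sg x.1 = 0) ->
  regular_germ M (@proj_xy R) (q0, z0).
Proof.
move=> ssg sg0 HM.
have sx : sholo (fun q => (q, z0 - sg q) : Cs) q0.
  apply: sholo_pair; first exact: sholo_lin (bl_id _).
  apply: sholo_add (sholo_cst _ _) _.
  have := sholo_scale (-1) ssg; congr sholo; apply/funext => q; exact: scaleN1r.
exists (fun q => (q, z0 - sg q)); split=> //.
- exact/sholo_holomorphic/sholo_lin/bl_fst.
- exact: sholo_holomorphic sx.
- by rewrite /proj_xy sg0 subr0.
- apply/closeP; apply: closeS HM => -[q z] /= HM /HM /eqP.
  by rewrite addrAC subr_eq0 => /eqP e; split=> //; rewrite -e /proj_xy /= addrK.
- apply/closeP.
  have HM' : close (q0, z0 - sg q0) (fun x => M x <-> x.2 - z0 + sg x.1 = 0) by rewrite sg0 subr0.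
  apply: closeS (sholo_continuous sx HM') => q /= HM'' _; split=> //; apply/HM''.
  by rewrite addrAC subrK subrr.
Qed.

(* In the coordinates psi on the target the surface is the image of the germ gam,
   where iota recovers the source point from its image and the coordinate sc. *)
Lemma germ_normal_form (psi psi' : Cp -> Cp) (sg : Cp -> Cplx R) (gam : Cp -> Cp)
    (iota : Cplx R * Cp -> Cp) (sc : Cp -> Cplx R) :
  local_iso psi psi' q0 0 -> sholo sg q0 -> sg q0 = 0 -> sholo gam 0 -> gam 0 = 0 ->
  bounded_linear iota -> bounded_linear sc -> (forall u, iota (sc u, gam u) = u) ->
  (forall s y, sc (iota (s, y)) = s) ->
  close (q0, z0) (fun x => M x <-> psi x.1 = gam (iota (x.2 - z0 + sg x.1, psi x.1))) ->
  (forall e : R, 0 < e -> exists u v, [/\ u <> v, nm u < e, nm v < e & gam u = gam v]) ->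
  (exists2 phi : Cp -> Cs, biholomorphic_germ setT 0 M (q0, z0) phi &
    \forall u \near (0 : Cp), psi (proj_xy (phi u)) = gam u) /\
  ~ regular_germ M (@proj_xy R) (q0, z0).
Proof.
move=> [spsi spsi' [psi0 psi'0] K K'] ssg sg0 sgam gam0 bi bs iK sK HM ninj.
pose phi u : Cs := (psi' (gam u), z0 + sc u - sg (psi' (gam u))).
pose chi (x : Cs) : Cp := iota (x.2 - z0 + sg x.1, psi x.1).
have phi0 : phi 0 = (q0, z0) by rewrite /phi gam0 psi'0 sg0 (bl0 bs) subr0 addr0.
have chi0 : chi (q0, z0) = 0 by rewrite /chi /= subrr sg0 addr0 psi0 (bl0 bi).
have sN (V : normedModType C) (f : V -> Cplx R) a : sholo f a -> sholo (fun u => - f u) a.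
  by move=> sf; have := sholo_scale (-1) sf; congr sholo; apply/funext => u; exact: scaleN1r.
have spsi'g : sholo psi' (gam 0) by rewrite gam0; exact: spsi'.
have spg := sholo_comp sgam spsi'g.
have ssg' : sholo sg (psi' (gam 0)) by rewrite gam0 psi'0; exact: ssg.
have sphi : sholo phi 0.
  have s1 := sholo_add (sholo_cst z0 0) (sholo_lin 0 bs).
  have s2 := sN _ _ _ (sholo_comp spg ssg').
  exact: (sholo_pair spg (sholo_add s1 s2)).
have sf : sholo (fst : Cs -> Cp) (q0, z0) by apply: sholo_lin; exact: bl_fst.
have schi : sholo chi (q0, z0).
  have s1 := sholo_add (sholo_lin (q0, z0) (@bl_snd R Cp (Cplx R))) (sholo_cst (- z0) (q0, z0)).
  have s2 := sholo_add s1 (sholo_comp sf ssg).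
  exact: (sholo_comp (sholo_pair s2 (sholo_comp sf spsi)) (sholo_lin _ bi)).
have Kg : close 0 (fun u => psi (psi' (gam u)) = gam u).
  have K0 : close (gam 0) (fun y => psi (psi' y) = y) by rewrite gam0; exact: K'.
  exact: (sholo_continuous sgam K0).
have at_phi P : close (q0, z0) P -> close 0 (fun u => P (phi u)).
  by rewrite -phi0; exact: (sholo_continuous sphi).
have HMphi := at_phi _ HM.
have fwd : close 0 (fun u => M (phi u) /\ chi (phi u) = u).
  apply: closeS (closeI Kg HMphi) => u [Ku Mu].
  have e : chi (phi u) = u.
    by rewrite /chi /phi /= Ku [_ - _ + sg _]addrAC subrK [z0 + _]addrC addrK iK.
  by split=> //; apply/Mu; rewrite -[iota _]/(chi (phi u)) e /phi /= Ku.
split.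
  exists phi; last by apply/closeP; apply: closeS Kg.
  exists chi; split; [exact: sholo_holomorphic sphi|exact: sholo_holomorphic schi|by []| |].
    by apply/closeP; apply: closeS fwd.
  have K1 : close (q0, z0) (fun x => psi' (psi x.1) = x.1) by exact: (sholo_continuous sf K).
  apply/closeP; apply: closeS (closeI K1 HM) => x [K1x Mx] /Mx e; split=> //.
  rewrite /phi -[iota _]/(chi x) in e *; rewrite -e K1x /chi sK.
  by case: x {K1x Mx e} => q z /=; rewrite addrA addrK addrC subrK.
(* If the germ were regular, its local inverse would make [gam] injective near 0, while [ninj]
   provides pairs with equal images arbitrarily close to 0. *)
move=> [Psi [_ _ _ /closeP H _]].
have Hphi := at_phi _ H.
have [e e0 He] := closeI fwd Hphi.
have [u [v [uv ue ve guv]]] := ninj e e0.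
have [[Mu cu] Pu] := He u (eq_ind_r (fun x => nm x < e) ue (subr0 u)).
have [[Mv cv] Pv] := He v (eq_ind_r (fun x => nm x < e) ve (subr0 v)).
apply: uv; rewrite -cu -cv; congr chi.
rewrite -(Pu Mu).2 -(Pv Mv).2; congr Psi.
by rewrite /proj_xy /phi /= guv.
Qed.

Lemma fold_noninjective (e : R) : 0 < e ->
  exists u v : Cp, [/\ u <> v, nm u < e, nm v < e & fold_germ u = fold_germ v].
Proof.
move=> e0; pose s : Cplx R := (e / 2)%:C.
have ns : nm s < e by rewrite nm_real; lra.
exists (0, s), (0, - s); split.
- by move=> /(congr1 (fun x : Cp => complex.Re x.2)) /=; lra.
- by rewrite nm_pair_lt /= nm0 e0.
- by rewrite nm_pair_lt /= nm0 nmN e0.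
- by rewrite /fold_germ /= sqrrN.
Qed.

Lemma fold'_noninjective (e : R) : 0 < e ->
  exists u v : Cp, [/\ u <> v, nm u < e, nm v < e & fold_germ' u = fold_germ' v].
Proof.
move=> e0; pose s : Cplx R := (e / 2)%:C.
have ns : nm s < e by rewrite nm_real; lra.
exists (s, 0), (- s, 0); split.
- by move=> /(congr1 (fun x : Cp => complex.Re x.1)) /=; lra.
- by rewrite nm_pair_lt /= nm0 e0 andbT.
- by rewrite nm_pair_lt /= nm0 nmN e0 andbT.
- by rewrite /fold_germ' /= sqrrN.
Qed.

Lemma cusp_noninjective (e : R) : 0 < e ->
  exists u v : Cp, [/\ u <> v, nm u < e, nm v < e & cusp_germ u = cusp_germ v].
Proof.
(* The bound by 1 gives r^2 <= r. The points (- s^2, 0) and (- s^2, s) have the same image because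
   s^3 - s^2 s = 0. *)
move=> e0; pose r := Num.min (e / 2) 1.
have r0 : 0 < r by rewrite lt_min ltr01 divr_gt0.
have re : r < e by rewrite gt_min; apply/orP; left; lra.
have r2e : r ^+ 2 < e.
  apply: le_lt_trans re; rewrite expr2 ler_piMr ?(ltW r0) //.
  by rewrite ge_min lexx orbT.
pose s : Cplx R := r%:C.
have ns : nm s < e by rewrite nm_real // ltW.
have ns2 : nm (- s ^+ 2 : Cplx R) < e.
  by rewrite nmN expr2 nmM nm_real ?(ltW r0) // -expr2.
exists (- s ^+ 2, 0), (- s ^+ 2, s); rewrite !nm_pair_lt /= ns ns2 nm0 e0; split=> //.
  by move=> /(congr1 (fun x : Cp => complex.Re x.2)) /=; lra.
by rewrite /cusp_germ /=; congr pair; ring.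
Qed.

End NormalForms.

(** * The surface near a root of given multiplicity *)

Section Branches.
Variable R : realType.
Local Notation C := R[i].
Local Notation Cp := (Cplane R).
Local Notation Cs := (Cspace R).

Lemma bl_linear_row n p (L : {linear 'rV[C]_n -> 'rV[C]_p}) : bounded_linear L.
Proof.
have := @bl_mulmx R n p (lin1_mx L); congr bounded_linear; apply/funext => u.
exact: mul_rV_lin1.
Qed.

(** Comparison of the two lowest coefficients, on which the unknown [kap] has no influence because
    of the factor X^m. *)
Lemma translated_jet (P k0 kap d : {poly C}) (z0 : C) m :
  P * k0 + 'X^m * kap = d \Po ('X + z0%:P) ->
  ((0 < m)%N -> P`_0 * k0.[0] = d.[z0]) /\
  ((1 < m)%N -> P`_1 * k0.[0] + P`_0 * k0`_1 = (d^`()).[z0]).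
Proof.
move=> E; split=> m0.
  have := congr1 (fun p : {poly C} => p.[0]) E.
  rewrite horner_comp !hornerE expr0n gtn_eqF // mul0r addr0 => <-.
  by rewrite -horner_coef0.
have c1 (p : {poly C}) : p`_1 = (p^`()).[0] by rewrite horner_coef0 coef_deriv mulr1n.
have := congr1 (fun p : {poly C} => p`_1) E.
rewrite [in X in _ = X]c1 deriv_comp derivD derivX derivC addr0 mulr1 horner_comp !hornerE => <-.
rewrite coefD coefM !big_ord_recl big_ord0 coefXnM m0 /= /bump /= !addr0 subn0 subnn.
by rewrite horner_coef0 addrC.
Qed.

(** After the translation of the root to the origin [hensel] applies. The cofactor has no zero near
    (q0, z0), so the monic factor alone is an equation of the surface there. *)
Lemma branch n (g : Cp -> {poly C}) (Dg : Cp -> Cp -> 'rV[C]_n) (q0 : Cp) (z0 : Cplx R) m k :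
  (forall q, (size (g q) <= n)%N) ->
  (forall q, sderiv (fun q => poly_rV (g q) : 'rV[C]_n) q (Dg q)) ->
  g q0 = ('X - z0%:P) ^+ m * k -> k.[z0] != 0 ->
  exists (t D : Cp -> 'rV[C]_m), [/\ sholo t q0, t q0 = 0, sderiv t q0 D,
    close (q0, z0) (fun x : Cs => (g x.1).[x.2] = 0 <->
      ('X^m + rVpoly (t x.1)).[x.2 - z0] = 0) &
    exists2 k0 : {poly C}, k0.[0] != 0 & forall v, exists kap,
      rVpoly (D v) * k0 + 'X^m * kap = rVpoly (Dg q0 v) \Po ('X + z0%:P)].
Proof.
move=> sg dg g0 kz0.
have kn0 : k != 0 by apply: contraNneq kz0 => ->; rewrite horner0.
have mn : (m <= n)%N.
  apply: leq_trans (sg q0); rewrite g0 size_monicM ?monic_exp ?monicXsubC //.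
  by rewrite size_exp_XsubC addSn /= leq_addr.
pose r := (n - m)%N; have nE : n = (m + r)%N by rewrite subnKC.
move: r nE => r nE; subst n.
pose G q := g q \Po ('X + z0%:P).
have sG q : (size (G q) <= m + r)%N by rewrite size_comp_poly2 ?size_XaddC.
pose S : 'rV[C]_(m + r) -> 'rV[C]_(m + r) := poly_rV \o (comp_poly ('X + z0%:P)) \o rVpoly.
have bS : bounded_linear S by exact: bl_linear_row.
have dG q : sderiv (fun q => poly_rV (G q) : 'rV[C]_(m + r)) q (fun v => S (Dg q v)).
  have -> : (fun q => poly_rV (G q) : 'rV[C]_(m + r)) = (fun q => S (poly_rV (g q))).
    by apply/funext => u; rewrite /S /= (poly_rV_K (sg u)).
  exact: (sderiv_comp (dg q) (sderiv_lin _ bS)).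
have G0 : G q0 = 'X^m * (k \Po ('X + z0%:P)).
  by rewrite /G g0 rmorphM rmorphXn rmorphB /= comp_polyX comp_polyC addrK.
have k00 : (k \Po ('X + z0%:P)).[0] != 0 by rewrite horner_comp !hornerE.
have [t [K [[st sK] t0 K0 Gf [D [E [tD HD]]]]]] := hensel sG dG G0 k00.
exists t, D; split; [exact: st|exact: t0|exact: tD| |].
  have sf : sholo (fst : Cs -> Cp) (q0, z0) by apply: sholo_lin; exact: bl_fst.
  have sh : sholo (fun x : Cs => (x.1, x.2 - z0) : Cs) (q0, z0).
    have s1 := sholo_add (sholo_lin (q0, z0) (@bl_snd R Cp (Cplx R))) (sholo_cst (- z0) (q0, z0)).
    exact: (sholo_pair sf s1).
  have KN : close (q0, z0 - z0) (fun x : Cs => (rVpoly (K x.1)).[x.2] != 0).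
    apply: (close_rVpoly_nonroot sK); rewrite K0 subrr; exact: k00.
  have C1 := sholo_continuous sf Gf; have C2 := sholo_continuous sh KN.
  apply: closeS (closeI C1 C2) => x /= [Gx Kx].
  have -> : (g x.1).[x.2] = (G x.1).[x.2 - z0] by rewrite horner_comp !hornerE subrK.
  rewrite Gx hornerM; split=> [/eqP|->]; last by rewrite mul0r.
  by rewrite mulf_eq0 (negPf Kx) orbF => /eqP.
exists (k \Po ('X + z0%:P)); first exact: k00.
move=> v; exists (rVpoly (E v)); rewrite HD /S /= poly_rV_K //.
by rewrite size_comp_poly2 ?size_XaddC // size_poly.
Qed.

End Branches.

Section RootTypes.
Variable R : realType.
Local Notation C := R[i].
Local Notation Cp := (Cplane R).
Local Notation Cs := (Cspace R).
Variables (M : set Cs) (q0 : Cp) (z0 : Cplx R).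

Local Notation smooth_branch psi gam :=
  ((exists2 phi : Cp -> Cs, biholomorphic_germ setT 0 M (q0, z0) phi &
    \forall u \near (0 : Cp), psi (proj_xy (phi u)) = gam u) /\
  ~ regular_germ M (@proj_xy R) (q0, z0)).

Section Germs.
Variables (sg a b : Cp -> Cplx R) (psi' : Cp -> Cp).
Hypotheses (iso : local_iso (fun q => (a q, b q)) psi' q0 0).
Hypotheses (ssg : sholo sg q0) (sg0 : sg q0 = 0).

Let f1 : bounded_linear (fst : Cp -> Cplx R) := @bl_fst R (Cplx R) (Cplx R).
Let f2 : bounded_linear (snd : Cp -> Cplx R) := @bl_snd R (Cplx R) (Cplx R).
Let p1 : bounded_linear (fst : Cplx R * Cp -> Cplx R) := @bl_fst R (Cplx R) Cp.
Let p2 : bounded_linear (snd : Cplx R * Cp -> Cp) := @bl_snd R (Cplx R) Cp.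
Let i1 : bounded_linear (fun x : Cplx R * Cp => (x.2.1, x.1) : Cp) := bl_pair (bl_comp p2 f1) p1.
Let i2 : bounded_linear (fun x : Cplx R * Cp => (x.1, x.2.2) : Cp) := bl_pair p1 (bl_comp p2 f2).

Lemma fold_branch :
  close (q0, z0) (fun x => M x <-> (x.2 - z0 + sg x.1) ^+ 2 = b x.1) ->
  smooth_branch (fun q => (a q, b q) : Cp) (@fold_germ R).
Proof.
move=> HM; have sgam : sholo (@fold_germ R) 0.
  exact: (sholo_pair (sholo_lin 0 f1) (sholoX 2 (sholo_lin 0 f2))).
apply: (germ_normal_form iso ssg sg0 sgam _ i1 f2); last exact: fold_noninjective.
- by rewrite /fold_germ expr0n.
- by case.
- by [].
- apply: closeS HM => x [H1 H2]; split=> [/H1 e|[e]]; last exact: H2.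
  by rewrite /fold_germ /= e.
Qed.

Lemma cusp_branch :
  close (q0, z0) (fun x => M x <->
    (x.2 - z0 + sg x.1) ^+ 3 + a x.1 * (x.2 - z0 + sg x.1) = b x.1) ->
  smooth_branch (fun q => (a q, b q) : Cp) (@cusp_germ R).
Proof.
move=> HM; have sgam : sholo (@cusp_germ R) 0.
  have s1 := sholo_lin 0 f1; have s2 := sholo_lin 0 f2.
  exact: (sholo_pair s1 (sholo_add (sholoX 3 s2) (sholoM s1 s2))).
apply: (germ_normal_form iso ssg sg0 sgam _ i1 f2); last exact: cusp_noninjective.
- by rewrite /cusp_germ expr0n mul0r addr0.
- by case.
- by [].
- apply: closeS HM => x [H1 H2]; split=> [/H1 e|[e]]; last exact: H2.
  by rewrite /cusp_germ /= e.
Qed.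

Lemma fold'_branch :
  close (q0, z0) (fun x => M x <-> (x.2 - z0 + sg x.1) ^+ 2 = a x.1) ->
  smooth_branch (fun q => (a q, b q) : Cp) (@fold_germ' R).
Proof.
move=> HM; have sgam : sholo (@fold_germ' R) 0.
  exact: (sholo_pair (sholoX 2 (sholo_lin 0 f1)) (sholo_lin 0 f2)).
apply: (germ_normal_form iso ssg sg0 sgam _ i2 f1); last exact: fold'_noninjective.
- by rewrite /fold_germ' expr0n.
- by case.
- by [].
- apply: closeS HM => x [H1 H2]; split=> [/H1 e|[e]]; last exact: H2.
  by rewrite /fold_germ' /= e.
Qed.

End Germs.

Variables (n : nat) (g : Cp -> {poly C}) (Dg : Cp -> Cp -> 'rV[C]_n) (k : {poly C}).
Hypothesis sg : forall q, (size (g q) <= n)%N.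
Hypothesis dg : forall q, sderiv (fun q => poly_rV (g q) : 'rV[C]_n) q (Dg q).
Hypothesis HM : close (q0, z0) (fun x : Cs => M x <-> (g x.1).[x.2] = 0).
Hypothesis kz0 : k.[z0] != 0.

Local Notation dl v := (rVpoly (Dg q0 v)).

Let sholo_coord m (t : Cp -> 'rV[C]_m) (i : 'I_m) : sholo t q0 -> sholo (fun q => t q 0 i : Cplx R) q0.
Proof. by move=> st; exact: (sholo_comp st (sholo_lin _ (bl_coord R i))). Qed.

Let sderiv_coord m (t D : Cp -> 'rV[C]_m) (i : 'I_m) : sderiv t q0 D ->
  sderiv (fun q => t q 0 i : Cplx R) q0 (fun v => D v 0 i).
Proof. by move=> st; exact: (sderiv_comp st (sderiv_lin _ (bl_coord R i))). Qed.

Lemma simple_root_regular : g q0 = ('X - z0%:P) ^+ 1 * k ->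
  regular_germ M (@proj_xy R) (q0, z0).
Proof.
move=> g0; have [t [D [st t0 _ Ht _]]] := branch sg dg g0 kz0.
apply: (@regular_normal_form R M q0 z0 (fun q => t q 0 0)).
- exact: sholo_coord st.
- by rewrite t0 mxE.
- apply: closeS (closeI HM Ht) => x [H1 H2]; apply: iff_trans H1 _; apply: iff_trans H2 _.
  by rewrite hornerD hornerXn horner_rVpoly_sum big_ord_recl big_ord0 expr0 expr1 mulr1 addr0.
Qed.

(** Completing the square in w^2 + t_1 w + t_0: s = t_1 / 2 and e = s^2 - t_0. As s vanishes at q0,
    the differential of e there is that of - t_0, which is the variation of the fiber equation at z0
    up to sign and the unit [kap]. *)
Lemma double_root : g q0 = ('X - z0%:P) ^+ 2 * k ->
  exists (s e E : Cp -> Cplx R) (kap : C), [/\ [/\ sholo s q0, s q0 = 0, sholo e q0 & e q0 = 0],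
    sderiv e q0 E, kap != 0, forall v, E v * kap = - (dl v).[z0] &
    close (q0, z0) (fun x => M x <-> (x.2 - z0 + s x.1) ^+ 2 = e x.1)].
Proof.
move=> g0; have [t [D [st t0 tD Ht [k0 k00 HD]]]] := branch sg dg g0 kz0.
pose t_ (i : 'I_2) q : Cplx R := t q 0 i; pose i1 : 'I_2 := lift ord0 ord0.
have s_ i : sholo (t_ i) q0 := sholo_coord i st.
have d_ i : sderiv (t_ i) q0 (fun v => D v 0 i) := sderiv_coord i tD.
have t_0 i : t_ i q0 = 0 by rewrite /t_ t0 mxE.
pose s q : Cplx R := 2^-1 *: t_ i1 q.
pose e q : Cplx R := s q ^+ 2 + -1 *: t_ 0 q.
have ss : sholo s q0 := sholo_scale _ (s_ i1).
have se : sholo e q0 := sholo_add (sholoX 2 ss) (sholo_scale _ (s_ 0)).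
have s0 : s q0 = 0 by rewrite /s t_0 scaler0.
have e0 : e q0 = 0 by rewrite /e s0 t_0 scaler0 expr0n addr0.
exists s, e, (fun v => 2%:R * s q0 ^+ 1 * (2^-1 *: D v 0 i1) + -1 *: D v 0 0), k0.[0]; split.
- by split; [exact: ss|exact: s0|exact: se|exact: e0].
- exact: (sderiv_add (sderivX 2 (sderiv_scale 2^-1 (d_ i1))) (sderiv_scale (-1) (d_ 0))).
- exact: k00.
- move=> v; have [kap /translated_jet[/(_ isT) J _]] := HD v.
  by rewrite s0 expr1 mulr0 mul0r add0r scaleN1r mulNr -J -coef_rVpoly_ord.
- apply: closeS (closeI HM Ht) => x [H1 H2]; apply: iff_trans H1 _; apply: iff_trans H2 _.
  rewrite hornerD hornerXn horner_rVpoly_sum !big_ord_recl big_ord0 expr0 /=.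
  rewrite -/(t_ 0 x.1) -/(t_ i1 x.1) /e /s /bump /= expr1; set w := x.2 - z0.
  rewrite /GRing.scale /=; split=> [E|/eqP].
    by apply/eqP; rewrite -subr_eq0 -[X in _ == X]E; apply/eqP; field.
  by rewrite -subr_eq0 => /eqP E; rewrite -[RHS]E; field.
Qed.

(** Completing the cube in w^3 + t_2 w^2 + t_1 w + t_0: s = t_2 / 3, a = t_1 - 3 s^2 and b = s t_1 -
    2 s^3 - t_0. At q0 the differentials of a and b are those of t_1 and - t_0; a triangular change
    with [kap] on the diagonal relates them to the variations of the fiber equation and of its
    z-derivative. *)
Lemma triple_root : g q0 = ('X - z0%:P) ^+ 3 * k ->
  exists (s a b A B : Cp -> Cplx R) (kap kap1 : C),
   [/\ sholo s q0 /\ s q0 = 0,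
       [/\ sholo a q0, a q0 = 0, sholo b q0 & b q0 = 0],
       sderiv a q0 A /\ sderiv b q0 B,
       [/\ kap != 0, forall v, B v * kap = - (dl v).[z0] &
         forall v, A v * kap - B v * kap1 = ((dl v)^`()).[z0]] &
    close (q0, z0) (fun x => M x <->
      (x.2 - z0 + s x.1) ^+ 3 + a x.1 * (x.2 - z0 + s x.1) = b x.1)].
Proof.
move=> g0; have [t [D [st t0 tD Ht [k0 k00 HD]]]] := branch sg dg g0 kz0.
pose t_ (i : 'I_3) q : Cplx R := t q 0 i.
pose i1 : 'I_3 := lift ord0 ord0; pose i2 : 'I_3 := lift ord0 (lift ord0 ord0).
have s_ i : sholo (t_ i) q0 := sholo_coord i st.
have d_ i : sderiv (t_ i) q0 (fun v => D v 0 i) := sderiv_coord i tD.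
have t_0 i : t_ i q0 = 0 by rewrite /t_ t0 mxE.
pose s q : Cplx R := 3^-1 *: t_ i2 q.
pose a q : Cplx R := t_ i1 q + (- 3) *: s q ^+ 2.
pose b q : Cplx R := s q * t_ i1 q + ((- 2) *: s q ^+ 3 + -1 *: t_ 0 q).
have ss : sholo s q0 := sholo_scale _ (s_ i2).
have sa : sholo a q0 := sholo_add (s_ i1) (sholo_scale _ (sholoX 2 ss)).
have sb : sholo b q0 := sholo_add (sholoM ss (s_ i1))
  (sholo_add (sholo_scale _ (sholoX 3 ss)) (sholo_scale _ (s_ 0))).
have s0 : s q0 = 0 by rewrite /s t_0 scaler0.
have a0 : a q0 = 0 by rewrite /a s0 t_0 expr0n scaler0 addr0.
have b0 : b q0 = 0 by rewrite /b s0 !t_0 expr0n !scaler0 mul0r !addr0.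
have ds := sderiv_scale 3^-1 (d_ i2).
have dA := sderiv_add (d_ i1) (sderiv_scale (- 3) (sderivX 2 ds)).
have dB := sderiv_add (sderivM ds (d_ i1))
  (sderiv_add (sderiv_scale (- 2) (sderivX 3 ds)) (sderiv_scale (-1) (d_ 0))).
exists s, a, b; eexists; eexists; exists k0.[0], k0`_1; split.
- by split; [exact: ss|exact: s0].
- by split; [exact: sa|exact: a0|exact: sb|exact: b0].
- by split; [exact: dA|exact: dB].
- rewrite -/(s q0) s0 t_0; split; first exact: k00.
    move=> v; have [kap /translated_jet[/(_ isT) J _]] := HD v.
    rewrite /= mul0r mul0r add0r expr0n !mulr0 !mul0r !scaler0 !add0r scaleN1r mulNr -J.
    by rewrite -coef_rVpoly_ord.
  move=> v; have [kap /translated_jet[/(_ isT) J0 /(_ isT) J]] := HD v.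
  rewrite /= !expr0n /= !(mulr0, mul0r, scaler0, add0r, addr0) scaleN1r mulNr opprK -J.
  by rewrite -(coef_rVpoly_ord (D v) i1) -(coef_rVpoly_ord (D v) 0).
- apply: closeS (closeI HM Ht) => x [H1 H2]; apply: iff_trans H1 _; apply: iff_trans H2 _.
  rewrite hornerD hornerXn horner_rVpoly_sum !big_ord_recl big_ord0 expr0 /=.
  rewrite -/(t_ 0 x.1) -/(t_ i1 x.1) -/(t_ i2 x.1) /a /b /s /bump /= expr1.
  set w := x.2 - z0; move: (t_ 0 x.1) (t_ i1 x.1) (t_ i2 x.1) => c0 c1 c2.
  rewrite /GRing.scale /=; split=> [E|/eqP].
    by apply/eqP; rewrite -subr_eq0 -[X in _ == X]E; apply/eqP; field.
  by rewrite -subr_eq0 => /eqP E; rewrite -[RHS]E; field.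
Qed.

End RootTypes.

(** * Multisingularities of the projection *)

Section Multisingularity.
Variable R : realType.
Local Notation C := R[i].
Local Notation Cp := (Cplane R).
Local Notation Cs := (Cspace R).
Variables (M : set Cs) (q0 : Cp).
Variables (n : nat) (g : Cp -> {poly C}) (Dg : Cp -> Cp -> 'rV[C]_n).
Hypothesis sg : forall q, (size (g q) <= n)%N.
Hypothesis dg : forall q, sderiv (fun q => poly_rV (g q) : 'rV[C]_n) q (Dg q).
Hypothesis HM : forall z0 : Cplx R, z0 != 0 ->
  close (q0, z0) (fun x : Cs => M x <-> (g x.1).[x.2] = 0).
Hypothesis HM0 : forall z : Cplx R, M (q0, z) -> z != 0.

Local Notation p := (@proj_xy R).
Let d1 : {poly C} := rVpoly (Dg q0 (1, 0)).
Let d2 : {poly C} := rVpoly (Dg q0 (0, 1)).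
Let mult (m : nat) (z : C) := ('X - z%:P) ^+ m %| g q0.

Hypothesis mult_lt4 : forall z : C, z != 0 -> ~ mult 4 z.
Hypothesis smooth_fold : forall z : C, z != 0 -> mult 2 z -> (d1.[z] != 0) || (d2.[z] != 0).
Hypothesis nondegenerate_cusp : forall z : C, z != 0 -> mult 3 z ->
  d1.[z] * (d2^`()).[z] - d2.[z] * (d1^`()).[z] != 0.
Hypothesis transverse_folds : forall z1 z2 : C, z1 != 0 -> z2 != 0 -> z1 != z2 -> mult 2 z1 -> mult 2 z2 ->
  d1.[z1] * d2.[z2] - d2.[z1] * d1.[z2] != 0.
Hypothesis no_cusp_and_fold : forall z1 z2 : C, z1 != 0 -> z2 != 0 -> z1 != z2 -> mult 3 z1 -> ~ mult 2 z2.
Hypothesis no_triple_fold : forall z1 z2 z3 : C, z1 != 0 -> z2 != 0 -> z3 != 0 -> uniq [:: z1; z2; z3] ->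
  mult 2 z1 -> mult 2 z2 -> ~ mult 2 z3.

(** The target coordinates are the equation e of the discriminant curve and whichever of x, y has a
    differential independent of that of e. *)
Lemma fold_point (z0 : Cplx R) k : z0 != 0 -> g q0 = ('X - z0%:P) ^+ 2 * k -> k.[z0] != 0 ->
  multigerm_equiv M p q0 [:: (q0, z0)] [:: @fold_germ R] /\ ~ regular_germ M p (q0, z0).
Proof.
move=> z00 g0 kz0; have m2 : mult 2 z0 by rewrite /mult g0 dvdp_mulr.
have [s [e [E [kap [[ss s0 se e0] eE kap0 EE He]]]]] := double_root sg dg (HM z00) kz0 g0.
have [l [L [sl l0 lL LE]]] : exists l L : Cp -> Cplx R, [/\ sholo l q0, l q0 = 0,
    sderiv l q0 L & L (1, 0) * E (0, 1) - L (0, 1) * E (1, 0) != 0].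
  have f1 := @bl_fst R (Cplx R) (Cplx R); have f2 := @bl_snd R (Cplx R) (Cplx R).
  have E0 v : (rVpoly (Dg q0 v)).[z0] != 0 -> E v != 0.
    by rewrite -oppr_eq0 -EE; apply: contraNneq => ->; rewrite mul0r.
  have ad (f : Cp -> Cplx R) c : bounded_linear f -> sholo (fun q => f q + c) q0 /\
      sderiv (fun q => f q + c) q0 (fun v => f v + 0).
    move=> bf; split; first exact: (sholo_add (sholo_lin q0 bf) (sholo_cst c q0)).
    exact: (sderiv_add (sderiv_lin q0 bf) (sderiv_cst c q0)).
  have /orP[/E0 n0|/E0 n0] := smooth_fold z00 m2.
    have [sh sd] := ad _ (- q0.2) f2; exists (fun q => q.2 - q0.2), (fun v => v.2 + 0).
    split; [exact: sh|by rewrite subrr|exact: sd|].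
    by rewrite /= !addr0 mul0r mul1r sub0r oppr_eq0.
  have [sh sd] := ad _ (- q0.1) f1; exists (fun q => q.1 - q0.1), (fun v => v.1 + 0).
  split; [exact: sh|by rewrite subrr|exact: sd|].
  by rewrite /= !addr0 mul0r mul1r subr0.
have [psi' iso] := local_coordinates sl se l0 e0 lL eE LE.
have [br nr] := fold_branch iso ss s0 He.
split; last exact: nr.
exists (fun q => (l q, e q)); first exact: local_iso_germ iso.
by apply: List.Forall2_cons; [exact: br|exact: List.Forall2_nil].
Qed.

Lemma cusp_point (z0 : Cplx R) k : z0 != 0 -> g q0 = ('X - z0%:P) ^+ 3 * k -> k.[z0] != 0 ->
  multigerm_equiv M p q0 [:: (q0, z0)] [:: @cusp_germ R] /\ ~ regular_germ M p (q0, z0).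
Proof.
move=> z00 g0 kz0; have m3 : mult 3 z0 by rewrite /mult g0 dvdp_mulr.
have [s [a [b [A [B [kap [kap1 [[ss s0] [sa a0 sb b0] [aA bB] [kap0 BE AE] He]]]]]]]] :=
  triple_root sg dg (HM z00) kz0 g0.
have AB : A (1, 0) * B (0, 1) - A (0, 1) * B (1, 0) != 0.
  apply: contraNneq (nondegenerate_cusp z00 m3) => E; apply/eqP.
  have e v : (rVpoly (Dg q0 v)).[z0] = - (B v * kap) by rewrite BE opprK.
  rewrite /d1 /d2 !e -!AE.
  transitivity ((A (1, 0) * B (0, 1) - A (0, 1) * B (1, 0)) * kap ^+ 2); first by ring.
  by rewrite E mul0r.
have [psi' iso] := local_coordinates sa sb a0 b0 aA bB AB.
have [br nr] := cusp_branch iso ss s0 He.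
split; last exact: nr.
exists (fun q => (a q, b q)); first exact: local_iso_germ iso.
by apply: List.Forall2_cons; [exact: br|exact: List.Forall2_nil].
Qed.

(** The equations e' and e of the two branches of the discriminant serve together as target
    coordinates, by transversality. The first root is a fold along e and the second along e', whence
    the two forms of the fold. *)
Lemma double_fold_point (z1 z2 : Cplx R) k1 k2 : z1 != 0 -> z2 != 0 -> z1 != z2 ->
  g q0 = ('X - z1%:P) ^+ 2 * k1 -> k1.[z1] != 0 ->
  g q0 = ('X - z2%:P) ^+ 2 * k2 -> k2.[z2] != 0 ->
  multigerm_equiv M p q0 [:: (q0, z1); (q0, z2)] [:: @fold_germ R; @fold_germ' R].
Proof.
move=> z10 z20 z12 g1 kz1 g2 kz2.
have m1 : mult 2 z1 by rewrite /mult g1 dvdp_mulr.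
have m2 : mult 2 z2 by rewrite /mult g2 dvdp_mulr.
have [s [e [E [kap [[ss s0 se e0] eE kap0 EE He]]]]] := double_root sg dg (HM z10) kz1 g1.
have [s' [e' [E' [kap' [[ss' s0' se' e0'] eE' kap0' EE' He']]]]] :=
  double_root sg dg (HM z20) kz2 g2.
have nz : E' (1, 0) * E (0, 1) - E' (0, 1) * E (1, 0) != 0.
  apply: contraNneq (transverse_folds z10 z20 z12 m1 m2) => Z; apply/eqP.
  have h v : (rVpoly (Dg q0 v)).[z1] = - (E v * kap) by rewrite EE opprK.
  have h' v : (rVpoly (Dg q0 v)).[z2] = - (E' v * kap') by rewrite EE' opprK.
  rewrite /d1 /d2 !h !h'.
  transitivity (- (E' (1, 0) * E (0, 1) - E' (0, 1) * E (1, 0)) * (kap * kap')); first by ring.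
  by rewrite Z oppr0 mul0r.
have [psi' iso] := local_coordinates se' se e0' e0 eE' eE nz.
have [br _] := fold_branch iso ss s0 He.
have [br' _] := fold'_branch iso ss' s0' He'.
exists (fun q => (e' q, e q)); first exact: local_iso_germ iso.
apply: List.Forall2_cons; first exact: br.
by apply: List.Forall2_cons; [exact: br'|exact: List.Forall2_nil].
Qed.

Lemma no_multiple_point : multigerm_equiv M p q0 [::] [::].
Proof.
exists (fun q => q + - q0); last exact: List.Forall2_nil.
have sh c a : sholo (fun q : Cp => q + c) a.
  exact: (sholo_add (sholo_lin a (@bl_id R Cp)) (sholo_cst c a)).
apply: (@local_iso_germ R Cp Cp _ (fun q => q + q0)); split; try exact: sh.
- by rewrite subrr add0r.
- by exists 1 => // u _; rewrite subrK.
- by exists 1 => // u _; rewrite addrK.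
Qed.

(** The zero polynomial is divisible by any fourth power, so excluding quadruple roots also excludes
    vertical lines in the surface. *)
Lemma g0_neq0 : g q0 != 0.
Proof.
apply/eqP => g0; apply: (mult_lt4 (z := 1)); first exact: oner_neq0.
by rewrite /mult g0 dvdp0.
Qed.

Lemma mult2_root (z : C) : mult 2 z -> (g q0).[z] = 0.
Proof.
move=> m2; apply/rootP; rewrite -dvdp_XsubCl; apply: dvdp_trans m2.
by rewrite -{1}(expr1 ('X - z%:P)) dvdp_exp2l.
Qed.

Lemma root_shape (z : C) : z != 0 -> (g q0).[z] = 0 -> exists m k,
  [/\ g q0 = ('X - z%:P) ^+ m * k, k.[z] != 0, (0 < m)%N, (m < 4)%N & mult 2 z = (1 < m)%N].
Proof.
move=> z0 gz; have [m [k /implyP/(_ g0_neq0) kz gE]] := multiplicity_XsubC (g q0) z.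
rewrite mulrC in gE; have kz0 : k.[z] != 0 by exact: kz.
have mE j : (j <= m)%N -> mult j z.
  by move=> jm; rewrite /mult gE dvdp_mulr // dvdp_exp2l.
exists m, k; split=> //.
- rewrite lt0n; apply: contraNneq kz0 => m0.
  by rewrite -gz gE m0 expr0 mul1r.
- by rewrite ltnNge; apply/negP => /mE; exact: mult_lt4.
have [|m1] := ltnP 1 m; first exact: mE.
apply/negbTE/negP; rewrite /mult gE => dv.
have : ('X - z%:P) ^+ 2 %| ('X - z%:P) ^+ 1 * k.
  by apply: dvdp_trans dv _; rewrite dvdp_mul2r ?dvdp_exp2l //; apply: contraNneq kz0 => ->; rewrite horner0.
by rewrite exprS dvdp_mul2l ?polyXsubC_eq0 // expr1 dvdp_XsubCl /root (negPf kz0).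
Qed.

Lemma multiple_not_regular (z : Cplx R) : z != 0 -> mult 2 z -> ~ regular_germ M p (q0, z).
Proof.
move=> z0 m2.
have gz := mult2_root m2.
have [m [k [gE kz m0 m4 mE]]] := root_shape z0 gz.
move: m0 m4 mE gE; rewrite m2; case: m => [|[|[|[|m]]]] // _ _ _ gE.
  exact: (fold_point z0 gE kz).2.
exact: (cusp_point z0 gE kz).2.
Qed.

(** Simple roots are regular points and multiple roots are not, so the points to list are the
    multiple roots. What is left is none, one of multiplicity 2 or 3, or two of multiplicity 2. *)
Lemma stable_of_root_types : stable_multisingularity M p q0.
Proof.
have [rs Hrs] := poly_finite_roots g0_neq0.
pose zs := undup [seq z <- rs | (z != 0) && mult 2 z].
have zsP z : (z \in zs) = (z != 0) && mult 2 z.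
  rewrite mem_undup mem_filter; case: (z =P 0) => //= /eqP z0.
  by have [m2|//] := boolP (mult 2 z); apply: Hrs; exact: mult2_root.
have uzs : uniq zs := undup_uniq _.
exists [seq (q0, z : Cplx R) | z <- zs].
  split; first by rewrite map_inj_uniq // => x y [].
  move=> [q z]; split.
    move=> /mapP[z' + [-> ->]]; rewrite zsP => /andP[z0 m2]; split=> //.
      have [_] := close_self (HM z0); apply; exact: mult2_root.
    exact: multiple_not_regular.
  move=> [Mz]; rewrite /proj_xy /= => e; rewrite e in Mz *; move=> nr.
  have z0 := HM0 Mz; have gz : (g q0).[z] = 0 by have [+ _] := close_self (HM z0); exact.
  apply/mapP; exists z => //; rewrite zsP z0.
  have [m [k [gE kz m0 m4 ->]]] := root_shape z0 gz.
  rewrite ltn_neqAle m0 andbT; apply/eqP => m1; apply: nr.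
  rewrite -m1 in gE; exact: (simple_root_regular sg dg (HM z0) kz gE).
have shape z : z \in zs -> exists m k, [/\ z != 0, mult 2 z, g q0 = ('X - z%:P) ^+ m * k, k.[z] != 0 &
    m = 2 \/ m = 3].
  rewrite zsP => /andP[z0 m2].
  have gz := mult2_root m2.
  have [m [k [gE kz m0 m4 mE]]] := root_shape z0 gz.
  exists m, k; split=> //; move: m4 mE; rewrite m2.
  by case: m {gE m0} => [|[|[|[|m]]]] //; [left|right].
case: zs zsP uzs shape => [|z1 [|z2 [|z3 zs]]] zsP uzs shape.
- by apply: Or41; exact: no_multiple_point.
- have [m [k [z0 _ gE kz [mE|mE]]]] := shape z1 (mem_head _ _); rewrite mE in gE.
    by apply: Or42; exact: (fold_point z0 gE kz).1.
  by apply: Or43; exact: (cusp_point z0 gE kz).1.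
- have [m [k [z0 m2 gE kz mE]]] := shape z1 (mem_head _ _).
  have [|m' [k' [z0' m2' gE' kz' mE']]] := shape z2; first by rewrite !inE eqxx orbT.
  have z12 : z1 != z2 by move: uzs; rewrite /= inE andbT.
  have m3 i z k0 : g q0 = ('X - z%:P) ^+ i * k0 -> i = 3 -> mult 3 z.
    by move=> gz i3; rewrite /mult gz i3 dvdp_mulr.
  case: mE => [mE|/(m3 _ _ _ gE) /(no_cusp_and_fold z0 z0' z12)]; last by case.
  case: mE' => [mE'|/(m3 _ _ _ gE') t3]; last first.
    by case: (no_cusp_and_fold z0' z0 _ t3 m2); rewrite eq_sym.
  rewrite mE in gE; rewrite mE' in gE'.
  by apply: Or44; exact: double_fold_point gE kz gE' kz'.
- have := zsP z1; have := zsP z2; have := zsP z3; rewrite !inE !eqxx !orbT /=.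
  move=> /esym/andP[z30 m3] /esym/andP[z20 m2] /esym/andP[z10 m1].
  exfalso; apply: (no_triple_fold z10 z20 z30 _ m1 m2 m3).
  move: uzs; rewrite /= !inE !negb_or -!andbA => /and5P[-> -> _ -> _] //.
Qed.

End Multisingularity.

(** * The fiber polynomial of the surface *)

Section Projection.
Variable R : realType.
Local Notation C := R[i].
Local Notation Cp := (Cplane R).
Local Notation Cs := (Cspace R).
Variables (N : {fset lattice3}) (e1 e2 h : N -> nat) (K : nat) (c : N -> C).
Hypothesis shift : forall b, [/\ (e1 b)%:Z = (val b).1.1 + K%:Z,
  (e2 b)%:Z = (val b).1.2 + K%:Z & (h b)%:Z = (val b).2 + K%:Z].
Hypothesis c_tame : tame h e1 e2 c.

Local Notation S := (Smoment h e1 e2 c).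

Definition fiber_poly (f : N -> C) (q : Cp) : {poly C} :=
  \sum_b (f b * q.1 ^+ e1 b * q.2 ^+ e2 b * c b) *: 'X^(h b).

Local Notation g := (fiber_poly (fun=> 1)).

Lemma fiber_polyE f q z : (fiber_poly f q).[z] = S q.1 q.2 z f.
Proof.
rewrite /fiber_poly horner_sum; apply: eq_bigr => b _.
by rewrite hornerZ hornerXn mulrAC.
Qed.

Lemma euler_fiber_poly f q : 'X * (fiber_poly f q)^`() = fiber_poly (fun b => f b * (h b)%:R) q.
Proof.
rewrite /fiber_poly raddf_sum big_distrr; apply: eq_bigr => b _ /=.
rewrite derivZ derivXn -scalerAr; case: (h b) => [|m].
  by rewrite mulr0n !mulr0 !mul0r scaler0 scale0r.
by rewrite -mulr_natl mulrCA -exprS mulr_natl -scaler_nat scalerA; congr (_ *: _); ring.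
Qed.

(** The Euler operator X d/dX multiplies the weight by h and lowers the multiplicity of a root by at
    most one. *)
Lemma multiple_root_moments m (q : Cp) (z : C) : ('X - z%:P) ^+ m %| g q ->
  forall k, (k < m)%N -> S q.1 q.2 z (@hpow C N h k) = 0.
Proof.
suff H k : forall f m, ('X - z%:P) ^+ m %| fiber_poly f q -> (k < m)%N ->
    S q.1 q.2 z (fun b => f b * hpow C h k b) = 0.
  move=> dv k km; rewrite -[RHS](H k _ _ dv km).
  by apply: eq_bigr => b _; rewrite mul1r.
elim: k => [|k IH] f {}m dv; case: m dv => // m dv km.
  transitivity (fiber_poly f q).[z].
    by rewrite fiber_polyE; apply: eq_bigr => b _; rewrite /hpow expr0 mulr1.
  apply/rootP; rewrite -dvdp_XsubCl; apply: dvdp_trans dv.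
  by rewrite exprS dvdp_mulr.
rewrite -[RHS](IH (fun b => f b * (h b)%:R) m _ km); last first.
  rewrite -euler_fiber_poly; apply: dvdp_mull.
  move: dv => /dvdpP[p ->]; rewrite derivM deriv_exp.
  apply: dvdp_add; first by apply: dvdp_mull; rewrite dvdp_exp2l.
  by rewrite -mulr_natl; do 3 apply: dvdp_mull.
by apply: eq_bigr => b _; rewrite /hpow exprS mulrA.
Qed.

Let n := (\max_b h b).+1.

Lemma size_fiber_poly q : (size (g q) <= n)%N.
Proof.
apply: leq_trans (size_sum _ _ _) _; apply/bigmax_leqP => b _.
apply: leq_trans (size_scale_leq _ _) _; rewrite size_polyXn ltnS.
exact: leq_bigmax.
Qed.

Let f1 : bounded_linear (fst : Cp -> Cplx R) := @bl_fst R (Cplx R) (Cplx R).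
Let f2 : bounded_linear (snd : Cp -> Cplx R) := @bl_snd R (Cplx R) (Cplx R).

Let coef b (q : Cp) : Cplx R := q.1 ^+ e1 b * q.2 ^+ e2 b.
Let dcoef b (q v : Cp) : Cplx R :=
  q.1 ^+ e1 b * ((e2 b)%:R * q.2 ^+ (e2 b).-1 * v.2) +
  q.2 ^+ e2 b * ((e1 b)%:R * q.1 ^+ (e1 b).-1 * v.1).

Lemma bl_scale_vector (V : normedModType C) (w : V) : bounded_linear (fun s : Cplx R => s *: w).
Proof.
split=> [u v|a u|]; first exact: scalerDl.
  by rewrite -scalerA.
exists (nm w + 1); first by rewrite ltr_wpDl // nm_ge0.
by move=> s; rewrite nmZ mulrC ler_wpM2r ?nm_ge0 // lerDl.
Qed.

Definition fiber_deriv (q v : Cp) : 'rV[C]_n :=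
  \sum_b dcoef b q v *: (c b *: poly_rV 'X^(h b)).

Lemma sderiv_fiber_poly q :
  sderiv (fun q => poly_rV (g q) : 'rV[C]_n) q (fiber_deriv q).
Proof.
have -> : (fun q => poly_rV (g q) : 'rV[C]_n) =
    (fun q => \sum_b coef b q *: (c b *: poly_rV 'X^(h b))).
  apply/funext => u; rewrite /fiber_poly linear_sum; apply: eq_bigr => b _.
  by rewrite linearZ scalerA /coef mul1r.
apply: sderiv_sum => b.
have D : sderiv (coef b) q (dcoef b q).
  exact: (sderivM (sderivX (e1 b) (sderiv_lin q f1)) (sderivX (e2 b) (sderiv_lin q f2))).
exact: (sderiv_comp D (sderiv_lin _ (bl_scale_vector (c b *: poly_rV 'X^(h b) : 'rV[C]_n)))).
Qed.

Lemma fiber_derivE q v : rVpoly (fiber_deriv q v) = \sum_b (dcoef b q v * c b) *: 'X^(h b).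
Proof.
rewrite /fiber_deriv linear_sum; apply: eq_bigr => b _.
rewrite scalerA linearZ /= poly_rV_K // size_polyXn ltnS.
exact: leq_bigmax.
Qed.

Let mul_pred (x : C) m : x * (m%:R * x ^+ m.-1) = m%:R * x ^+ m.
Proof. by case: m => [|m]; rewrite ?mul0r ?mulr0 // mulrCA -exprS. Qed.

(** The factor [q.1] turns d/dx into an Euler operator, that is, into multiplication of the weight
    by [e1]. *)
Lemma fiber_deriv1 q : q.1 *: rVpoly (fiber_deriv q (1, 0)) = fiber_poly (fun b => (e1 b)%:R) q.
Proof.
rewrite fiber_derivE scaler_sumr; apply: eq_bigr => b _; rewrite scalerA; congr (_ *: _).
by rewrite /dcoef /= mulr0 mulr0 add0r mulr1 -mul_pred; ring.
Qed.

Lemma fiber_deriv2 q : q.2 *: rVpoly (fiber_deriv q (0, 1)) = fiber_poly (fun b => (e2 b)%:R) q.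
Proof.
rewrite fiber_derivE scaler_sumr; apply: eq_bigr => b _; rewrite scalerA; congr (_ *: _).
rewrite /dcoef /= !mulr0 addr0 mulr1.
transitivity (q.1 ^+ e1 b * (q.2 * ((e2 b)%:R * q.2 ^+ (e2 b).-1)) * c b : C); first by ring.
by rewrite mul_pred; ring.
Qed.

Lemma laurent_fiber_poly (x : Cs) : x.1.1 != 0 -> x.1.2 != 0 -> x.2 != 0 ->
  (g x.1).[x.2] = (x.1.1 * x.1.2 * x.2) ^+ K * laurent c x.
Proof.
move=> x0 y0 z0; rewrite fiber_polyE /Smoment /laurent big_distrr; apply: eq_bigr => b _ /=.
have [E1 E2 E3] := shift b; rewrite /laurent_monomial.
have X (w : C) (k : nat) (d : int) : w != 0 -> k%:Z = d + K%:Z -> w ^+ k = w ^ d * w ^+ K.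
  by move=> w0 E; rewrite (exprnP w k) (exprnP w K) -expfzDr // E.
by rewrite (X _ _ _ x0 E1) (X _ _ _ y0 E2) (X _ _ _ z0 E3) !exprMn; ring.
Qed.

Lemma surface_near (q0 : Cp) (z0 : Cplx R) : q0.1 != 0 -> q0.2 != 0 -> z0 != 0 ->
  close (q0, z0) (fun x : Cs => surface c x <-> (g x.1).[x.2] = 0).
Proof.
move=> x0 y0 zn0.
have near (f : Cs -> Cplx R) : bounded_linear f -> f (q0, z0) != 0 ->
    close (q0, z0) (fun x => f x != 0).
  move=> bf f0; apply: (sholo_continuous (sholo_lin _ bf) (P := fun y => y != 0)).
  exists (nm (f (q0, z0))); first exact: nm_gt0.
  by move=> u ud; apply: contraTneq ud => ->; rewrite sub0r nmN -leNgt.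
have p1 : bounded_linear (fst : Cs -> Cp) := @bl_fst R Cp (Cplx R).
have C1 := near _ (bl_comp p1 f1) x0; have C2 := near _ (bl_comp p1 f2) y0.
have C3 := near _ (@bl_snd R Cp (Cplx R)) zn0.
apply: closeS (closeI C1 (closeI C2 C3)) => x [x1 [x2 x3]].
rewrite (laurent_fiber_poly x1 x2 x3); split=> [[_ _ _ ->]|/eqP]; first by rewrite mulr0.
by rewrite mulf_eq0 expf_eq0 !mulf_eq0 (negPf x1) (negPf x2) (negPf x3) andbF => /eqP.
Qed.

(** Multiplied by the nonzero numbers x, y, z, the partial derivatives of the fiber polynomial are
    moments; each degenerate root configuration is thus one of the systems that tameness
    excludes. *)
Lemma tame_stable (q : Cp) : q.1 != 0 -> q.2 != 0 ->
  stable_multisingularity (surface c) (@proj_xy R) q.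
Proof.
move=> x0 y0; have [t1 t2 t3 [t4 t5 t6]] := c_tame.
have D1 z : q.1 * (rVpoly (fiber_deriv q (1, 0))).[z] = S q.1 q.2 z (fun b => (e1 b)%:R).
  by rewrite -hornerZ fiber_deriv1 fiber_polyE.
have D2 z : q.2 * (rVpoly (fiber_deriv q (0, 1))).[z] = S q.1 q.2 z (fun b => (e2 b)%:R).
  by rewrite -hornerZ fiber_deriv2 fiber_polyE.
have D z (d : {poly C}) a (f : N -> C) : a *: d = fiber_poly f q ->
    z * (a * (d^`()).[z]) = S q.1 q.2 z (fun b => f b * @hpow C N h 1 b).
  move=> E; rewrite -hornerZ -derivZ E -{1}(hornerX z) -hornerM euler_fiber_poly fiber_polyE.
  by apply: eq_bigr => b _; rewrite /hpow expr1.
have D1' z := D z _ _ _ (fiber_deriv1 q); have D2' z := D z _ _ _ (fiber_deriv2 q).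
have mom := @multiple_root_moments.
apply: (stable_of_root_types size_fiber_poly sderiv_fiber_poly).
- by move=> z0; exact: surface_near.
- by move=> z [].
- move=> z z0 m4; apply: t1; exists q.1, q.2, z; split=> //; exact: mom m4.
- move=> z z0 m2; rewrite -negb_and; apply/negP => /andP[/eqP d1 /eqP d2].
  apply: t2; exists q.1, q.2, z; split=> //.
  + by rewrite -[RHS](mom _ _ _ m2 0%N isT); apply: eq_bigr => b _; rewrite /hpow expr0.
  + by rewrite -D1 d1 mulr0.
  + by rewrite -D2 d2 mulr0.
  + by rewrite -[RHS](mom _ _ _ m2 1%N isT); apply: eq_bigr => b _; rewrite /hpow expr1.
- move=> z z0 m3; apply/eqP => E; apply: t3; exists q.1, q.2, z; split=> //; first exact: mom m3.
  have {}E := congr1 (fun w => q.1 * q.2 * z * w) E; rewrite mulr0 in E.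
  by rewrite -D1 -D2 -D1' -D2' -[RHS]E; ring.
- move=> z1 z2 z10 z20 z12 m1 m2; apply/eqP => E; apply: t4; exists q.1, q.2, z1, z2.
  split=> //; [exact: mom m1|exact: mom m2|].
  have {}E := congr1 (fun w => q.1 * q.2 * w) E; rewrite mulr0 in E.
  by rewrite -!D1 -!D2 -[RHS]E; ring.
- move=> z1 z2 z10 z20 z12 m1 m2; apply: t5; exists q.1, q.2, z1, z2.
  by split=> //; [exact: mom m1|exact: mom m2].
- move=> z1 z2 z3 z10 z20 z30; rewrite /= !inE negb_or andbT => /andP[/andP[z12 z13] z23] m1 m2 m3.
  apply: t6; exists q.1, q.2, (fun j => nth 0 [:: z1; z2; z3] j); split=> //=.
    by split; rewrite eq_sym.
  by move=> [|[|[|j]]] k // _ kl; [exact: mom m1 _ kl|exact: mom m2 _ kl|exact: mom m3 _ kl].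
Qed.

End Projection.

Theorem theorem1p6 (R : realType) (K : set (real_space R))
    (N : {fset lattice3})
    (HK : convex_polytope K)
    (HN : forall b : lattice3, b \in N <-> K (lattice_to_real R b))
    (HA6 : (6 <= #|` heights N|)%N)
    (HAP : forall a b : int, arith_prog a b `<` setT ->
      ~ exists2 B : {fset int},
          (B `<=` heights N)%fset /\ #|` B| = (#|` heights N| - 1)%N &
          [set` B] `<=` arith_prog a b) :
  exists U : set (N -> complex R),
    [/\ zariski_open U, U !=set0 &
        forall c : N -> complex R, U c ->
        forall q : Cplane R, q.1 != 0 -> q.2 != 0 ->
          stable_multisingularity (surface c) (@proj_xy R) q].
Proof.
have [U [e1 [e2 [h [K0 [oU neU shift tU]]]]]] := generic_tame R HA6 HAP.
exists U; split=> // c Uc q q1 q2; exact: (tame_stable shift (tU c Uc)).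
Qed.
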